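(* Let $p=p(n)\to\infty$ with $p/n\to\gamma\in(0,\infty)$. For every finite $\Omega$, $$\sup_{0\le\omega\le\Omega}\big\|G_n^{\mathrm{sph}}(\omega)-G_n(\omega)\big\|_{\mathrm{TV}}=O\big(p^{-1/2}\big).$$
   Context: For a positive definite $p\times p$ matrix $\Sigma$, $P_{n,\Sigma}$ is the law of a sample of $n$ i.i.d. $N_p(0,\Sigma)$ observations. For a symmetric $p\times p$ matrix $M$ and $\omega\ge0$ put $A=\omega M/n$ and $\Sigma_\omega(M)=(I_p+A+A^2)^{-1}$, which is positive definite for every symmetric $M$. $Q_n$ is the GOE law on symmetric $p\times p$ matrices: independent upper-triangular entries, $H_{ij}\sim N(0,1)$ for $i<j$, $H_{ii}\sim N(0,2)$. $Q_n^{\mathrm{sph}}$ is the uniform law on the Frobenius sphere $\{S=S':\operatorname{tr}(S^2)=p^2\}$ in the space of real symmetric $p\times p$ matrices with the Frobenius inner product. The mixture laws are $G_n(\omega)(B)=\int P_{n,\Sigma_\omega(H)}(B)\,\mathrm dQ_n(H)$ and $G_n^{\mathrm{sph}}(\omega)(B)=\int P_{n,\Sigma_\omega(S)}(B)\,\mathrm dQ_n^{\mathrm{sph}}(S)$. $\|\cdot\|_{\mathrm{TV}}$ is total variation distance, $\|P-Q\|_{\mathrm{TV}}=\sup_B|P(B)-Q(B)|$. *)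

(* Defs.v *)
From HB Require Import structures.
From mathcomp Require Import all_boot all_order all_algebra.
From mathcomp Require Import all_classical all_reals all_analysis.

Set Implicit Arguments.
Unset Strict Implicit.
Unset Printing Implicit Defensive.

Import Order.TTheory GRing.Theory Num.Theory.
Import numFieldNormedType.Exports.

Local Open Scope classical_set_scope.
Local Open Scope ring_scope.
Local Open Scope ereal_scope.

Definition measure_matrix_display : measure_display.
Proof. exact. Qed.

Section measurable_matrix.
Context {R : realType}.
Variables m n : nat.

(* The sigma-algebra generated by the entries, i.e. the Borel sets of R^(m*n) *)
Let entries : 'I_(m * n) -> 'M[R]_(m, n) -> R := fun k M => mxvec M ord0 k.

Let matrix_set0 : g_sigma_preimage entries set0.
Proof. exact: sigma_algebra0. Qed.

Let matrix_setC A :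
  g_sigma_preimage entries A -> g_sigma_preimage entries (~` A).
Proof. exact: sigma_algebraC. Qed.

Let matrix_bigcup (F : _^nat) : (forall i, g_sigma_preimage entries (F i)) ->
  g_sigma_preimage entries (\bigcup_i (F i)).
Proof. exact: sigma_algebra_bigcup. Qed.

HB.instance Definition _ := @isMeasurable.Build measure_matrix_display
  'M[R]_(m, n) (g_sigma_preimage entries) matrix_set0 matrix_setC matrix_bigcup.

End measurable_matrix.

(* Product measure m 0 \x ... \x m n.-1 on n-tuples; in the uses below every
   factor is sigma-finite. *)
Fixpoint tuple_prod d (T : measurableType d) (R : realType)
    (m : nat -> set T -> \bar R) (n : nat) : set (n.-tuple T) -> \bar R :=
  match n with
  | 0 => \d_[tuple]
  | n'.+1 => pushforward (m 0%N \x @tuple_prod d T R (fun i => m i.+1) n')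
               (fun xt => [tuple of xt.1 :: xt.2])
  end.
Arguments tuple_prod {d T R} m n _ : simpl nomatch.

Section laws.
Context {R : realType}.

Definition lebesgue_rV (p : nat) : set 'rV[R]_p -> \bar R :=
  pushforward (tuple_prod (fun=> lebesgue_measure) p)
    (fun t : p.-tuple R => \row_j tnth t j).

Definition gauss_pdf p (Sigma : 'M[R]_p) (x : 'rV[R]_p) : R :=
  ((Num.sqrt ((pi *+ 2) ^+ p * \det Sigma))^-1 *
   expR (- (x *m invmx Sigma *m x^T) ord0 ord0 / 2))%R.

Definition gauss_prob p (Sigma : 'M[R]_p) : set 'rV[R]_p -> \bar R :=
  fun B => \int[@lebesgue_rV p]_(x in B) (gauss_pdf Sigma x)%:E.

Definition sample_law n p (Sigma : 'M[R]_p) :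
    set (n.-tuple 'rV[R]_p) -> \bar R :=
  tuple_prod (fun=> gauss_prob Sigma) n.

Definition Sigma_of n p (omega : R) (M : 'M[R]_p) : 'M[R]_p :=
  let A := ((omega / n%:R) *: M)%R in invmx (1%:M + A + A *m A)%R.

Definition sym_mx p : set 'M[R]_p := [set S | S^T = S].

(* [normal_prob m s] has standard deviation [s], hence the [sqrt 2] for the
   diagonal entries.  Row i of the p * p independent normals supplies the
   entries (i, j) with i <= j; those with j < i are discarded. *)
Definition goe_law p : set 'M[R]_p -> \bar R :=
  pushforward
    (tuple_prod (fun i => tuple_prod (fun j =>
       normal_prob 0%R (if i == j then Num.sqrt 2 else 1%R)) p) p)
    (fun t : p.-tuple (p.-tuple R) => \matrix_(i, j)
       (if (i <= j)%N then tnth (tnth t i) j else tnth (tnth t j) i)).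

Definition frob_dot p (S T : 'M[R]_p) : R := \tr (S^T *m T).

Definition sym_sphere p : set 'M[R]_p :=
  [set S | sym_mx S /\ \tr (S *m S) = (p%:R ^+ 2)%R].

(* A linear isometry of the space of symmetric matrices, given by a linear
   extension to all matrices; the extension is irrelevant for a law carried by
   the symmetric matrices. *)
Definition sym_isometry p (f : {linear 'M[R]_p -> 'M[R]_p}) : Prop :=
  (forall S, sym_mx S -> sym_mx (f S)) /\
  (forall S T, sym_mx S -> sym_mx T -> frob_dot (f S) (f T) = frob_dot S T).

(* The uniform law on the sphere: the (unique) probability measure carried by
   the sphere and invariant under the isometries of the ambient space. *)
Definition uniform_sym_sphere p (Q : probability 'M[R]_p R) : Prop :=
  Q (@sym_sphere p) = 1 /\
  forall f : {linear 'M[R]_p -> 'M[R]_p}, sym_isometry f ->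
    forall B, measurable B -> Q (f @^-1` B) = Q B.

Definition mixture_law n p (Q : set 'M[R]_p -> \bar R) (omega : R) :
    set (n.-tuple 'rV[R]_p) -> \bar R :=
  fun B => \int[Q]_M sample_law (Sigma_of n omega M) B.

Definition tv_dist d (T : measurableType d) (P Q : set T -> \bar R) : \bar R :=
  ereal_sup [set `|P B - Q B| | B in measurable].

End laws.

Arguments lebesgue_rV {R} p _.
Arguments goe_law {R} p _.
Arguments sym_sphere {R} p _.
Arguments sample_law {R} n {p} Sigma _.
Arguments mixture_law {R} n {p} Q omega _.

(* Main.v *)
Require Import Defs.
From HB Require Import structures.
From mathcomp Require Import all_boot all_order all_algebra.
From mathcomp Require Import ring lra.
From mathcomp Require Import all_classical all_reals all_analysis.
From mathcomp Require Import measurable_realfun.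

Set Implicit Arguments.
Unset Strict Implicit.
Unset Printing Implicit Defensive.

Import Order.TTheory GRing.Theory Num.Theory.
Import numFieldNormedType.Exports.

Local Open Scope classical_set_scope.
Local Open Scope ring_scope.

(** Radial projection couples the two mixing laws.  Write [|.|] for the Frobenius
    norm.  The law of the Gaussian orthogonal ensemble is isotropic, so the
    projection [S = p H / |H|] of [H] to the sphere has the uniform law.  Both
    mixtures are thus averages over the same [H], of the sample law at
    [Sigma_omega(S)] and of the sample law at [Sigma_omega(H)] respectively, and it
    remains to average the distance of these two sample laws.

    Two sample laws.  The precision matrix [K(M) = 1 + A + A ^ 2], with
    [A = omega M / n], equals [(A + 1 / 2) ^ 2 + 3 / 4], so it is bounded below
    uniformly in [M].  The Hellinger affinity of two centred Gaussian laws is an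
    explicit ratio of determinants of precision matrices, which is quadratically
    close to 1 in their difference ([det_perturb]).  Taken to the power [n], it
    bounds the total variation distance of the samples by [2 sqrt n |K1 - K2|]
    ([sample_law_lip]), whence a bound by
    [2 sqrt n (omega / n) |H - S| (1 + (omega / n) (|H| + |S|))]
    ([sample_law_of_lip]).

    The radius.  Here [|S| = p] and [|H - S| = | |H| - p |], so that the bound is at
    most [2 sqrt n (omega / n) (1 / p + omega / n)] times [| |H| ^ 2 - p ^ 2 |]
    ([dist_sphere_le]).  As [|H| ^ 2] is twice a sum of about [p ^ 2 / 2] independent
    squares of standard normal variables, its deviation from [p ^ 2] is [O(p)] in
    mean ([goe_radius]).  In total the distance is
    [O(n ^ (- 1 / 2) (1 + p / n)) = O(p ^ (- 1 / 2))], since [p / n] has a finite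
    positive limit.

    The projection.  That it is uniform rests on two invariance properties.  By
    reflections, all balls of a given radius centred on the sphere have the same mass
    for the uniform law ([sphere_ball_const]).  By rotations in two Gaussian
    coordinates, the joint law of [<y, H>] and [|H|] under the ensemble depends on [y]
    through [|y|] only ([goe_isotropic]), so the projection of [H] falls in all these
    balls with the same probability.  Averaging a Lipschitz function over pairs of
    nearby points, one from each law, then shows that the two laws give it the same
    integral ([uniform_is_projection]), and this applies to the probability of an
    event under the sample law as a function of the mixing matrix. *)

(** * Frobenius norm *)

Section frobenius.
Context {R : rcfType}.

Definition fsq m n (A : 'M[R]_(m, n)) : R := \sum_i \sum_j A i j ^+ 2.
Definition fnorm m n (A : 'M[R]_(m, n)) : R := Num.sqrt (fsq A).

Lemma sum_cauchy_schwarz (I : finType) (a b : I -> R) :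
  (\sum_i a i * b i) ^+ 2 <= (\sum_i a i ^+ 2) * \sum_i b i ^+ 2.
Proof.
set c := \sum_i _ * _; set A := \sum_i a _ ^+ 2; set B := \sum_i b _ ^+ 2.
have A0 : 0 <= A by apply: sumr_ge0 => i _; exact: sqr_ge0.
have key : 0 <= A * (A * B - c ^+ 2).
  have -> : A * (A * B - c ^+ 2) = \sum_i (A * b i - c * a i) ^+ 2.
    under eq_bigr => i _.
      have -> : (A * b i - c * a i) ^+ 2 =
        A ^+ 2 * b i ^+ 2 - 2 * A * c * (a i * b i) + c ^+ 2 * a i ^+ 2 by ring.
      over.
    rewrite big_split sumrB /= -!mulr_sumr -/A -/B -/c; ring.
  by apply: sumr_ge0 => i _; exact: sqr_ge0.
have [A_eq0|A_neq0] := eqVneq A 0; last first.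
  by rewrite -subr_ge0 -(pmulr_rge0 _ (_ : 0 < A)) // lt_def A_neq0.
have a0 i : a i = 0.
  apply/eqP; rewrite -sqrf_eq0; apply/eqP.
  exact: (psumr_eq0P (fun i _ => sqr_ge0 (a i)) A_eq0).
by rewrite A_eq0 mul0r /c big1 ?expr0n // => i _; rewrite a0 mul0r.
Qed.

Lemma fsq_ge0 m n (A : 'M[R]_(m, n)) : 0 <= fsq A.
Proof. by apply: sumr_ge0 => i _; apply: sumr_ge0 => j _; exact: sqr_ge0. Qed.

Lemma fnorm_ge0 m n (A : 'M[R]_(m, n)) : 0 <= fnorm A.
Proof. exact: sqrtr_ge0. Qed.

Lemma fnorm_sqr m n (A : 'M[R]_(m, n)) : fnorm A ^+ 2 = fsq A.
Proof. by rewrite sqr_sqrtr ?fsq_ge0. Qed.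

Lemma fsq_trace m n (A : 'M[R]_(m, n)) : fsq A = \tr (A *m A^T).
Proof.
by apply: eq_bigr => i _; rewrite mxE; apply: eq_bigr => j _; rewrite mxE.
Qed.

Lemma fsq_tr m n (A : 'M[R]_(m, n)) : fsq A^T = fsq A.
Proof. by rewrite !fsq_trace trmxK mxtrace_mulC. Qed.

Lemma fsq_row n (x : 'rV_n) : fsq x = \sum_j x ord0 j ^+ 2.
Proof. by rewrite /fsq big_ord1. Qed.

Lemma fsq_rows m n (A : 'M[R]_(m, n)) : fsq A = \sum_i fsq (row i A).
Proof.
by apply: eq_bigr => i _; rewrite fsq_row; apply: eq_bigr => j _; rewrite mxE.
Qed.

Lemma fsqZ m n a (A : 'M[R]_(m, n)) : fsq (a *: A) = a ^+ 2 * fsq A.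
Proof.
rewrite /fsq mulr_sumr; apply: eq_bigr => i _.
by rewrite mulr_sumr; apply: eq_bigr => j _; rewrite mxE exprMn.
Qed.

Lemma fnormZ m n a (A : 'M[R]_(m, n)) : fnorm (a *: A) = `|a| * fnorm A.
Proof. by rewrite /fnorm fsqZ sqrtrM ?sqr_ge0 // sqrtr_sqr. Qed.

Lemma fsq_eq0 m n (A : 'M[R]_(m, n)) : fsq A = 0 -> A = 0.
Proof.
rewrite /fsq => A0; apply/matrixP => i j; rewrite mxE; apply/eqP.
rewrite -sqrf_eq0; apply/eqP.
have row0 k : true -> 0 <= \sum_j A k j ^+ 2.
  by move=> _; apply: sumr_ge0 => l _; exact: sqr_ge0.
have Ai0 : \sum_j A i j ^+ 2 = 0 by exact: (psumr_eq0P row0 A0).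
exact: (psumr_eq0P (fun l _ => sqr_ge0 (A i l)) Ai0).
Qed.

Lemma fsqD m n (A B : 'M[R]_(m, n)) :
  fsq (A + B) = fsq A + fsq B + 2 * \sum_i \sum_j A i j * B i j.
Proof.
rewrite /fsq mulr_sumr -!big_split /=; apply: eq_bigr => i _.
by rewrite mulr_sumr -!big_split /=; apply: eq_bigr => j _; rewrite mxE; ring.
Qed.

Lemma fdot_le m n (A B : 'M[R]_(m, n)) :
  (\sum_i \sum_j A i j * B i j) ^+ 2 <= fsq A * fsq B.
Proof.
rewrite /fsq !pair_big /=.
exact: (sum_cauchy_schwarz (fun u : 'I_m * 'I_n => A u.1 u.2) (fun u => B u.1 u.2)).
Qed.

Lemma fnormD m n (A B : 'M[R]_(m, n)) : fnorm (A + B) <= fnorm A + fnorm B.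
Proof.
rewrite -[leRHS]ger0_norm ?addr_ge0 ?fnorm_ge0 // -sqrtr_sqr ler_wsqrtr //.
rewrite fsqD sqrrD !fnorm_sqr -mulr_natl.
suff : \sum_i \sum_j A i j * B i j <= fnorm A * fnorm B by lra.
apply: le_trans (ler_norm _) _.
by rewrite -sqrtr_sqr -sqrtrM ?fsq_ge0 // ler_wsqrtr // fdot_le.
Qed.

Lemma fnormN m n (A : 'M[R]_(m, n)) : fnorm (- A) = fnorm A.
Proof. by rewrite -scaleN1r fnormZ normrN1 mul1r. Qed.

Lemma fnormM m n p (A : 'M[R]_(m, n)) (B : 'M[R]_(n, p)) :
  fnorm (A *m B) <= fnorm A * fnorm B.
Proof.
rewrite -sqrtrM ?fsq_ge0 // ler_wsqrtr // {1 2}/fsq mulr_suml.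
apply: ler_sum => i _; rewrite -fsq_tr {1}/fsq mulr_sumr.
apply: ler_sum => j _; rewrite mxE.
apply: le_trans (sum_cauchy_schwarz _ _) _.
by rewrite le_eqVlt; apply/orP; left; apply/eqP; congr (_ * _);
  apply: eq_bigr => k _; rewrite mxE.
Qed.

End frobenius.

(** * Positive definite matrices *)

Section posdef.
Context {R : rcfType}.

Definition qform n (K : 'M[R]_n) (x : 'rV[R]_n) : R :=
  (x *m K *m x^T) ord0 ord0.

Definition posdef n (K : 'M[R]_n) : Prop :=
  K^T = K /\ forall x : 'rV[R]_n, x != 0 -> 0 < qform K x.

Lemma qform1 n (x : 'rV[R]_n) : qform 1%:M x = fsq x.
Proof. by rewrite /qform mulmx1 fsq_trace trace_mx11. Qed.

Lemma qformD n (K L : 'M[R]_n) x : qform (K + L) x = qform K x + qform L x.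
Proof. by rewrite /qform mulmxDr mulmxDl mxE. Qed.

Lemma qformZ n a (K : 'M[R]_n) x : qform (a *: K) x = a * qform K x.
Proof. by rewrite /qform -scalemxAr -scalemxAl mxE. Qed.

Lemma qform0 n (K : 'M[R]_n) : qform K 0 = 0.
Proof. by rewrite /qform mul0mx mul0mx mxE. Qed.

Lemma qform_gram n m (L : 'M[R]_(n, m)) x : qform (L *m L^T) x = fsq (x *m L).
Proof. by rewrite /qform fsq_trace trace_mx11 trmx_mul !mulmxA. Qed.

Lemma posdef_coercive n (K : 'M[R]_n) (c : R) : 0 < c -> K^T = K ->
  (forall x, c * fsq x <= qform K x) -> posdef K.
Proof.
move=> c0 Ksym Kc; split=> // x x0; apply: lt_le_trans (Kc x).
rewrite mulr_gt0 // lt_def fsq_ge0 andbT; apply: contra x0 => /eqP x0.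
by rewrite (fsq_eq0 x0).
Qed.

(** Completing the square in the first coordinate. *)
Lemma qform_schur n (a t : R) (b y : 'rV[R]_n) (C : 'M[R]_n) : a != 0 ->
  @qform (1 + n) (block_mx a%:M b b^T C) (row_mx t%:M y) =
  a * (t + (y *m b^T) ord0 ord0 / a) ^+ 2
  + qform (C - a^-1 *: (b^T *m b)) y.
Proof.
move=> a0; rewrite qformD -scaleNr qformZ {1}/qform.
have -> : qform (b^T *m b) y = (y *m b^T) ord0 ord0 ^+ 2.
  by have := qform_gram b^T y; rewrite trmxK => ->; rewrite /fsq !big_ord1.
set s := (y *m b^T) ord0 ord0.
have yb : y *m b^T = s%:M by rewrite [LHS]mx11_scalar.
have bty : b *m y^T = s%:M by rewrite -[LHS]trmxK trmx_mul trmxK yb tr_scalar_mx.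
rewrite mul_row_block tr_row_mx mul_row_col !mulmxDl !mul_scalar_mx.
have -> : y *m C *m y^T = (qform C y)%:M by rewrite [LHS]mx11_scalar.
rewrite -!scalemxAl bty yb tr_scalar_mx !mul_mx_scalar !mxE /= !mulr1n.
by field.
Qed.

Lemma det_schur n (a : R) (b : 'rV[R]_n) (C : 'M[R]_n) : a != 0 ->
  \det (block_mx a%:M b b^T C) = a * \det (C - a^-1 *: (b^T *m b)).
Proof.
move=> a0.
have -> : block_mx a%:M b b^T C =
    block_mx 1%:M 0 (a^-1 *: b^T) 1%:M *m
    block_mx a%:M b 0 (C - a^-1 *: (b^T *m b)).
  rewrite mulmx_block !mul1mx !mul0mx !addr0 -!scalemxAl.
  by rewrite mul_mx_scalar scalerA mulVf // scale1r addrC subrK.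
by rewrite det_mulmx det_lblock det_ublock !det1 !mul1r det_scalar1.
Qed.

Lemma block_symE n (K : 'M[R]_(1 + n)) : K^T = K ->
  K = block_mx (K ord0 ord0)%:M (ursubmx K) (ursubmx K)^T (drsubmx K).
Proof.
move=> Ksym; rewrite -[LHS]submxK -[ursubmx K in X in _ = X]/(ursubmx K).
congr block_mx; last by rewrite -[K in dlsubmx K]Ksym trmx_ursub.
by rewrite [LHS]mx11_scalar !mxE; congr (K _ _)%:M; apply/val_inj.
Qed.

(** This decomposition carries the inductions on the dimension: the Schur
    complement is the restriction of the form to the vectors that annihilate the
    square of [qform_schur]. *)
Lemma posdef_block n (K : 'M[R]_(1 + n)) : posdef K ->
  exists a b C, [/\ K = block_mx a%:M b b^T C, 0 < a
    & posdef (C - a^-1 *: (b^T *m b))].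
Proof.
move=> [Ksym Kpos]; move: (block_symE Ksym).
set a := K _ _; set b := ursubmx K; set C := drsubmx K => KE.
have Csym : C^T = C by rewrite /C trmx_drsub Ksym.
have a0 : 0 < a.
  have -> : a = qform K (row_mx 1%:M 0).
    rewrite /qform KE mul_row_block tr_row_mx mul_row_col !mul1mx !mul0mx.
    by rewrite trmx0 mulmx0 !addr0 tr_scalar_mx mulmx1 mxE.
  apply: Kpos; apply/eqP => /matrixP /(_ ord0 (lshift _ ord0)).
  by rewrite row_mxEl !mxE => /eqP; rewrite oner_eq0.
exists a, b, C; split=> //; split.
  by rewrite linearB /= Csym linearZ /= trmx_mul trmxK.
move=> y y0.
have -> : qform (C - a^-1 *: (b^T *m b)) y =
    qform K (row_mx (- (y *m b^T) ord0 ord0 / a)%:M y).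
  by rewrite KE qform_schur ?gt_eqF // mulNr addNr expr0n mulr0 add0r.
apply: Kpos; apply: contra y0 => /eqP.
by rewrite -[0]row_mx0 => /eq_row_mx [_ ->].
Qed.

Lemma posdef_det_gt0 n (K : 'M[R]_n) : posdef K -> 0 < \det K.
Proof.
elim: n K => [|n IH] K Kpd; first by rewrite det_mx00 ltr01.
have [a [b [C [-> a0 Spd]]]] := posdef_block Kpd.
by rewrite det_schur ?gt_eqF // mulr_gt0 // IH.
Qed.

Lemma cholesky n (K : 'M[R]_n) : posdef K -> exists L : 'M[R]_n, K = L *m L^T.
Proof.
elim: n K => [|n IH] K Kpd; first by exists 0; apply/matrixP => -[].
have [a [b [C [-> a0 Spd]]]] := posdef_block Kpd.
have [L LE] := IH _ Spd.
have s0 : Num.sqrt a != 0 by rewrite gt_eqF // sqrtr_gt0.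
exists (block_mx (Num.sqrt a)%:M 0 ((Num.sqrt a)^-1 *: b^T) L).
rewrite (@tr_block_mx _ 1 n 1 n) (@mulmx_block _ 1 n 1 n 1 n) !tr_scalar_mx trmx0 linearZ /= trmxK.
rewrite !mul0mx !mulmx0 !addr0 -!scalemxAl -!scalemxAr mul_scalar_mx mul_mx_scalar.
rewrite scale_scalar_mx -expr2 sqr_sqrtr ?ltW // mul_scalar_mx !scalerA.
by rewrite !mulVf // !scale1r -LE -invfM -expr2 sqr_sqrtr ?ltW // addrC subrK.
Qed.

Lemma nonneg_quad_disc (y b c : R) :
  (forall t u, 0 <= y * t ^+ 2 + 2 * b * t * u + c * u ^+ 2) -> b ^+ 2 <= y * c.
Proof.
move=> h; have y0 := h 1 0; rewrite expr1n expr0n /= !mulr0 mulr1 !addr0 in y0.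
have [yp|] := ltP 0 y.
  have := h (- b) y.
  have -> : y * (- b) ^+ 2 + 2 * b * - b * y + c * y ^+ 2 = y * (y * c - b ^+ 2) by ring.
  by rewrite pmulr_rge0 // subr_ge0.
move=> yle; have yE : y = 0 by apply/eqP; rewrite eq_le yle.
subst y; rewrite mul0r; have [->|b0] := eqVneq b 0; first by rewrite expr0n.
have := h (- (c + 1) / b) 1; rewrite mul0r add0r expr1n !mulr1.
have -> : 2 * b * (- (c + 1) / b) = - 2 * (c + 1) by field.
have := h 0 1; rewrite !mul0r !mulr0 add0r mul0r add0r expr1n mulr1; lra.
Qed.

(** The determinant analogue of the union bound: [\prod (1 - y_i)] is at least
    [1 - \sum y_i] for the eigenvalues [y_i] of [Y].  The Schur complement of
    [1 - y] in [1 - Y] is again of the form [1 - Y'] with [Y'] nonnegative, and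
    the trace estimate survives because of the nonnegative minors of [Y]. *)
Lemma det_1B_ge n (Y : 'M[R]_n) : Y^T = Y -> (forall x, 0 <= qform Y x) ->
  \tr Y < 1 -> 1 - \tr Y <= \det (1%:M - Y).
Proof.
elim: n Y => [|n IH]; first by move=> Y _ _ _; rewrite /mxtrace big_ord0 det_mx00 subr0.
rewrite -[n.+1]/(1 + n)%N => Y Ysym Ypsd.
move: (block_symE Ysym).
set y := Y _ _; set b := ursubmx Y; set C := drsubmx Y => YE.
have Csym : C^T = C by rewrite /C trmx_drsub Ysym.
clearbody y b C.
have trYE : \tr Y = y + \tr C by rewrite YE mxtrace_block trace_mx11 mxE.
have qE t z : qform Y (row_mx t%:M z) =
    y * t ^+ 2 + 2 * (z *m b^T) ord0 ord0 * t + qform C z.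
  rewrite {1}/qform YE mul_row_block tr_row_mx mul_row_col !mulmxDl !mul_scalar_mx.
  set s := (z *m b^T) ord0 ord0.
  have zb : z *m b^T = s%:M by rewrite [LHS]mx11_scalar.
  have btz : b *m z^T = s%:M by rewrite -[LHS]trmxK trmx_mul trmxK zb tr_scalar_mx.
  have -> : z *m C *m z^T = (qform C z)%:M by rewrite [LHS]mx11_scalar.
  rewrite -!scalemxAl btz zb tr_scalar_mx !mul_mx_scalar !mxE /= !mulr1n.
  by ring.
have Cpsd z : 0 <= qform C z.
  by have := Ypsd (row_mx 0%:M z); rewrite qE expr0n !mulr0 !add0r.
have minor j : b ord0 j ^+ 2 <= y * C j j.
  apply: nonneg_quad_disc => t u.
  have := Ypsd (row_mx t%:M (u *: delta_mx ord0 j)).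
  rewrite qE /qform linearZ /= -!scalemxAl -!scalemxAr -!rowE.
  rewrite trmx_delta -colE !mxE.
  by congr (0 <= _); ring.
have y0 : 0 <= y.
  have := Ypsd (row_mx 1%:M 0).
  by rewrite qE mul0mx mxE qform0 mulr0 mul0r !addr0 expr1n mulr1.
have trC0 : 0 <= \tr C.
  apply: sumr_ge0 => j _.
  have := Cpsd (delta_mx ord0 j).
  by rewrite /qform -rowE trmx_delta -colE !mxE.
set beta := \tr (b^T *m b).
have betaE : beta = \sum_j b ord0 j ^+ 2.
  by rewrite /beta mxtrace_mulC -fsq_trace fsq_row.
have beta_le : beta <= y * \tr C.
  by rewrite betaE /mxtrace mulr_sumr; apply: ler_sum => j _; exact: minor.
have tr1 : \tr Y < 1 -> 0 < 1 - y by rewrite trYE; lra.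
move=> trY1; have a0 := tr1 trY1; have an0 : 1 - y != 0 by rewrite gt_eqF.
pose Y' := C + (1 - y)^-1 *: (b^T *m b).
have -> : \det (1%:M - Y) = (1 - y) * \det (1%:M - Y').
  have -> : 1%:M - Y = block_mx (1 - y)%:M (- b) (- b)^T (1%:M - C) :> 'M[R]_(1 + n).
    rewrite {1}YE scalar_mx_block opp_block_mx add_block_mx !add0r.
    by rewrite -raddfN -raddfD /= linearN.
  have bb : (- b)^T *m - b = b^T *m b by rewrite [(- b)^T]raddfN /= mulNmx mulmxN opprK.
  by rewrite det_schur // bb /Y' opprD addrA.
have trY' : \tr Y' = \tr C + (1 - y)^-1 * beta by rewrite mxtraceD mxtraceZ.
have aV : (1 - y) * (1 - y)^-1 = 1 by rewrite mulfV.
have main : 1 - \tr Y <= (1 - y) * (1 - \tr Y').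
  rewrite trY' trYE.
  have -> : (1 - y) * (1 - (\tr C + (1 - y)^-1 * beta)) =
     1 - y - (1 - y) * \tr C - ((1 - y) * (1 - y)^-1) * beta by ring.
  rewrite aV; nra.
have trY'1 : \tr Y' < 1.
  by rewrite -subr_gt0 -(pmulr_rgt0 _ a0); apply: lt_le_trans main; rewrite subr_gt0.
apply: le_trans main _; rewrite ler_pM2l //; apply: IH => //.
  by rewrite linearD /= Csym linearZ /= trmx_mul trmxK.
move=> z; rewrite qformD qformZ addr_ge0 // mulr_ge0 // ?invr_ge0 ?(ltW a0) //.
have := qform_gram b^T z; rewrite trmxK => ->; exact: fsq_ge0.
Qed.

(** [L] expands lengths by [sqrt c], so that its inverse [P] contracts them.  For
    the transpose of [P], each row [v] of [F] and [w = v P'] satisfy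
    [|w| ^ 2 = <v, w P>], to which the Cauchy-Schwarz inequality applies. *)
Lemma coercive_inv_factor n (L P : 'M[R]_n) (c : R) m (F : 'M[R]_(m, n)) : 0 < c ->
  P *m L = 1%:M -> (forall x : 'rV[R]_n, c * fsq x <= fsq (x *m L)) ->
  c * fsq (F *m P^T) <= fsq F.
Proof.
move=> c0 PL Lc; rewrite (fsq_rows F) fsq_rows mulr_sumr.
apply: ler_sum => i _; rewrite row_mul; move: (row i F) => v.
set w := v *m P^T; pose u := w *m P.
have uw : c * fsq u <= fsq w by have := Lc u; rewrite /u -mulmxA PL mulmx1.
have vu : fsq w = \sum_i \sum_j v i j * u i j.
  rewrite fsq_trace {1}/w -mulmxA -trmx_mul -/u trace_mx11 mxE big_ord1.
  by apply: eq_bigr => j _; rewrite [u^T _ _]mxE.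
have := fdot_le v u; rewrite -vu => cs.
have [w0|wN] := eqVneq (fsq w) 0; first by rewrite w0 mulr0 fsq_ge0.
have wp : 0 < fsq w by rewrite lt_def wN fsq_ge0.
rewrite -(ler_pM2r wp) -mulrA -expr2.
apply: le_trans (_ : c * (fsq v * fsq u) <= _); first by rewrite ler_pM2l.
by rewrite mulrCA ler_wpM2l ?fsq_ge0.
Qed.

(** Writing [M = L L'] and [E = L^-1 D L'^-1], the ratio
    [det (M + D) det (M - D) / det M ^ 2] equals [det (1 - E ^ 2)].  The terms of
    first order in [D] have cancelled, and [det_1B_ge] applies to [E ^ 2]. *)
Lemma det_perturb n (M D : 'M[R]_n) (c : R) : 0 < c -> M^T = M -> D^T = D ->
  (forall x, c * fsq x <= qform M x) -> fsq D / c ^+ 2 < 1 ->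
  (1 - fsq D / c ^+ 2) * \det M ^+ 2 <= \det (M + D) * \det (M - D).
Proof.
move=> c0 Msym Dsym Mc D1.
have Mpd := posdef_coercive c0 Msym Mc.
have [L ML] := cholesky Mpd.
have detM := posdef_det_gt0 Mpd.
have Lu : L \in unitmx.
  rewrite unitmxE unitfE; apply/eqP => L0.
  by move: detM; rewrite ML det_mulmx L0 mul0r ltxx.
pose P := invmx L; have PL : P *m L = 1%:M by rewrite mulVmx.
have LP : L *m P = 1%:M by rewrite mulmxV.
pose E := P *m D *m P^T.
have DE : D = L *m E *m L^T.
  by rewrite /E !mulmxA LP mul1mx -mulmxA -trmx_mul LP trmx1 mulmx1.
have Esym : E^T = E by rewrite /E !trmx_mul trmxK Dsym mulmxA.
have Lc (x : 'rV[R]_n) : c * fsq x <= fsq (x *m L) by rewrite -qform_gram -ML.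
have fE : fsq E <= fsq D / c ^+ 2.
  rewrite ler_pdivlMr ?exprn_gt0 // mulrC expr2 -mulrA.
  have h1 := coercive_inv_factor (P *m D) c0 PL Lc.
  have h2 := coercive_inv_factor D c0 PL Lc.
  apply: le_trans (_ : c * fsq (P *m D) <= _); first by rewrite ler_pM2l.
  by rewrite -fsq_tr trmx_mul Dsym.
have detML : \det M = \det L ^+ 2 by rewrite ML det_mulmx det_tr expr2.
have -> : \det (M + D) * \det (M - D) = \det (1%:M - E *m E) * \det M ^+ 2.
  have -> : M + D = L *m (1%:M + E) *m L^T.
    by rewrite mulmxDr mulmxDl -DE mulmx1 -ML.
  have -> : M - D = L *m (1%:M - E) *m L^T.
    by rewrite mulmxBr mulmxBl -DE mulmx1 -ML.
  have -> : 1%:M - E *m E = (1%:M + E) *m (1%:M - E).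
    by rewrite mulmxDl mul1mx mulmxBr mulmx1 addrA subrK.
  rewrite !det_mulmx !det_tr detML; ring.
rewrite ler_pM2r ?exprn_gt0 //.
have trE : \tr (E *m E) = fsq E by rewrite fsq_trace Esym.
apply: le_trans (det_1B_ge _ _ _).
- by rewrite trE lerD2l lerN2.
- by rewrite trmx_mul Esym.
- by move=> x; rewrite -{2}Esym qform_gram fsq_ge0.
- by rewrite trE; exact: le_lt_trans fE D1.
Qed.

Definition precision n (A : 'M[R]_n) : 'M[R]_n := 1%:M + A + A *m A.

Lemma precision_sym n (A : 'M[R]_n) : A^T = A -> (precision A)^T = precision A.
Proof. by move=> As; rewrite /precision !linearD /= trmx1 trmx_mul As. Qed.

(** [1 + A + A ^ 2 = (1 / 2 + A) ^ 2 + 3 / 4]. *)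
Lemma precision_coercive n (A : 'M[R]_n) x : A^T = A ->
  3 / 4 * fsq x <= qform (precision A) x.
Proof.
move=> As; have AA := qform_gram A x; rewrite As in AA.
rewrite !qformD qform1 AA !fsq_row.
have -> : qform A x = \sum_j (x *m A) ord0 j * x ord0 j.
  by rewrite /qform mxE; apply: eq_bigr => j _; rewrite [x^T _ _]mxE.
rewrite -!big_split mulr_sumr /=; apply: ler_sum => j _.
by set u := x _ _; set w := (x *m A) _ _; have := sqr_ge0 (u / 2 + w); nra.
Qed.

Lemma precision_lip n (A B : 'M[R]_n) :
  fnorm (precision A - precision B) <= fnorm (A - B) * (1 + fnorm A + fnorm B).
Proof.
have -> : precision A - precision B = (A - B) + (A *m (A - B) + (A - B) *m B).
  rewrite /precision mulmxBr mulmxBl (addrA (A *m A - _)) subrK.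
  by rewrite opprD addrACA opprD (addrACA 1%:M) subrr add0r.
apply: le_trans (fnormD _ _) _.
have h1 := fnormD (A *m (A - B)) ((A - B) *m B).
have h2 := fnormM A (A - B); have h3 := fnormM (A - B) B.
set t := fnorm (A - B) in h2 h3 *; nra.
Qed.

End posdef.

(** * Densities and finite product measures *)

Section density.
Context d (T : measurableType d) (R : realType).
Local Open Scope ereal_scope.
Import HBNNSimple.

(** The hypothesis is the case of indicators; simple functions and monotone limits
    follow. *)
Lemma integral_density (mu nu : {measure set T -> \bar R}) (f : T -> R) :
  measurable_fun setT f -> (forall x, 0 <= f x)%R ->
  (forall A, measurable A -> nu A = \int[mu]_(x in A) (f x)%:E) ->
  forall g : T -> \bar R, measurable_fun setT g -> (forall x, 0 <= g x) ->
  \int[nu]_x g x = \int[mu]_x (g x * (f x)%:E).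
Proof.
move=> mf f0 nuE g mg g0.
have mfE : measurable_fun setT (EFin \o f) by exact/measurable_EFinP.
pose h := nnsfun_approx measurableT mg.
have hcvg x : (EFin \o h n) x @[n --> \oo] --> g x by exact: cvg_nnsfun_approx.
have hnd x a b : (a <= b)%N -> (h a x <= h b x)%R.
  by move=> ab; exact/lefP/nd_nnsfun_approx.
have -> : \int[nu]_x g x = limn (fun n => \int[nu]_x (EFin \o h n) x).
  under eq_integral => x _ do rewrite -(cvg_lim _ (hcvg x))//.
  apply: monotone_convergence => //.
  - by move=> n; exact/measurable_EFinP.
  - by move=> n x _ /=; rewrite lee_fin.
  - by move=> x _ a b ab /=; rewrite lee_fin; exact: hnd.
have -> : \int[mu]_x (g x * (f x)%:E) =
    limn (fun n => \int[mu]_x ((EFin \o h n) x * (f x)%:E)).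
  have hfcvg x : (EFin \o h n) x * (f x)%:E @[n --> \oo] --> g x * (f x)%:E.
    by apply: cvgeZr.
  under eq_integral => x _ do rewrite -(cvg_lim _ (hfcvg x))//.
  apply: monotone_convergence => //.
  - by move=> n; apply: emeasurable_funM => //; exact/measurable_EFinP.
  - by move=> n x _ /=; rewrite mule_ge0 ?lee_fin.
  - by move=> x _ a b ab /=; rewrite lee_wpmul2r ?lee_fin //; exact: hnd.
congr (limn _); apply/funext => n /=.
have mind r : measurable_fun setT (fun x => (r * \1_(h n @^-1` [set r]) x)%:E).
  by apply/measurable_EFinP; exact: measurable_funM.
transitivity (\int[nu]_x
   (\sum_(y \in range (h n)) (y * \1_(h n @^-1` [set y]) x)%:E)).
  by apply: eq_integral => t tE; rewrite /= fimfunE -fsumEFin.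
rewrite ge0_integral_fsum//; last by move=> m y Ey; exact: nnfun_muleindic_ge0.
transitivity (\int[mu]_x (\sum_(y \in range (h n))
    (y * \1_(h n @^-1` [set y]) x)%:E * (f x)%:E)); last first.
  apply: eq_integral => x _.
  rewrite -ge0_mule_fsuml => [|y]; last exact: nnfun_muleindic_ge0.
  by rewrite fsumEFin // -(fimfunE _ x).
rewrite ge0_integral_fsum//; last 2 first.
  - by move=> y; apply: emeasurable_funM.
  - move=> m y Ey; apply: mule_ge0; last by rewrite lee_fin.
    exact: nnfun_muleindic_ge0.
apply: eq_fsbigr => r rhn.
under eq_integral do rewrite EFinM.
rewrite integralZl_indic_nnsfun => //.
under [RHS]eq_integral do rewrite EFinM -muleA.
rewrite ge0_integralZl//.
- rewrite integral_indic // setIT nuE // integral_mkcond; congr (_ * _).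
  by apply: eq_integral => x _; rewrite epatch_indic muleC.
- by apply: emeasurable_funM => //; exact/measurable_EFinP.
- by move=> t Et; rewrite mule_ge0 ?lee_fin.
- by move: rhn; rewrite inE => -[t _ <-]; rewrite lee_fin.
Qed.

End density.

Section as_sigma_finite.
Context d (T : measurableType d) (R : realType).
Context (mu : {measure set T -> \bar R}).

(** A synonym of [mu] on which the proof of sigma-finiteness becomes a canonical
    structure. *)
Definition as_sigma_finite & sigma_finite setT mu : set T -> \bar R := mu.

Context (sfin : sigma_finite setT mu).
HB.instance Definition _ := Measure.on (as_sigma_finite sfin).
HB.instance Definition _ :=
  Measure_isSigmaFinite.Build _ _ _ (as_sigma_finite sfin) sfin.

End as_sigma_finite.

Section sigma_finiteness.
Local Open Scope ereal_scope.

Lemma sigma_finite_pack d (T : measurableType d) (R : realType)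
    (mu : {measure set T -> \bar R}) : sigma_finite setT mu ->
  exists nu : {sigma_finite_measure set T -> \bar R}, mu = nu :> (set T -> \bar R).
Proof. by move=> sfin; exists (as_sigma_finite sfin). Qed.

Context d1 d2 (X : measurableType d1) (Y : measurableType d2) (R : realType).

Lemma product_sigma_finite (m1 : {sigma_finite_measure set X -> \bar R})
    (m2 : {sigma_finite_measure set Y -> \bar R}) :
  exists nu : {sigma_finite_measure set (X * Y)%type -> \bar R},
    m1 \x m2 = nu :> (set (X * Y) -> \bar R).
Proof.
have /sigma_finiteP[F [FT Fnd Foo]] := sigma_finiteT m1.
have /sigma_finiteP[G [GT Gnd Goo]] := sigma_finiteT m2.
apply: (sigma_finite_pack (mu := m1 \x m2)); exists (fun k => F k `*` G k).
  apply/seteqP; split=> // -[x y] _.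
  have [i _ Fi] : (\bigcup_k F k) x by rewrite -FT.
  have [j _ Gj] : (\bigcup_k G k) y by rewrite -GT.
  exists (maxn i j) => //; split=> /=.
    exact: (subsetPset _ _ (Fnd _ _ (leq_maxl i j))).
  exact: (subsetPset _ _ (Gnd _ _ (leq_maxr i j))).
move=> k; have [mF Fk] := Foo k; have [mG Gk] := Goo k.
split; first exact: measurableX.
by rewrite /= product_measure1E// lte_mul_pinfty// ge0_fin_numE.
Qed.

Lemma pushforward_sigma_finite (m : {sigma_finite_measure set X -> \bar R})
    (f : X -> Y) (g : Y -> X) : measurable_fun setT f -> measurable_fun setT g ->
  cancel f g ->
  exists nu : {sigma_finite_measure set Y -> \bar R},
    pushforward m f = nu :> (set Y -> \bar R).
Proof.
move=> mf mg fK.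
apply: (sigma_finite_pack
  (mu := measure_function_pushforward__canonical__measure_function_Measure m mf)).
have [F FT Fm] := sigma_finiteT m.
exists (fun k => g @^-1` F k) => [|k].
  by rewrite -preimage_bigcup -FT preimage_setT.
have [Fmk Fk] := Fm k; split; first by rewrite -[X in measurable X]setTI; exact: mg.
by rewrite /= /pushforward -comp_preimage (_ : g \o f = idfun)//; apply/funext => x /=.
Qed.

End sigma_finiteness.

Section tuple_products.
Context d (T : measurableType d) (R : realType).
Local Open Scope ereal_scope.
Implicit Types m : nat -> {sigma_finite_measure set T -> \bar R}.

Let cons_pair n (xt : T * n.-tuple T) : n.+1.-tuple T := [tuple of xt.1 :: xt.2].

Let measurable_cons_pair n : measurable_fun setT (@cons_pair n).
Proof. exact: measurable_cons. Qed.

Lemma tuple_prod_sigma_finite m n :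
  exists nu : {sigma_finite_measure set (n.-tuple T) -> \bar R},
    tuple_prod m n = nu :> (set _ -> \bar R).
Proof.
elim: n m => [|n IH] m; first by exists \d_[tuple].
have [nu E] := IH (fun i => m i.+1); have [mu muE] := product_sigma_finite (m 0%N) nu.
rewrite [tuple_prod _ _]/(pushforward (m 0%N \x tuple_prod (fun i => m i.+1) n) (@cons_pair n)).
rewrite E muE.
apply: (@pushforward_sigma_finite _ _ _ _ _ mu _
  (fun t => (thead t, [tuple of behead t]))).
- exact: measurable_cons_pair.
- by apply: measurable_fun_pair; [exact: measurable_tnth|exact: measurable_behead].
- by case=> x t; congr pair; apply/val_inj.
Qed.

(** The product measure as an element of the structure that the Tonelli theorem
    asks for; it is only defined through its existence because each step of the
    recursion needs the structure on the previous one. *)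
Definition tuple_measure m n : {sigma_finite_measure set (n.-tuple T) -> \bar R} :=
  projT1 (cid (tuple_prod_sigma_finite m n)).

Lemma tuple_measureE m n : tuple_prod m n = tuple_measure m n :> (set _ -> \bar R).
Proof. by rewrite /tuple_measure; case: cid. Qed.

Lemma integral_tuple0 m (f : 0.-tuple T -> \bar R) :
  \int[tuple_measure m 0]_t f t = f [tuple].
Proof.
rewrite -tuple_measureE /=.
have -> : f = cst (f [tuple]) by apply/funext => t; rewrite (tuple0 t).
by rewrite integral_dirac//= diracT mul1e.
Qed.

Lemma integral_tupleS m n (f : n.+1.-tuple T -> \bar R) :
  measurable_fun setT f -> (forall t, 0 <= f t) ->
  \int[tuple_measure m n.+1]_t f t =
  \int[m 0%N]_x \int[tuple_measure (fun i => m i.+1) n]_t f [tuple of x :: t].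
Proof.
move=> mf f0.
have -> : tuple_measure m n.+1 =
    pushforward (m 0%N \x tuple_measure (fun i => m i.+1) n) (@cons_pair n) :> (set _ -> \bar R).
  by rewrite -!tuple_measureE.
rewrite ge0_integral_pushforward//; last exact: measurable_cons_pair.
rewrite fubini_tonelli1//; last by move=> x; exact: f0.
exact: (measurableT_comp mf (@measurable_cons_pair n)).
Qed.

Lemma measurable_cons_tuple n x : measurable_fun setT (fun t : n.-tuple T => [tuple of x :: t]).
Proof. exact: (measurable_cons (measurable_cst x) (@measurable_id _ (n.-tuple T) setT)). Qed.

Lemma measurable_integral_cons m n (f : n.+1.-tuple T -> \bar R) :
  measurable_fun setT f -> (forall t, 0 <= f t) ->
  measurable_fun setT (fun x => \int[tuple_measure m n]_t f [tuple of x :: t]).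
Proof.
move=> mf f0.
apply: (@measurable_fun_fubini_tonelli_F _ _ _ _ _ (tuple_measure m n)
  (fun xt => f [tuple of xt.1 :: xt.2])) => //.
exact: (measurableT_comp mf (@measurable_cons_pair n)).
Qed.

End tuple_products.

Section tuple_integrals.
Context d (T : measurableType d) (R : realType).
Local Open Scope ereal_scope.
Implicit Types m mu : nat -> {sigma_finite_measure set T -> \bar R}.

Lemma measurable_tuple_prod n (f : nat -> T -> R) :
  (forall i, measurable_fun setT (f i)) ->
  measurable_fun setT (fun t : n.-tuple T => (\prod_(i < n) f i (tnth t i))%R).
Proof.
move=> mf; apply: measurable_prod => i _.
exact: (measurableT_comp (mf i) (measurable_tnth i)).
Qed.

Lemma integral_tuple_density m mu (f : nat -> T -> R) n :
  (forall i, measurable_fun setT (f i)) -> (forall i x, 0 <= f i x)%R ->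
  (forall i (g : T -> \bar R), measurable_fun setT g -> (forall x, 0 <= g x) ->
     \int[m i]_x g x = \int[mu i]_x (g x * (f i x)%:E)) ->
  forall g : n.-tuple T -> \bar R, measurable_fun setT g -> (forall t, 0 <= g t) ->
  \int[tuple_measure m n]_t g t =
  \int[tuple_measure mu n]_t (g t * (\prod_(i < n) f i (tnth t i))%:E).
Proof.
elim: n m mu f => [|n IH] m mu f mf f0 mE g mg g0.
  by rewrite !integral_tuple0 big_ord0 mule1.
have mprod k (h : nat -> T -> R) : (forall i, measurable_fun setT (h i)) ->
    measurable_fun setT (fun t : k.-tuple T => (\prod_(i < k) h i (tnth t i))%:E).
  by move=> mh; apply/measurable_EFinP; exact: measurable_tuple_prod.
have prod0 k (h : nat -> T -> R) (t : k.-tuple T) : (forall i x, 0 <= h i x)%R ->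
    0 <= (\prod_(i < k) h i (tnth t i))%:E.
  by move=> h0; rewrite lee_fin; apply: prodr_ge0 => i _.
rewrite !integral_tupleS//; last first.
- by move=> t; apply: mule_ge0 => //; exact: prod0.
- by apply: emeasurable_funM => //; exact: mprod.
rewrite mE//; last first.
- by move=> x; exact: integral_ge0.
- exact: measurable_integral_cons.
apply: eq_integral => x _.
rewrite (IH (fun i => m i.+1) (fun i => mu i.+1) (fun i => f i.+1)
  (fun i => mf i.+1) (fun i => f0 i.+1) (fun i => mE i.+1))//; last first.
  exact: (measurableT_comp mg (measurable_cons_tuple _)).
rewrite -ge0_integralZr//; last 3 first.
- apply: emeasurable_funM; last by apply: (mprod _ (fun i => f i.+1)).
  exact: (measurableT_comp mg (measurable_cons_tuple _)).
- by move=> t _; apply: mule_ge0 => //; exact: (prod0 _ (fun i => f i.+1)).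
- by rewrite lee_fin.
apply: eq_integral => t _; rewrite big_ord_recl -muleA; congr (_ * _).
rewrite -EFinM mulrC; congr (_ * _)%:E.
by apply: eq_bigr => i _; rewrite tnthS.
Qed.

Lemma integral_tuple_prod m (f : nat -> T -> R) (c : nat -> R) n :
  (forall i, measurable_fun setT (f i)) -> (forall i x, 0 <= f i x)%R ->
  (forall i, \int[m i]_x (f i x)%:E = (c i)%:E) ->
  \int[tuple_measure m n]_t (\prod_(i < n) f i (tnth t i))%:E =
  (\prod_(i < n) c i)%:E.
Proof.
elim: n m f c => [|n IH] m f c mf f0 fE; first by rewrite integral_tuple0 !big_ord0.
rewrite integral_tupleS; last 2 first.
- by apply/measurable_EFinP; exact: measurable_tuple_prod.
- by move=> t; rewrite lee_fin; apply: prodr_ge0.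
have c0 i : (0 <= c i)%R.
  by rewrite -lee_fin -fE; apply: integral_ge0 => x _; rewrite lee_fin.
rewrite big_ord_recl EFinM -fE -ge0_integralZr//; last 3 first.
- exact/measurable_EFinP.
- by move=> x _; rewrite lee_fin.
- by rewrite lee_fin; apply: prodr_ge0.
apply: eq_integral => x _.
rewrite -(IH (fun i => m i.+1) (fun i => f i.+1) (fun i => c i.+1)
  (fun i => mf i.+1) (fun i => f0 i.+1) (fun i => fE i.+1)).
rewrite -ge0_integralZl//; last 3 first.
- by apply/measurable_EFinP; exact: (@measurable_tuple_prod _ (fun i => f i.+1)).
- by move=> t _; rewrite lee_fin; apply: prodr_ge0.
- by rewrite lee_fin.
apply: eq_integral => t _; rewrite big_ord_recl -EFinM; congr (_ * _)%:E.
by apply: eq_bigr => i _; rewrite tnthS.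
Qed.

Lemma integral_tuple_prod_le m (f : nat -> T -> R) (c : nat -> R) n :
  (forall i, measurable_fun setT (f i)) -> (forall i x, 0 <= f i x)%R ->
  (forall i, \int[m i]_x (f i x)%:E <= (c i)%:E) ->
  \int[tuple_measure m n]_t (\prod_(i < n) f i (tnth t i))%:E <=
  (\prod_(i < n) c i)%:E.
Proof.
move=> mf f0 fc.
have I0 i : 0 <= \int[m i]_x (f i x)%:E.
  by apply: integral_ge0 => x _; rewrite lee_fin.
have IE i : \int[m i]_x (f i x)%:E = (fine (\int[m i]_x (f i x)%:E))%:E.
  by rewrite fineK// ge0_fin_numE//; apply: le_lt_trans (fc i) _; rewrite ltry.
rewrite (integral_tuple_prod _ mf f0 IE) lee_fin; apply: ler_prod => i _.
by rewrite fine_ge0//= -lee_fin -IE fc.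
Qed.

End tuple_integrals.

(** * Random matrices *)

Section measurable_matrices.
Context d (X : measurableType d) (R : realType).

Lemma measurable_entry m n i j :
  measurable_fun [set: 'M[R]_(m, n)] (fun M : 'M[R]_(m, n) => M i j).
Proof.
move=> _ Y mY; rewrite setTI; apply: sub_sigma_algebra => /=.
rewrite -bigcup_seq/=; exists (mxvec_index i j) => /=; first by rewrite mem_index_enum.
by exists Y => //; rewrite setTI; apply/seteqP; split=> M /=; rewrite mxvecE.
Qed.

(** The sigma-algebra on matrices is generated by the entries. *)
Lemma measurable_mx m n (f : X -> 'M[R]_(m, n)) :
  (forall i j, measurable_fun setT (fun x => f x i j)) -> measurable_fun setT f.
Proof.
move=> mf; have sub : g_sigma_preimage
    (fun (k : 'I_(m * n)) (x : X) => mxvec (f x) ord0 k) `<=` measurable.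
  apply: smallest_sub; first exact: sigma_algebra_measurable.
  move=> A; rewrite -bigcup_seq /= => -[k _ [B mB <-]].
  case/mxvec_indexP: k => i j; rewrite (_ : (fun x => _) = fun x => f x i j).
    exact: mf.
  by apply/funext => x; rewrite mxvecE.
move=> _ A mA; apply: sub.
have := g_sigma_preimage_comp (fun k (M : 'M[R]_(m, n)) => mxvec M ord0 k) f.
by rewrite /comp => ->; exists A.
Qed.

Lemma measurable_mulmx m n q (f : X -> 'M[R]_(m, n)) (g : X -> 'M[R]_(n, q)) :
  measurable_fun setT f -> measurable_fun setT g ->
  measurable_fun setT (fun x => f x *m g x).
Proof.
move=> mf mg; apply: measurable_mx => i j.
under eq_fun do rewrite mxE.
by apply: measurable_sum => k; apply: measurable_funM;
  [exact: (measurableT_comp (measurable_entry _ _) mf)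
  |exact: (measurableT_comp (measurable_entry _ _) mg)].
Qed.

Lemma measurable_addmx m n (f g : X -> 'M[R]_(m, n)) :
  measurable_fun setT f -> measurable_fun setT g ->
  measurable_fun setT (fun x => f x + g x).
Proof.
move=> mf mg; apply: measurable_mx => i j.
under eq_fun do rewrite mxE.
by apply: measurable_funD;
  [exact: (measurableT_comp (measurable_entry _ _) mf)
  |exact: (measurableT_comp (measurable_entry _ _) mg)].
Qed.

Lemma measurable_submx m n (f g : X -> 'M[R]_(m, n)) :
  measurable_fun setT f -> measurable_fun setT g ->
  measurable_fun setT (fun x => f x - g x).
Proof.
move=> mf mg; apply: measurable_mx => i j.
under eq_fun do rewrite !mxE.
by apply: measurable_funB;
  [exact: (measurableT_comp (measurable_entry _ _) mf)
  |exact: (measurableT_comp (measurable_entry _ _) mg)].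
Qed.

Lemma measurable_scalemx m n (a : X -> R) (f : X -> 'M[R]_(m, n)) :
  measurable_fun setT a -> measurable_fun setT f ->
  measurable_fun setT (fun x => a x *: f x).
Proof.
move=> ma mf; apply: measurable_mx => i j.
under eq_fun do rewrite mxE.
by apply: measurable_funM => //; exact: (measurableT_comp (measurable_entry _ _) mf).
Qed.

Lemma measurable_trmx m n (f : X -> 'M[R]_(m, n)) :
  measurable_fun setT f -> measurable_fun setT (fun x => (f x)^T).
Proof.
move=> mf; apply: measurable_mx => i j; under eq_fun do rewrite mxE.
exact: (measurableT_comp (measurable_entry _ _) mf).
Qed.

Lemma measurable_det n (f : X -> 'M[R]_n) :
  measurable_fun setT f -> measurable_fun setT (fun x => \det (f x)).
Proof.
move=> mf; rewrite /determinant; apply: measurable_sum => s.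
apply: measurable_funM => //; apply: measurable_prod => i _.
exact: (measurableT_comp (measurable_entry _ _) mf).
Qed.

Lemma measurable_fsq m n (f : X -> 'M[R]_(m, n)) :
  measurable_fun setT f -> measurable_fun setT (fun x => fsq (f x)).
Proof.
move=> mf; rewrite /fsq; apply: measurable_sum => i; apply: measurable_sum => j.
apply: measurable_funX; exact: (measurableT_comp (measurable_entry _ _) mf).
Qed.

Lemma measurable_qform n (K : X -> 'M[R]_n) (y : X -> 'rV[R]_n) :
  measurable_fun setT K -> measurable_fun setT y ->
  measurable_fun setT (fun x => qform (K x) (y x)).
Proof.
move=> mK my; apply: (measurableT_comp (measurable_entry ord0 ord0)).
apply: measurable_mulmx; last exact: measurable_trmx.
exact: measurable_mulmx.
Qed.

End measurable_matrices.

(** * Gaussian integrals *)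

Section lebesgue_rows.
Context (R : realType).
Local Open Scope ereal_scope.

Definition lebesgue_seq (i : nat) :
  {sigma_finite_measure set (measurableTypeR R) -> \bar R} := lebesgue_measure.

Let row_of p (t : p.-tuple R) : 'rV[R]_p := \row_j tnth t j.

Let measurable_row_of p : measurable_fun setT (@row_of p).
Proof.
apply: measurable_mx => i j; under eq_fun do rewrite mxE.
exact: measurable_tnth.
Qed.

Lemma lebesgue_rV_sigma_finite p :
  exists nu : {sigma_finite_measure set 'rV[R]_p -> \bar R},
    lebesgue_rV p = nu :> (set _ -> \bar R).
Proof.
rewrite /lebesgue_rV (tuple_measureE lebesgue_seq).
apply: (@pushforward_sigma_finite _ _ _ _ _ (tuple_measure lebesgue_seq p) (@row_of p)
  (fun x : 'rV[R]_p => [tuple x ord0 j | j < p])).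
- exact: measurable_row_of.
- apply/measurable_fun_tnthP => j.
  rewrite (_ : _ \o _ = fun x : 'rV[R]_p => x ord0 j); first exact: measurable_entry.
  by apply/funext => x /=; rewrite tnth_mktuple.
- by move=> t; apply: eq_from_tnth => j; rewrite tnth_mktuple mxE.
Qed.

Definition leb_rV p : {sigma_finite_measure set 'rV[R]_p -> \bar R} :=
  projT1 (cid (lebesgue_rV_sigma_finite p)).

Lemma leb_rVE p : lebesgue_rV p = leb_rV p :> (set _ -> \bar R).
Proof. by rewrite /leb_rV; case: cid. Qed.

Let integral_rV_tuple p (f : 'rV[R]_p -> \bar R) :
  measurable_fun setT f -> (forall x, 0 <= f x) ->
  \int[leb_rV p]_x f x = \int[tuple_measure lebesgue_seq p]_t f (row_of t).
Proof.
move=> mf f0; rewrite -leb_rVE /lebesgue_rV (tuple_measureE lebesgue_seq).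
by rewrite ge0_integral_pushforward//; exact: measurable_row_of.
Qed.

Lemma integral_rV0 (f : 'rV[R]_0 -> \bar R) : (forall x, 0 <= f x) ->
  \int[leb_rV 0]_x f x = f 0%R.
Proof.
move=> f0.
have fE : f = cst (f 0%R).
  by apply/funext => x /=; congr f; apply/rowP => -[].
rewrite integral_rV_tuple//; last by rewrite fE; exact: measurable_cst.
by rewrite integral_tuple0 fE.
Qed.

Lemma measurable_row_mx p : measurable_fun setT
  (fun u : measurableTypeR R * 'rV[R]_p => row_mx (u.1)%:M u.2 : 'rV[R]_(1 + p)).
Proof.
apply: measurable_mx => i j.
under eq_fun do rewrite mxE.
case: (fintype.split j) => k; last exact: (measurableT_comp (measurable_entry _ _) measurable_snd).
by under eq_fun do rewrite mxE; rewrite !ord1 eqxx; exact: measurable_fst.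
Qed.

Lemma integral_rVS p (f : 'rV[R]_(1 + p) -> \bar R) :
  measurable_fun setT f -> (forall x, 0 <= f x) ->
  \int[leb_rV (1 + p)]_x f x =
  \int[lebesgue_measure]_x \int[leb_rV p]_y f (row_mx x%:M y).
Proof.
move=> mf f0; rewrite integral_rV_tuple// integral_tupleS//; last first.
  exact: (measurableT_comp mf (@measurable_row_of _)).
apply: eq_integral => x _; rewrite integral_rV_tuple//; last first.
  apply: (measurableT_comp mf).
  exact: (measurableT_comp (@measurable_row_mx p) (measurable_fun_pair (measurable_cst x) (@measurable_id _ _ setT))).
apply: eq_integral => t _; congr f; apply/rowP => j; rewrite !mxE.
case: split_ordP => k ->.
  by rewrite !ord1 mxE eqxx (tnth_nth 0%R).
by rewrite mxE -[RHS](tnthS x); congr tnth; apply/val_inj.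
Qed.

End lebesgue_rows.
Arguments leb_rV {R} p.

Section gauss_integrals.
Context (R : realType).
Local Open Scope ereal_scope.
Notation mu := (@lebesgue_measure R).

Lemma integral_gauss1 (a c : R) : (0 < a)%R ->
  \int[mu]_x (expR (- (a * (x + c) ^+ 2) / 2))%:E = (Num.sqrt (pi *+ 2 / a))%:E.
Proof.
move=> a0; pose s : R := (Num.sqrt a)^-1%R.
have s0 : s != 0%R by rewrite invr_eq0 gt_eqF ?sqrtr_gt0.
have s2 : (s ^+ 2 = a^-1)%R by rewrite exprVn sqr_sqrtr ?ltW.
have peak0 := normal_peak_gt0 s0.
have := @integral_normal_pdf R (- c) s.
rewrite normal_pdfE//.
under eq_integral do rewrite EFinM.
rewrite ge0_integralZl//=; last 3 first.
- by apply/measurable_EFinP; exact: measurable_normal_fun.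
- by move=> x _; rewrite lee_fin normal_fun_ge0.
- by rewrite lee_fin ltW.
have -> : \int[mu]_x (normal_fun (- c) s x)%:E =
    \int[mu]_x (expR (- (a * (x + c) ^+ 2) / 2))%:E.
  apply: eq_integral => x _; congr (expR _)%:E; rewrite s2 opprK.
  by rewrite -mulr_natr; field; rewrite gt_eqF.
move=> h; have := congr1 (fun u => ((normal_peak s)^-1)%:E * u) h.
rewrite muleA -EFinM mulVf ?gt_eqF// mul1e mule1 => ->.
by rewrite /normal_peak invrK s2; rewrite -mulrnAr mulrC.
Qed.

Lemma measurable_gauss p (K : 'M[R]_p) :
  measurable_fun setT (fun x : 'rV[R]_p => expR (- qform K x / 2)%R).
Proof.
apply: measurableT_comp => //; apply: measurable_funM => //.
by apply: measurableT_comp => //; apply: measurable_qform => //; exact: measurable_cst.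
Qed.

(** Integrating out the first coordinate leaves the Gaussian integral of the Schur
    complement; the determinant builds up through [det_schur]. *)
Lemma integral_gauss p (K : 'M[R]_p) : posdef K ->
  \int[leb_rV p]_x (expR (- qform K x / 2))%:E =
  (Num.sqrt ((pi *+ 2) ^+ p / \det K))%:E.
Proof.
elim: p K => [|p IH] K Kpd.
  rewrite integral_rV0; last by move=> x; rewrite lee_fin expR_ge0.
  by rewrite qform0 oppr0 mul0r expR0 det_mx00 expr0 divr1 sqrtr1.
have mK : measurable_fun setT (fun x : 'rV[R]_p.+1 => (expR (- qform K x / 2))%:E).
  by apply/measurable_EFinP; exact: measurable_gauss.
rewrite (@integral_rVS R p (fun x => (expR (- qform K x / 2))%:E))//.
rewrite (fubini_tonelli (fun u : measurableTypeR R * 'rV[R]_p =>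
    (expR (- qform K (row_mx (u.1)%:M u.2 : 'rV_(1 + p)) / 2))%:E)); last 2 first.
- exact: (measurableT_comp mK (@measurable_row_mx R p)).
- by move=> u; rewrite lee_fin expR_ge0.
have [a [b [C [KE a0 Spd]]]] := posdef_block Kpd.
set S := (C - _)%R in Spd *.
transitivity (\int[leb_rV p]_y ((Num.sqrt (pi *+ 2 / a))%:E *
    (expR (- qform S y / 2))%:E)).
  apply: eq_integral => y _.
  transitivity (\int[mu]_x
      ((expR (- (a * (x + (y *m b^T) ord0 ord0 / a) ^+ 2) / 2))%:E *
       (expR (- qform S y / 2))%:E)).
    apply: eq_integral => x _ /=.
    by rewrite KE qform_schur ?gt_eqF// opprD mulrDl expRD EFinM.
  rewrite ge0_integralZr//; last first.
    apply/measurable_EFinP; apply: measurableT_comp => //; apply: measurable_funM => //.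
    apply: measurableT_comp => //; apply: measurable_funM => //.
    by apply: measurable_funX; exact: measurable_funD.
  by rewrite integral_gauss1.
rewrite ge0_integralZl//; last first.
  by apply/measurable_EFinP; exact: measurable_gauss.
have pia0 : (0 <= pi *+ 2 / a :> R)%R.
  by apply: divr_ge0; [rewrite mulrn_wge0// pi_ge0|exact: ltW].
rewrite IH// -EFinM -sqrtrM//.
rewrite KE det_schur ?gt_eqF// -/S; congr (Num.sqrt _)%:E.
have dS := posdef_det_gt0 Spd.
by rewrite exprS; field; rewrite !gt_eqF.
Qed.

End gauss_integrals.

(** * Total variation distance between Gaussian samples *)

Section density_measure.
Context d (T : measurableType d) (R : realType).
Context (mu : {measure set T -> \bar R}) (f : T -> R).
Local Open Scope ereal_scope.

Definition density_measure & measurable_fun setT f & (forall x, 0 <= f x)%R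
    & \int[mu]_x (f x)%:E = 1 : set T -> \bar R :=
  fun A => \int[mu]_(x in A) (f x)%:E.

Context (mf : measurable_fun setT f) (f0 : (forall x, 0 <= f x)%R).
Context (f1 : \int[mu]_x (f x)%:E = 1).
Notation nu := (density_measure mf f0 f1).

Let density0 : nu set0 = 0.
Proof. by rewrite /density_measure integral_set0. Qed.

Let density_ge0 A : 0 <= nu A.
Proof. by apply: integral_ge0 => x _; rewrite lee_fin. Qed.

Let density_sigma_additive : semi_sigma_additive nu.
Proof.
move=> A mA tA mUA; rewrite /density_measure ge0_integral_bigcup//.
- apply: is_cvg_ereal_nneg_natsum_cond => n _ _.
  by apply: integral_ge0 => x _; rewrite lee_fin.
- by apply/measurable_EFinP; exact: measurable_funTS.
- by move=> x _; rewrite lee_fin.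
Qed.

HB.instance Definition _ := isMeasure.Build _ _ _
  nu density0 density_ge0 density_sigma_additive.

HB.instance Definition _ := @Measure_isProbability.Build _ _ R nu f1.

End density_measure.

Section hellinger.
Context d (T : measurableType d) (R : realType).
Local Open Scope ereal_scope.

(** A quantitative form of the Cauchy-Schwarz bound of total variation by
    Hellinger distance: with [u = sqrt f] and [v = sqrt g],
    [u ^ 2 - v ^ 2 = (u - v) (u + v)] is at most
    [l / 2 * (u - v) ^ 2 + (u + v) ^ 2 / (2 * l)], where [(u - v) ^ 2] has
    integral [2 - 2 a] and [(u + v) ^ 2] has integral at most 4. *)
Lemma le_hellinger (mu : {measure set T -> \bar R}) (f g h : T -> R) (a l : R) B :
  measurable_fun setT f -> measurable_fun setT g -> measurable_fun setT h ->
  (forall x, 0 <= f x)%R -> (forall x, 0 <= g x)%R -> (forall x, 0 <= h x)%R ->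
  (forall x, h x ^+ 2 = f x * g x)%R ->
  \int[mu]_x (f x)%:E = 1 -> \int[mu]_x (g x)%:E = 1 ->
  \int[mu]_x (h x)%:E = a%:E -> (0 < l)%R -> measurable B ->
  \int[mu]_x ((\1_B x)%:E * (f x)%:E) + (l * a)%:E <=
  \int[mu]_x ((\1_B x)%:E * (g x)%:E) + (l + 2 / l)%:E.
Proof.
move=> mf mg mh f0 g0 h0 hfg f1 g1 ha l0 mB.
have mfE : measurable_fun setT (EFin \o f) by exact/measurable_EFinP.
have mgE : measurable_fun setT (EFin \o g) by exact/measurable_EFinP.
have mhE : measurable_fun setT (EFin \o h) by exact/measurable_EFinP.
have mI : measurable_fun setT (fun x : T => (\1_B x)%:E : \bar R).
  exact/measurable_EFinP.
have fE0 x : setT x -> 0 <= (f x)%:E by rewrite lee_fin.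
have gE0 x : setT x -> 0 <= (g x)%:E by rewrite lee_fin.
have hE0 x : setT x -> 0 <= (h x)%:E by rewrite lee_fin.
have I0 (k : T -> R) x : (forall x, 0 <= k x)%R -> 0 <= (\1_B x)%:E * (k x)%:E.
  by move=> k0; rewrite -EFinM lee_fin mulr_ge0.
pose c : R := (l / 2 + l^-1)%R.
have c0 : (0 <= c)%R by rewrite addr_ge0 ?divr_ge0 ?invr_ge0 ?(ltW l0).
have -> : (l * a)%:E = \int[mu]_x (l%:E * (h x)%:E).
  by rewrite ge0_integralZl ?ha// lee_fin ltW.
have -> : (l + 2 / l)%:E = \int[mu]_x (c%:E * ((f x)%:E + (g x)%:E)).
  rewrite ge0_integralZl//; last 2 first.
  - exact: emeasurable_funD.
  - by move=> x _; rewrite adde_ge0 ?lee_fin.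
  rewrite ge0_integralD// f1 g1 -EFinD -EFinM; congr EFin.
  by rewrite /c; field; rewrite gt_eqF.
have If0 x : setT x -> 0 <= (\1_B x)%:E * (f x)%:E by move=> _; exact: I0.
have Ig0 x : setT x -> 0 <= (\1_B x)%:E * (g x)%:E by move=> _; exact: I0.
have lh0 x : setT x -> 0 <= l%:E * (h x)%:E.
  by move=> _; rewrite -EFinM lee_fin mulr_ge0// ltW.
have cfg0 x : setT x -> 0 <= c%:E * ((f x)%:E + (g x)%:E).
  by move=> _; rewrite -EFinD -EFinM lee_fin mulr_ge0// addr_ge0.
have mIf : measurable_fun setT (fun x => (\1_B x)%:E * (f x)%:E) by exact: emeasurable_funM.
have mIg : measurable_fun setT (fun x => (\1_B x)%:E * (g x)%:E) by exact: emeasurable_funM.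
have mlh : measurable_fun setT (fun x => l%:E * (h x)%:E) by exact: emeasurable_funM.
have mcfg : measurable_fun setT (fun x => c%:E * ((f x)%:E + (g x)%:E)).
  by apply: emeasurable_funM => //; exact: emeasurable_funD.
rewrite -!ge0_integralD//; apply: ge0_le_integral => //.
- by move=> x Tx; rewrite adde_ge0 ?If0 ?lh0.
- exact: emeasurable_funD.
- exact: emeasurable_funD.
move=> x _; rewrite -[(f x)%:E + _]EFinD -!EFinM -!EFinD lee_fin.
pose u := Num.sqrt (f x); pose v := Num.sqrt (g x).
have fE : f x = (u ^+ 2)%R by rewrite sqr_sqrtr.
have gE : g x = (v ^+ 2)%R by rewrite sqr_sqrtr.
have hE : h x = (u * v)%R.
  apply/eqP; rewrite -(@eqrXn2 _ 2)// ?mulr_ge0 ?sqrtr_ge0//.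
  by rewrite hfg exprMn fE gE.
have b01 : (\1_B x = 0 :> R)%R \/ (\1_B x = 1 :> R)%R.
  by rewrite indicE; case: (_ \in _); [right|left].
have cE : (c = l / 2 + l^-1)%R by [].
have ll : (l * l^-1 = 1)%R by rewrite mulfV// gt_eqF.
have li0 : (0 < l^-1)%R by rewrite invr_gt0.
have s1 := sqr_ge0 (u - v - l^-1 * (u + v))%R.
have s2 : (0 <= l * (u - v - l^-1 * (u + v)) ^+ 2)%R.
  exact: mulr_ge0 (ltW l0) (sqr_ge0 _).
have s2E : (l * (u - v - l^-1 * (u + v)) ^+ 2 = l * (u - v) ^+ 2
   - 2 * (l * l^-1) * (u ^+ 2 - v ^+ 2) + l * l^-1 * l^-1 * (u + v) ^+ 2)%R by ring.
rewrite ll in s2E.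
have s3 : (0 <= l^-1 * (u - v) ^+ 2)%R by exact: mulr_ge0 (ltW li0) (sqr_ge0 _).
have s4 : (0 <= l * (u - v) ^+ 2)%R by exact: mulr_ge0 (ltW l0) (sqr_ge0 _).
have s5 : (0 <= l^-1 * (u ^+ 2 + v ^+ 2))%R.
  exact: mulr_ge0 (ltW li0) (addr_ge0 (sqr_ge0 _) (sqr_ge0 _)).
rewrite fE gE hE cE; case: b01 => ->; lra.
Qed.

End hellinger.

Section gauss_samples.
Context (R : realType).
Local Open Scope ereal_scope.
Implicit Types p n : nat.

Definition gauss_mass p (K : 'M[R]_p) : R := Num.sqrt ((pi *+ 2) ^+ p / \det K).

Definition gauss_density p (K : 'M[R]_p) (x : 'rV[R]_p) : R :=
  ((gauss_mass K)^-1 * expR (- qform K x / 2))%R.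

Lemma gauss_pdf_inv p (K : 'M[R]_p) x : gauss_pdf (invmx K) x = gauss_density K x.
Proof. by rewrite /gauss_pdf det_inv invmxK. Qed.

Lemma measurable_gauss_density p (K : 'M[R]_p) : measurable_fun setT (gauss_density K).
Proof. by apply: measurable_funM => //; exact: measurable_gauss. Qed.

Lemma gauss_density_ge0 p (K : 'M[R]_p) x : (0 <= gauss_density K x)%R.
Proof. by rewrite mulr_ge0 ?invr_ge0 ?sqrtr_ge0 ?expR_ge0. Qed.

Lemma gauss_mass_gt0 p (K : 'M[R]_p) : posdef K -> (0 < gauss_mass K)%R.
Proof.
move=> Kpd; rewrite sqrtr_gt0 divr_gt0 ?posdef_det_gt0//.
by rewrite exprn_gt0// mulrn_wgt0// pi_gt0.
Qed.

Lemma integral_gauss_density p (K : 'M[R]_p) : posdef K ->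
  \int[leb_rV p]_x (gauss_density K x)%:E = 1.
Proof.
move=> Kpd; under eq_integral do rewrite EFinM.
rewrite ge0_integralZl//; last 2 first.
- by apply/measurable_EFinP; exact: measurable_gauss.
- by rewrite lee_fin invr_ge0 sqrtr_ge0.
by rewrite integral_gauss// -EFinM mulVf// gt_eqF// gauss_mass_gt0.
Qed.

Lemma integral_sample_density n p (K : 'M[R]_p) : posdef K ->
  \int[tuple_measure (fun=> leb_rV p) n]_t
    (\prod_(i < n) gauss_density K (tnth t i))%:E = 1.
Proof.
move=> Kpd; rewrite (@integral_tuple_prod _ _ _ (fun=> leb_rV p)
  (fun=> gauss_density K) (fun=> 1%R)).
- by rewrite big1.
- by move=> _; exact: measurable_gauss_density.
- by move=> _ x; exact: gauss_density_ge0.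
- by move=> _; exact: integral_gauss_density.
Qed.

Lemma sample_law_density n p (K : 'M[R]_p) B : posdef K -> measurable B ->
  sample_law n (invmx K) B = \int[tuple_measure (fun=> leb_rV p) n]_t
    ((\1_B t)%:E * (\prod_(i < n) gauss_density K (tnth t i))%:E).
Proof.
move=> Kpd mB.
pose nu : {sigma_finite_measure set 'rV[R]_p -> \bar R} := density_measure
  (measurable_gauss_density K) (gauss_density_ge0 K) (integral_gauss_density Kpd).
have nuE : gauss_prob (invmx K) = nu :> (set _ -> \bar R).
  apply/funext => A; rewrite /gauss_prob leb_rVE.
  by apply: eq_integral => x _; rewrite gauss_pdf_inv.
rewrite /sample_law nuE (tuple_measureE (fun=> nu)) -[in LHS](setIT B) -integral_indic//.
rewrite (@integral_tuple_density _ _ _ (fun=> nu) (fun=> leb_rV p) (fun=> gauss_density K))//.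
- by move=> _; exact: measurable_gauss_density.
- by move=> _ x; exact: gauss_density_ge0.
- move=> _ g mg g0; apply: integral_density => //.
  + exact: measurable_gauss_density.
  + by move=> x; exact: gauss_density_ge0.
- by apply/measurable_EFinP; exact: measurable_indic.
Qed.

Lemma sample_law_le1 n p (K : 'M[R]_p) B : posdef K -> measurable B ->
  0 <= sample_law n (invmx K) B <= 1.
Proof.
move=> Kpd mB; rewrite sample_law_density// -(integral_sample_density n Kpd).
have mprod : measurable_fun setT (fun t : n.-tuple 'rV[R]_p =>
    (\prod_(i < n) gauss_density K (tnth t i))%:E).
  apply/measurable_EFinP; apply: (measurable_tuple_prod (f := fun=> gauss_density K)).
  by move=> _; exact: measurable_gauss_density.
have prod0 (t : n.-tuple 'rV[R]_p) : (0 <= \prod_(i < n) gauss_density K (tnth t i))%R.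
  by apply: prodr_ge0 => i _; exact: gauss_density_ge0.
apply/andP; split.
  by apply: integral_ge0 => t _; rewrite -EFinM lee_fin mulr_ge0.
apply: ge0_le_integral => //.
- by move=> t _; rewrite -EFinM lee_fin mulr_ge0.
- by apply: emeasurable_funM => //; exact/measurable_EFinP.
- move=> t _; rewrite -EFinM lee_fin ler_piMl//.
Qed.

Let bernoulli_le (t : R) n : (0 <= t <= 1 -> 1 - n%:R * t <= (1 - t) ^+ n)%R.
Proof.
move=> /andP[t0 t1]; elim: n => [|n IH]; first by rewrite mul0r subr0 expr0.
rewrite exprS; apply: le_trans (_ : (1 - t) * (1 - n%:R * t) <= _)%R.
  rewrite -natr1; have : (0 <= n%:R * t ^+ 2)%R by rewrite mulr_ge0 ?sqr_ge0.
  by move: (n%:R : R) => m; rewrite expr2; nra.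
by rewrite ler_wpM2l// subr_ge0.
Qed.

(** If [a < 1], then [a ^ n >= a ^ (4 n) >= (1 - t) ^ n >= 1 - n t]. *)
Let affinity_le (a t : R) n : (0 <= a -> 0 <= t <= 1 -> 1 - t <= a ^+ 4 ->
  1 - a ^+ n <= n%:R * t)%R.
Proof.
move=> a0 t01 at4; have [a1|a1] := leP 1%R a.
  have : (1 <= a ^+ n)%R by exact: exprn_ege1.
  have : (0 <= n%:R * t)%R by rewrite mulr_ge0//; case/andP: t01.
  lra.
have h := bernoulli_le n t01.
have : ((1 - t) ^+ n <= (a ^+ 4) ^+ n)%R.
  by rewrite lerXn2r ?nnegrE ?exprn_ge0 ?subr_ge0//; case/andP: t01.
have : ((a ^+ 4) ^+ n <= a ^+ n)%R.
  by rewrite lerXn2r ?nnegrE ?exprn_ge0// exprSr ler_piMl// exprn_ile1// ltW.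
lra.
Qed.

(** The Hellinger affinity of two centred Gaussian laws is
    [(det K1 det K2 / det ((K1 + K2) / 2) ^ 2) ^ (1/4)], and it is raised to the
    power [n] for samples of size [n].  Hence [det_perturb] makes it close to 1. *)
Lemma sample_law_perturb n p (K1 K2 : 'M[R]_p) (c l : R) B : (0 < c)%R ->
  K1^T = K1 -> K2^T = K2 ->
  (forall x, c * fsq x <= qform K1 x)%R -> (forall x, c * fsq x <= qform K2 x)%R ->
  (fsq (2^-1 *: (K1 - K2)) / c ^+ 2 < 1)%R -> (0 < l)%R -> measurable B ->
  sample_law n (invmx K1) B <= sample_law n (invmx K2) B +
    (l * (n%:R * (fsq (2^-1 *: (K1 - K2)) / c ^+ 2)) + 2 / l)%:E.
Proof.
move=> c0 K1s K2s K1c K2c; set D := (2^-1 *: (K1 - K2))%R; set t := (fsq D / c ^+ 2)%R.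
move=> t1 l0 mB.
pose M := (2^-1 *: (K1 + K2))%R.
have MD : (M + D = K1)%R.
  by rewrite -scalerDr addrACA subrr addr0 -[(K1 + K1)%R]mulr2n -[(K1 *+ 2)%R]scaler_nat scalerA mulVf ?scale1r.
have MBD : (M - D = K2)%R.
  by rewrite -scalerBr opprB [(K1 + K2)%R]addrC addrACA subrr addr0 -[(K2 + K2)%R]mulr2n -[(K2 *+ 2)%R]scaler_nat scalerA mulVf ?scale1r.
have Ms : (M^T = M)%R by rewrite linearZ /= linearD /= K1s K2s.
have Ds : (D^T = D)%R by rewrite linearZ /= linearB /= K1s K2s.
have Mc (x : 'rV[R]_p) : (c * fsq x <= qform M x)%R.
  rewrite qformZ qformD; have := K1c x; have := K2c x; lra.
have K1pd := posdef_coercive c0 K1s K1c; have K2pd := posdef_coercive c0 K2s K2c.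
have Mpd := posdef_coercive c0 Ms Mc.
have dK1 := posdef_det_gt0 K1pd; have dK2 := posdef_det_gt0 K2pd.
have dM := posdef_det_gt0 Mpd.
have perturb : ((1 - t) * \det M ^+ 2 <= \det K1 * \det K2)%R.
  by have := det_perturb c0 Ms Ds Mc t1; rewrite MD MBD.
have Z1 := gauss_mass_gt0 K1pd; have Z2 := gauss_mass_gt0 K2pd.
pose s := Num.sqrt (gauss_mass K1 * gauss_mass K2).
have s0 : (0 < s)%R by rewrite sqrtr_gt0 mulr_gt0.
have s2 : (s ^+ 2 = gauss_mass K1 * gauss_mass K2)%R by rewrite sqr_sqrtr// ltW// mulr_gt0.
pose h1 (x : 'rV[R]_p) : R := (s^-1 * expR (- qform M x / 2))%R.
have mh1 : measurable_fun setT h1 by apply: measurable_funM => //; exact: measurable_gauss.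
have h10 x : (0 <= h1 x)%R by rewrite mulr_ge0 ?expR_ge0// invr_ge0 ltW.
have h1E x : (h1 x ^+ 2 = gauss_density K1 x * gauss_density K2 x)%R.
  rewrite exprMn exprVn s2 invfM /gauss_density [RHS]mulrACA; congr (_ * _)%R.
  by rewrite expr2 -!expRD qformZ qformD; congr expR; field.
pose a := (gauss_mass M / s)%R.
have a0 : (0 <= a)%R by rewrite divr_ge0 ?ltW// gauss_mass_gt0.
have ha : \int[leb_rV p]_x (h1 x)%:E = a%:E.
  under eq_integral do rewrite EFinM.
  rewrite ge0_integralZl//; last 2 first.
  - by apply/measurable_EFinP; exact: measurable_gauss.
  - by rewrite lee_fin invr_ge0 ltW.
  by rewrite integral_gauss// -EFinM mulrC.
have pi2 : (0 < (pi *+ 2) ^+ p :> R)%R by rewrite exprn_gt0// mulrn_wgt0// pi_gt0.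
have a4 : (1 - t <= a ^+ 4)%R.
  have m2 (K : 'M[R]_p) : (0 < \det K -> gauss_mass K ^+ 2 = (pi *+ 2) ^+ p / \det K)%R.
    by move=> dK; rewrite sqr_sqrtr// divr_ge0 ?ltW.
  have -> : (a ^+ 4 = \det K1 * \det K2 / \det M ^+ 2)%R.
    have -> : (a ^+ 4 = (gauss_mass M ^+ 2) ^+ 2 / (s ^+ 2) ^+ 2)%R.
      by rewrite -!exprM -exprVn -exprMn.
    rewrite s2 [((gauss_mass K1 * _) ^+ 2)%R]exprMn !m2//.
    by field; rewrite !gt_eqF.
  by rewrite ler_pdivlMr// exprn_gt0.
have t0 : (0 <= t)%R by apply: divr_ge0; [exact: fsq_ge0|exact: sqr_ge0].
have an : (1 - a ^+ n <= n%:R * t)%R by apply: affinity_le => //; rewrite t0 ltW.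
have arith (x y : R) : (x + l * a ^+ n <= y + (l + 2 / l) ->
    x <= y + (l * (n%:R * t) + 2 / l))%R.
  have := an; rewrite -(ler_pM2l l0); move: (n%:R * t)%R (a ^+ n)%R (2 / l)%R.
  clear; move=> u v w; lra.
have mdens (K : 'M[R]_p) : measurable_fun setT (fun u : n.-tuple 'rV[R]_p =>
    \prod_(i < n) gauss_density K (tnth u i))%R.
  apply: (measurable_tuple_prod (f := fun=> gauss_density K)).
  by move=> _; exact: measurable_gauss_density.
have dens0 (K : 'M[R]_p) (u : n.-tuple 'rV[R]_p) :
    (0 <= \prod_(i < n) gauss_density K (tnth u i))%R.
  by apply: prodr_ge0 => i _; exact: gauss_density_ge0.
have h1p (u : n.-tuple 'rV[R]_p) : (0 <= \prod_(i < n) h1 (tnth u i))%R.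
  by apply: prodr_ge0 => i _.
have key := @le_hellinger _ _ R (tuple_measure (fun=> leb_rV p) n)
  (fun u => \prod_(i < n) gauss_density K1 (tnth u i))%R
  (fun u => \prod_(i < n) gauss_density K2 (tnth u i))%R
  (fun u => \prod_(i < n) h1 (tnth u i))%R (a ^+ n)%R l B (mdens K1) (mdens K2)
  (measurable_tuple_prod (f := fun=> h1) (fun=> mh1)) (dens0 K1) (dens0 K2)
  h1p.
rewrite -!sample_law_density// in key.
have {key} := key _ (integral_sample_density n K1pd) (integral_sample_density n K2pd) _ l0 mB.
set P1 := sample_law _ _ _; set P2 := sample_law _ _ _ => key.
have P1f : P1 \is a fin_num.
  have /andP[u0 u1] : 0 <= P1 <= 1 by exact: sample_law_le1.
  by rewrite ge0_fin_numE//; apply: le_lt_trans u1 _; rewrite ltry.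
have P2f : P2 \is a fin_num.
  have /andP[u0 u1] : 0 <= P2 <= 1 by exact: sample_law_le1.
  by rewrite ge0_fin_numE//; apply: le_lt_trans u1 _; rewrite ltry.
have {key} : P1 + (l * a ^+ n)%:E <= P2 + (l + 2 / l)%:E.
  apply: key => [u|].
    by rewrite -prodrXl -big_split; apply: eq_bigr => i _; exact: h1E.
  rewrite (@integral_tuple_prod _ _ _ (fun=> leb_rV p) (fun=> h1) (fun=> a))//.
  by rewrite prodr_const card_ord.
move: P1f P2f; move: P1 P2 => [x| |] [y| |] // _ _; rewrite -!EFinD !lee_fin.
exact: arith.
Qed.

(** The root of the squared distance appears by optimizing [l] in
    [sample_law_perturb]; the constant 3 / 4 is that of [precision_coercive]. *)
Lemma sample_law_lip n p (K1 K2 : 'M[R]_p) B : (0 < n)%N ->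
  K1^T = K1 -> K2^T = K2 ->
  (forall x, 3 / 4 * fsq x <= qform K1 x)%R ->
  (forall x, 3 / 4 * fsq x <= qform K2 x)%R -> measurable B ->
  sample_law n (invmx K1) B <= sample_law n (invmx K2) B +
    (2 * Num.sqrt n%:R * fnorm (K1 - K2))%:E.
Proof.
move=> n0 K1s K2s K1c K2c mB.
have c0 : (0 < 3 / 4 :> R)%R by lra.
have K1pd := posdef_coercive c0 K1s K1c; have K2pd := posdef_coercive c0 K2s K2c.
have tE : (fsq (2^-1 *: (K1 - K2)) / (3 / 4) ^+ 2 = (2 / 3 * fnorm (K1 - K2)) ^+ 2)%R.
  by rewrite fsqZ [RHS]exprMn fnorm_sqr; field.
set r := fnorm _ in tE *; have r0 : (0 <= r)%R by exact: fnorm_ge0.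
have n1 : (1 <= Num.sqrt n%:R :> R)%R by rewrite -{1}sqrtr1 ler_wsqrtr// ler1n.
have /andP[_ P11] := sample_law_le1 K1pd mB.
have /andP[P20 _] := sample_law_le1 K2pd mB.
have [t1|t1] := ltP ((2 / 3 * r) ^+ 2)%R 1%R; last first.
  (* The right-hand side exceeds 1. *)
  apply: le_trans P11 _; apply: le_trans (_ : (2 * Num.sqrt n%:R * r)%:E <= _); last exact: leeDr.
  rewrite lee_fin; have : (1 <= 2 / 3 * r)%R.
    by rewrite -(@ler_pXn2r _ 2)// ?nnegrE ?expr1n ?mulr_ge0//; lra.
  nra.
have [rz|rN] := eqVneq r 0%R.
  have -> : K1 = K2.
    by apply/eqP; rewrite -subr_eq0; apply/eqP/fsq_eq0; rewrite -fnorm_sqr -/r rz expr0n.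
  by rewrite leeDl// rz mulr0.
have rp : (0 < r)%R by rewrite lt_def rN.
(* With [l = w^-1] the error [l * w ^ 2 + 2 / l] is [3 * w]. *)
pose w := (Num.sqrt n%:R * (2 / 3 * r))%R.
have w0 : (0 < w)%R by apply: mulr_gt0; [rewrite sqrtr_gt0 ltr0n|apply: mulr_gt0 => //; lra].
have wi0 : (0 < w^-1)%R by rewrite invr_gt0.
have := @sample_law_perturb n p K1 K2 _ (w^-1) B c0 K1s K2s K1c K2c.
rewrite tE => /(_ t1 wi0 mB) h; apply: le_trans h _; rewrite leeD2l// lee_fin.
have -> : (n%:R * (2 / 3 * r) ^+ 2 = w * w)%R.
  by rewrite /w -{1}(@sqr_sqrtr R n%:R)// !expr2; ring.
rewrite mulrA mulVf ?gt_eqF// mul1r invrK /w; lra.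
Qed.

End gauss_samples.

(** * The laws of the samples as a function of the perturbation *)

Section almost_everywhere.
Context d (T : measurableType d) (R : realType) (mu : {measure set T -> \bar R}).
Local Open Scope ereal_scope.
Implicit Types f g : T -> \bar R.

(** The integral of a nonnegative function is a supremum over the simple functions
    below it. *)
Lemma le_integral_nonmeasurable f g : (forall x, 0 <= f x) ->
  (forall x, f x <= g x) -> \int[mu]_x f x <= \int[mu]_x g x.
Proof.
move=> f0 fg; have g0 x : 0 <= g x by exact: le_trans (f0 x) (fg x).
rewrite !ge0_integralTE//; apply: ereal_sup_le => _ [h hf <-].
by exists h => // x; exact: le_trans (hf x) (fg x).
Qed.

Let integral_eq_on_ge0 f g (D : set T) : measurable D -> mu (~` D) = 0 ->
  (forall x, 0 <= f x) -> (forall x, 0 <= g x) -> measurable_fun setT g ->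
  (forall x, D x -> f x = g x) -> \int[mu]_x f x = \int[mu]_x g x.
Proof.
move=> mD D0 f0 g0 mg fg.
pose lo x := if x \in D then g x else 0.
pose up x := if x \in D then g x else +oo.
have mif (c : \bar R) : measurable_fun setT (fun x => if x \in D then g x else c).
  apply: measurable_fun_ifT => //.
  by apply: (measurable_fun_bool true); rewrite setTI (_ : _ @^-1` _ = D)//;
    apply/seteqP; split=> x /=; [move/set_mem|move/mem_set].
have aeD (h : T -> \bar R) : (forall x, D x -> h x = g x) -> ae_eq mu setT h g.
  move=> hg; exists (~` D); split; [exact: measurableC|exact: D0|].
  by move=> x /= nhg Dx; apply: nhg => _; exact: hg.
have loE : \int[mu]_x lo x = \int[mu]_x g x.
  apply: ge0_ae_eq_integral => //; first exact: mif.
  - by move=> x _; rewrite /lo; case: ifP.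
  - by apply: aeD => x Dx; rewrite /lo mem_set.
have upE : \int[mu]_x up x = \int[mu]_x g x.
  apply: ge0_ae_eq_integral => //; first exact: mif.
  - by move=> x _; rewrite /up; case: ifP.
  - by apply: aeD => x Dx; rewrite /up mem_set.
apply/eqP; rewrite eq_le -{1}upE -{1}loE; apply/andP; split.
- apply: le_integral_nonmeasurable => // x; rewrite /up.
  by case: ifPn => [/set_mem/fg ->//|_]; exact: leey.
- apply: le_integral_nonmeasurable => x; rewrite /lo; first by case: ifP.
  by case: ifPn => [/set_mem/fg ->//|_].
Qed.

(** [f] lies between two measurable functions that agree with [g] on [D].  The
    integrand of a mixture law is such an [f]: it is given by a density formula on
    the symmetric matrices. *)
Lemma integral_eq_on f g (D : set T) : measurable D -> mu (~` D) = 0 ->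
  (forall x, 0 <= g x) -> measurable_fun setT g ->
  (forall x, D x -> f x = g x) -> \int[mu]_x f x = \int[mu]_x g x.
Proof.
move=> mD D0 g0 mg fg; rewrite integralE.
rewrite (@integral_eq_on_ge0 (f^\+) g D)//; last first.
  by move=> x Dx; rewrite funeposE fg//; apply/max_idPl.
rewrite (@integral_eq_on_ge0 (f^\-) (cst 0) D)//; last first.
  by move=> x Dx; rewrite funenegE fg//; apply/max_idPr; rewrite oppe_le0.
by rewrite integral0 sube0.
Qed.

End almost_everywhere.

Section sample_law_of.
Context (R : realType).
Local Open Scope ereal_scope.
Implicit Types n p : nat.

Lemma measurable_inv : measurable_fun [set: R] (fun x : R => x^-1)%R.
Proof.
(* The factor [x] accounts for the value 0 at 0, whatever [ln 0] is. *)
rewrite (_ : (fun x => _) = (fun x : R => x * expR (- ln (x ^+ 2)))%R).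
  apply: measurable_funM => //; apply: measurableT_comp => //.
  apply: measurableT_comp => //; apply: (measurableT_comp (@measurable_ln R)).
  exact: measurable_funX.
apply/funext => x; have [->|x0] := eqVneq x 0%R; first by rewrite invr0 mul0r.
rewrite expRN lnK ?posrE ?exprn_even_gt0//.
by rewrite expr2 invfM mulrA mulfV// mul1r.
Qed.

Lemma measurable_sqrt : measurable_fun [set: R] (@Num.sqrt R).
Proof. by apply: continuous_measurable_fun => x; exact: sqrt_continuous. Qed.

Definition law_precision n (omega : R) p (M : 'M[R]_p) : 'M[R]_p :=
  precision ((omega / n%:R) *: M).

Lemma Sigma_ofE n omega p (M : 'M[R]_p) :
  Sigma_of n omega M = invmx (law_precision n omega M).
Proof. by []. Qed.

Lemma law_precision_sym n omega p (M : 'M[R]_p) : M^T = M ->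
  (law_precision n omega M)^T = law_precision n omega M.
Proof. by move=> Ms; apply: precision_sym; rewrite linearZ /= Ms. Qed.

Lemma law_precision_coercive n omega p (M : 'M[R]_p) x : M^T = M ->
  (3 / 4 * fsq x <= qform (law_precision n omega M) x)%R.
Proof. by move=> Ms; apply: precision_coercive; rewrite linearZ /= Ms. Qed.

Lemma law_precision_posdef n omega p (M : 'M[R]_p) : M^T = M ->
  posdef (law_precision n omega M).
Proof.
move=> Ms; apply: (@posdef_coercive _ _ _ (3 / 4)); first lra.
  exact: law_precision_sym.
by move=> x; exact: law_precision_coercive.
Qed.

Lemma sample_law_of_lip n omega p (M N : 'M[R]_p) B : (0 < n)%N -> (0 <= omega)%R ->
  M^T = M -> N^T = N -> measurable B ->
  sample_law n (Sigma_of n omega M) B <= sample_law n (Sigma_of n omega N) B +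
    (2 * Num.sqrt n%:R * (omega / n%:R) * fnorm (M - N) *
      (1 + (omega / n%:R) * (fnorm M + fnorm N)))%:E.
Proof.
move=> n0 w0 Ms Ns mB; rewrite !Sigma_ofE.
apply: le_trans (sample_law_lip n0 (law_precision_sym n omega Ms)
  (law_precision_sym n omega Ns) (fun x => law_precision_coercive n omega x Ms)
  (fun x => law_precision_coercive n omega x Ns) mB) _.
rewrite leeD2l// lee_fin -!mulrA ler_pM2l// ler_wpM2l ?sqrtr_ge0//.
apply: le_trans (precision_lip _ _) _.
have wn : (0 <= omega / n%:R)%R by rewrite divr_ge0.
rewrite -scalerBr !fnormZ ger0_norm// le_eqVlt; apply/orP; left; apply/eqP.
ring.
Qed.

(** A version of the density formula that is measurable in [M] on all matrices. *)
Definition sample_law_fun n omega p (B : set (n.-tuple 'rV[R]_p)) (M : 'M[R]_p) : \bar R :=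
  \int[tuple_measure (fun=> leb_rV p) n]_t
    ((\1_B t)%:E * (\prod_(i < n) gauss_density (law_precision n omega M) (tnth t i))%:E).

Lemma sample_law_funE n omega p B (M : 'M[R]_p) : M^T = M -> measurable B ->
  sample_law n (Sigma_of n omega M) B = sample_law_fun omega B M.
Proof.
by move=> Ms mB; rewrite Sigma_ofE sample_law_density//; exact: law_precision_posdef.
Qed.

Lemma sample_law_fun_ge0 n omega p (B : set (n.-tuple 'rV[R]_p)) M :
  0 <= sample_law_fun omega B M.
Proof.
apply: integral_ge0 => t _; rewrite -EFinM lee_fin mulr_ge0//.
by apply: prodr_ge0 => i _; exact: gauss_density_ge0.
Qed.

Lemma measurable_sample_law_fun n omega p (B : set (n.-tuple 'rV[R]_p)) :
  measurable B -> measurable_fun setT (sample_law_fun (n := n) omega B).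
Proof.
move=> mB.
apply: (@measurable_fun_fubini_tonelli_F _ _ _ _ _ (tuple_measure (fun=> leb_rV p) n)
  (fun Mt : 'M[R]_p * n.-tuple 'rV[R]_p => (\1_B Mt.2)%:E *
   (\prod_(i < n) gauss_density (law_precision n omega Mt.1) (tnth Mt.2 i))%:E)).
  have mK : measurable_fun setT (fun Mt : 'M[R]_p * n.-tuple 'rV[R]_p =>
      law_precision n omega Mt.1).
    have mA : measurable_fun setT (fun Mt : 'M[R]_p * n.-tuple 'rV[R]_p =>
        ((omega / n%:R) *: Mt.1)%R).
      by apply: measurable_scalemx; [exact: measurable_cst|exact: measurable_fst].
    apply: measurable_addmx; last exact: measurable_mulmx.
    by apply: measurable_addmx => //; exact: measurable_cst.
  apply: emeasurable_funM; apply/measurable_EFinP.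
    by apply: measurableT_comp; [exact: measurable_indic|exact: measurable_snd].
  apply: measurable_prod => i _; apply: measurable_funM.
    apply: (measurableT_comp measurable_inv); apply: (measurableT_comp measurable_sqrt).
    apply: measurable_funM => //; apply: (measurableT_comp measurable_inv).
    exact: measurable_det.
  apply: measurableT_comp => //; apply: measurable_funM => //.
  apply: measurableT_comp => //; apply: measurable_qform => //.
  exact: (measurableT_comp (measurable_tnth i) measurable_snd).
move=> Mt; rewrite -EFinM lee_fin mulr_ge0//.
by apply: prodr_ge0 => i _; exact: gauss_density_ge0.
Qed.

Lemma measurable_sym p : measurable (@sym_mx R p).
Proof.
rewrite (_ : @sym_mx R p = (fun M : 'M[R]_p => fsq (M^T - M)%R) @^-1` [set 0%R]); last first.
  apply/seteqP; split=> M /=.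
    by move=> ->; rewrite subrr /fsq big1// => i _; rewrite big1// => j _; rewrite mxE expr0n.
  by move/fsq_eq0/eqP; rewrite subr_eq0 => /eqP.
rewrite -[X in measurable X]setTI; apply: measurable_fsq => //.
by apply: measurable_submx => //; exact: measurable_trmx.
Qed.

Lemma mixture_law_fun n omega p (Q : {measure set 'M[R]_p -> \bar R}) B :
  Q (~` @sym_mx R p) = 0 -> measurable B ->
  mixture_law n Q omega B = \int[Q]_M sample_law_fun (n := n) omega B M.
Proof.
move=> Q0 mB; apply: (integral_eq_on (@measurable_sym p)) => //.
- by move=> M; exact: sample_law_fun_ge0.
- exact: measurable_sample_law_fun.
- by move=> M Ms; exact: sample_law_funE.
Qed.

End sample_law_of.

(** * Rotation invariance of Gaussian vectors *)

Section lebesgue_affine.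
Context (R : realType).
Local Open Scope ereal_scope.
Notation mu := (@lebesgue_measure R).

Let affine (a b x : R) : measurableTypeR R := (a * x + b)%R.

Let measurable_affine (a b : R) : measurable_fun [set: measurableTypeR R] (affine a b).
Proof. by apply: measurable_funD => //; exact: measurable_funM. Qed.

Let affine_image (a b : R) : a != 0%R ->
  forall X, measurable X ->
  mscale (`|a|%:nng)%R (measure_function_pushforward__canonical__measure_function_Measure
    mu (measurable_affine a b)) X = mu X.
Proof.
move=> a0 X mX; apply/esym/lebesgue_measure_unique => // _ [[u v] /= uv <-].
rewrite /mscale /= /pushforward.
have [ap|an] : (0 < a)%R \/ (a < 0)%R by case: (ltgtP a 0%R) a0 => // h _; [right|left].
  rewrite (_ : _ @^-1` _ = [set` `](u - b) / a, (v - b) / a]%R]).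
    rewrite !lebesgue_measure_itv /= !lte_fin ltr_pM2r ?invr_gt0// ltrD2r.
    case: ifPn => _; last by rewrite mule0.
    by rewrite -!EFinB -EFinM gtr0_norm//; congr EFin; field; rewrite gt_eqF.
  apply/seteqP; split=> x; rewrite /affine /= !in_itv /=.
    by move=> /andP[h1 h2]; rewrite ltr_pdivrMr// ler_pdivlMr//; apply/andP; split; lra.
  by rewrite ltr_pdivrMr// ler_pdivlMr// => /andP[h1 h2]; apply/andP; split; lra.
rewrite (_ : _ @^-1` _ = [set` `[(v - b) / a, (u - b) / a[%R]).
  rewrite !lebesgue_measure_itv /= !lte_fin ltr_nM2r ?invr_lt0// ltrD2r.
  case: ifPn => _; last by rewrite mule0.
  by rewrite -!EFinB -EFinM ltr0_norm//; congr EFin; field; rewrite lt_eqF.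
apply/seteqP; split=> x; rewrite /affine /= !in_itv /=.
  by move=> /andP[h1 h2]; rewrite ltr_ndivlMr// ler_ndivrMr//; apply/andP; split; lra.
by rewrite ltr_ndivlMr// ler_ndivrMr// => /andP[h1 h2]; apply/andP; split; lra.
Qed.

Lemma integral_affine (a b : R) (f : R -> \bar R) : a != 0%R ->
  measurable_fun [set: R] f -> (forall x, 0 <= f x) ->
  \int[mu]_x f x = `|a|%:E * \int[mu]_x f (a * x + b)%R.
Proof.
move=> a0 mf f0.
rewrite -(eq_measure_integral _ (fun X mX _ => affine_image b a0 mX)).
rewrite ge0_integral_mscale//; congr (_ * _).
by rewrite ge0_integral_pushforward//; exact: measurable_affine.
Qed.

End lebesgue_affine.

Section gauss_rotation.
Context (R : realType).
Local Open Scope ereal_scope.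
Notation mu := (@lebesgue_measure R).
Notation gamma := (normal_prob (0 : R) 1).

Lemma integral_normal (s : R) (f : R -> \bar R) :
  measurable_fun [set: R] f -> (forall x, 0 <= f x) ->
  \int[normal_prob 0%R s]_x f x = \int[mu]_x (f x * (normal_pdf 0%R s x)%:E).
Proof.
move=> mf f0; apply: integral_density => //.
- exact: measurable_normal_pdf.
- by move=> x; exact: normal_pdf_ge0.
Qed.

Lemma normal_scale (s : R) (f : R -> \bar R) : s != 0%R ->
  measurable_fun [set: R] f -> (forall x, 0 <= f x) ->
  \int[normal_prob 0%R s]_x f x = \int[gamma]_x f (s * x)%R.
Proof.
move=> s0 mf f0.
have ms : measurable_fun [set: R] (fun x => f (s * x)%R).
  by apply: (measurableT_comp mf); exact: measurable_funM.
have mpdf t : measurable_fun [set: R] (fun x => (normal_pdf (0 : R) t x)%:E).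
  by apply/measurable_EFinP; exact: measurable_normal_pdf.
have pdf0 t x : 0 <= (normal_pdf (0 : R) t x)%:E by rewrite lee_fin normal_pdf_ge0.
rewrite (integral_normal s mf f0) (integral_normal 1%R ms (fun x => f0 _)).
rewrite (integral_affine 0%R s0); last 2 first.
- by apply: emeasurable_funM => //; exact: mpdf.
- by move=> x; rewrite mule_ge0.
rewrite -ge0_integralZl//; last 2 first.
- apply: emeasurable_funM.
    by apply: (measurableT_comp mf); exact: measurable_funD.
  apply: (measurableT_comp (mpdf s)); exact: measurable_funD.
- by move=> x _; rewrite mule_ge0.
apply: eq_integral => x _; rewrite addr0 muleCA; congr (_ * _).
rewrite -EFinM; congr EFin; rewrite !normal_pdfE ?oner_eq0// /normal_peak /normal_fun.
rewrite !subr0 expr1n mul1r.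
have -> : (s ^+ 2 * pi *+ 2 = s ^+ 2 * (pi *+ 2))%R by rewrite -mulrnAr.
rewrite (sqrtrM _ (sqr_ge0 _)) sqrtr_sqr invfM !mulrA mulfV ?normr_eq0// mul1r.
congr (_ * expR _)%R.
by rewrite exprMn -[(s ^+ 2 *+ 2)%R]mulr_natr; field.
Qed.

Lemma normal_sym (f : R -> \bar R) :
  measurable_fun [set: R] f -> (forall x, 0 <= f x) ->
  \int[gamma]_x f (- x)%R = \int[gamma]_x f x.
Proof.
move=> mf f0; have N1 : (-1 : R)%R != 0%R by rewrite oppr_eq0 oner_eq0.
under eq_integral do rewrite -mulN1r.
rewrite -(normal_scale N1 mf f0) (integral_normal _ mf f0) (integral_normal _ mf f0).
apply: eq_integral => x _; congr (_ * _%:E).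
rewrite !normal_pdfE ?oppr_eq0 ?oner_eq0// /normal_peak /normal_fun.
by rewrite sqrrN.
Qed.

(** A rotation as two shears: [u = c x + s y] at fixed [y], then [y = c v + s u]
    at fixed [u].  Their Jacobians [1 / c] and [c] cancel. *)
Let lebesgue_rotation (c s : R) (f : R * R -> \bar R) :
  measurable_fun [set: R * R] f -> (forall u, 0 <= f u) ->
  c != 0%R -> (c ^+ 2 + s ^+ 2 = 1)%R ->
  \int[mu]_y \int[mu]_x f (c * x + s * y, x ^+ 2 + y ^+ 2)%R =
  \int[mu]_u \int[mu]_v f (u, u ^+ 2 + v ^+ 2)%R.
Proof.
move=> mf f0 c0 cs1.
have ci0 : c^-1%R != 0%R by rewrite invr_eq0.
have m2 (g h : R * R -> R) : measurable_fun setT g -> measurable_fun setT h ->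
    measurable_fun setT (fun u => f (g u, h u)).
  by move=> mg mh; apply: (measurableT_comp mf); exact: measurable_fun_pair.
pose F (y u : R) := f (u, (c^-1 * u + - (s * y) / c) ^+ 2 + y ^+ 2)%R.
have mF : measurable_fun setT (fun w : R * R => F w.1 w.2).
  apply: m2 => //; apply: measurable_funD; last exact: measurable_funX.
  apply: measurable_funX; apply: measurable_funD; first exact: measurable_funM.
  by apply: measurable_funM => //; apply: measurableT_comp => //; exact: measurable_funM.
have mFy y : measurable_fun [set: R] (F y).
  exact: (measurableT_comp mF (measurable_fun_pair (measurable_cst y) (@measurable_id _ _ setT))).
have mFu u : measurable_fun [set: R] (F ^~ u).
  exact: (measurableT_comp mF (measurable_fun_pair (@measurable_id _ _ setT) (measurable_cst u))).
transitivity (\int[mu]_y (`|c^-1|%R%:E * \int[mu]_u F y u)).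
  apply: eq_integral => y _.
  rewrite (@integral_affine _ c^-1 (- (s * y) / c) (fun x => f (c * x + s * y, x ^+ 2 + y ^+ 2)%R))//.
    congr (_ * _); apply: eq_integral => u _; rewrite /F; congr f; congr pair.
    by field.
  apply: (measurableT_comp mf); apply: measurable_fun_pair.
    by apply: measurable_funD => //; exact: measurable_funM.
  by apply: measurable_funD => //; exact: measurable_funX.
rewrite ge0_integralZl//; last 2 first.
- exact: (measurable_fun_fubini_tonelli_F (m2 := mu) _ mF (fun w => f0 _)).
- by move=> y _; apply: integral_ge0 => u _; exact: f0.
rewrite (fubini_tonelli (m1 := mu) (m2 := mu) (fun w : R * R => F w.1 w.2))//; last first.
  by move=> w; exact: f0.
rewrite -ge0_integralZl//; last 2 first.
- exact: (measurable_fun_fubini_tonelli_G (m1 := mu) _ mF (fun w => f0 _)).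
- by move=> y _; apply: integral_ge0 => u _; exact: f0.
apply: eq_integral => u _.
rewrite (@integral_affine _ c (s * u) (F ^~ u))//; last by move=> v; exact: f0.
rewrite muleA -EFinM -normrM mulVf// normr1 mul1e.
apply: eq_integral => v _; rewrite /F; congr f; congr pair.
have -> : (c^-1 * u + - (s * (c * v + s * u)) / c = c^-1 * (1 - s ^+ 2) * u - s * v)%R.
  by field.
have -> : (1 - s ^+ 2 = c ^+ 2)%R by rewrite -cs1; ring.
have -> : (c^-1 * c ^+ 2 = c)%R by field.
have -> : ((c * u - s * v) ^+ 2 + (c * v + s * u) ^+ 2 = (c ^+ 2 + s ^+ 2) * (u ^+ 2 + v ^+ 2))%R.
  by ring.
by rewrite cs1 mul1r.
Qed.

(** The standard normal law of the plane is invariant under the rotation that takes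
    the coefficients [(a, b)] to [(sqrt (a ^ 2 + b ^ 2), 0)]. *)
Lemma gauss_rotation (a b : R) (f : R * R -> \bar R) :
  measurable_fun [set: R * R] f -> (forall u, 0 <= f u) ->
  \int[gamma]_x \int[gamma]_y f (a * x + b * y, x ^+ 2 + y ^+ 2)%R =
  \int[gamma]_x \int[gamma]_y f (Num.sqrt (a ^+ 2 + b ^+ 2) * x, x ^+ 2 + y ^+ 2)%R.
Proof.
move=> mf f0; set r := Num.sqrt _.
have m2 (g h : R * R -> R) : measurable_fun setT g -> measurable_fun setT h ->
    measurable_fun setT (fun u => f (g u, h u)).
  by move=> mg mh; apply: (measurableT_comp mf); exact: measurable_fun_pair.
have mlin (p q : R) : measurable_fun [set: R * R] (fun u => p * u.1 + q * u.2)%R.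
  by apply: measurable_funD; apply: measurable_funM.
have msq : measurable_fun [set: R * R] (fun u => u.1 ^+ 2 + u.2 ^+ 2)%R.
  by apply: measurable_funD; exact: measurable_funX.
have mpq (p q : R) : measurable_fun setT
    (fun u : R * R => f (p * u.1 + q * u.2, u.1 ^+ 2 + u.2 ^+ 2)%R) by exact: m2.
have mrow (g : R * R -> \bar R) x : measurable_fun setT g ->
    measurable_fun [set: R] (fun y => g (x, y)).
  move=> mg.
  exact: (measurableT_comp mg (measurable_fun_pair (measurable_cst x) (@measurable_id _ _ setT))).
pose W (q : R) := (normal_peak 1 ^+ 2 * expR (- q / 2) : R)%R.
have W0 q : (0 <= W q)%R by rewrite mulr_ge0 ?expR_ge0// sqr_ge0.
have mW : measurable_fun [set: R] W.
  by apply: measurable_funM => //; apply: measurableT_comp => //; exact: measurable_funM.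
have pdfE (x y : R) : (normal_pdf 0 1 x * normal_pdf 0 1 y = W (x ^+ 2 + y ^+ 2))%R.
  rewrite !normal_pdfE ?oner_eq0// /normal_fun mulrACA -expRD -expr2 /W.
  by congr (_ * expR _)%R; rewrite !subr0 expr1n; field.
have mpdf : measurable_fun [set: R] (fun x => (normal_pdf (0 : R) 1 x)%:E).
  by apply/measurable_EFinP; exact: measurable_normal_pdf.
have lebesgueE (p q : R) :
    \int[gamma]_x \int[gamma]_y f (p * x + q * y, x ^+ 2 + y ^+ 2)%R =
    \int[mu]_x \int[mu]_y (f (p * x + q * y, x ^+ 2 + y ^+ 2)%R *
      (W (x ^+ 2 + y ^+ 2))%:E).
  rewrite integral_normal; last 2 first.
  - exact: (measurable_fun_fubini_tonelli_F (m2 := gamma) _ (mpq p q) (fun w => f0 _)).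
  - by move=> x; exact: integral_ge0.
  apply: eq_integral => x _.
  rewrite integral_normal//; last exact: (mrow _ x (mpq p q)).
  rewrite -ge0_integralZr//; last 3 first.
  - by apply: emeasurable_funM => //; exact: (mrow _ x (mpq p q)).
  - by move=> y _; rewrite mule_ge0// lee_fin normal_pdf_ge0.
  - by rewrite lee_fin normal_pdf_ge0.
  by apply: eq_integral => y _; rewrite -muleA -EFinM -pdfE [(normal_pdf 0 1 y * _)%R]mulrC.
have r2 : (r ^+ 2 = a ^+ 2 + b ^+ 2)%R by rewrite sqr_sqrtr ?addr_ge0 ?sqr_ge0.
pose H (y : R) := \int[gamma]_x f (r * y, y ^+ 2 + x ^+ 2)%R.
have mH : measurable_fun [set: R] H.
  apply: (measurable_fun_fubini_tonelli_F (m2 := gamma)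
    (fun u : R * R => f (r * u.1, u.1 ^+ 2 + u.2 ^+ 2)%R)) => //.
  by apply: m2 => //; exact: measurable_funM.
have [az|a0] := eqVneq a 0%R.
  (* The shears degenerate; exchanging the two variables replaces them. *)
  rewrite (fubini_tonelli (m1 := gamma) (m2 := gamma)
    (fun u : R * R => f (a * u.1 + b * u.2, u.1 ^+ 2 + u.2 ^+ 2)%R) (mpq a b)
    (fun u => f0 _)).
  have rb : b = r \/ b = (- r)%R.
    have : (b == r) || (b == (- r)%R) by rewrite -eqf_sqr r2 az expr0n add0r.
    by case/orP => /eqP; [left|right].
  change (\int[gamma]_y \int[gamma]_x f (a * x + b * y, x ^+ 2 + y ^+ 2)%R =
    \int[gamma]_y H y).
  case: rb => bE.
    apply: eq_integral => y _; apply: eq_integral => x _ /=.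
    by rewrite az mul0r add0r bE addrC.
  rewrite -(normal_sym mH (fun y => integral_ge0 _ (fun x _ => f0 _))).
  apply: eq_integral => y _; apply: eq_integral => x _ /=.
  by rewrite az mul0r add0r bE addrC sqrrN mulrN mulNr.
have r0 : (0 < r)%R.
  rewrite sqrtr_gt0; apply: ltr_pwDl; last exact: sqr_ge0.
  by rewrite exprn_even_gt0//= a0.
pose g (u : R * R) : \bar R := f (r * u.1, u.2)%R * (W u.2)%:E.
have mg : measurable_fun [set: R * R] g.
  apply: emeasurable_funM; first by apply: m2 => //; exact: measurable_funM.
  by apply/measurable_EFinP; exact: (measurableT_comp mW).
have g0 u : 0 <= g u by rewrite mule_ge0// lee_fin.
have := @lebesgue_rotation (a / r) (b / r) g mg g0.
have -> : ((a / r) ^+ 2 + (b / r) ^+ 2 = 1)%R.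
  by rewrite !expr_div_n -mulrDl -r2 mulfV// expf_neq0// gt_eqF.
have -> : (a / r != 0)%R by rewrite mulf_neq0// invr_eq0 gt_eqF.
move=> /(_ isT erefl) rot.
apply: (etrans (lebesgueE a b)).
transitivity (\int[mu]_y \int[mu]_x g (a / r * x + b / r * y, x ^+ 2 + y ^+ 2)%R).
  pose k (u : R * R) : \bar R := f (a * u.1 + b * u.2, u.1 ^+ 2 + u.2 ^+ 2)%R *
    (W (u.1 ^+ 2 + u.2 ^+ 2))%:E.
  have mk : measurable_fun setT k.
    apply: emeasurable_funM; first exact: mpq.
    by apply/measurable_EFinP; exact: (measurableT_comp mW msq).
  have k0 u : 0 <= k u by apply: mule_ge0; [exact: f0|rewrite lee_fin; exact: W0].
  apply: (etrans (fubini_tonelli (m1 := mu) (m2 := mu) k mk k0)).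
  apply: eq_integral => y _; apply: eq_integral => x _; rewrite /g /k /=.
  by congr (f (_, _) * _); field; rewrite gt_eqF.
apply: (etrans rot).
transitivity (\int[gamma]_x \int[gamma]_y f (r * x + 0 * y, x ^+ 2 + y ^+ 2)%R).
  apply: (etrans _ (esym (lebesgueE r 0%R))).
  apply: eq_integral => u _; apply: eq_integral => v _.
  by rewrite /g /= mul0r addr0.
by apply: eq_integral => x _; apply: eq_integral => y _; rewrite mul0r addr0.
Qed.

End gauss_rotation.

(** * The joint law of a linear form and of the squared norm *)

Section gauss_sums.
Context (R : realType).
Local Open Scope ereal_scope.
Notation gamma := (normal_prob (0 : R) 1).
Implicit Types (s : seq R) (f : R * R -> \bar R) (w : R * R).

(** The expectation of [f (w + \sum_i (a_i z_i, z_i ^ 2))] for independent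
    standard normal [z_i], where [s] lists the [a_i]. *)
Fixpoint gsum s f w : \bar R :=
  if s is a :: s' then \int[gamma]_z gsum s' f (w.1 + a * z, w.2 + z ^+ 2)%R
  else f w.

Lemma gsum_ge0 s f w : (forall u, 0 <= f u) -> 0 <= gsum s f w.
Proof.
by move=> f0; elim: s w => [|a s IH] w //=; apply: integral_ge0 => z _.
Qed.

Let measurable_shift (a : R) : measurable_fun setT
  (fun v : (R * R) * R => (v.1.1 + a * v.2, v.1.2 + v.2 ^+ 2)%R).
Proof.
apply: measurable_fun_pair; apply: measurable_funD.
- exact: (measurableT_comp measurable_fst measurable_fst).
- by apply: measurable_funM.
- exact: (measurableT_comp measurable_snd measurable_fst).
- exact: measurable_funX.
Qed.

Lemma measurable_gsum s f : measurable_fun setT f -> (forall u, 0 <= f u) ->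
  measurable_fun setT (gsum s f).
Proof.
move=> mf f0; elim: s => [|a s IH] //=.
apply: (measurable_fun_fubini_tonelli_F (m2 := gamma)
  (fun v : (R * R) * R => gsum s f (v.1.1 + a * v.2, v.1.2 + v.2 ^+ 2)%R)).
  exact: (measurableT_comp IH (measurable_shift a)).
by move=> v; exact: gsum_ge0.
Qed.

Lemma gsum_cat s1 s2 f w : gsum (s1 ++ s2) f w = gsum s1 (gsum s2 f) w.
Proof. by elim: s1 w => [|a s IH] w //=; apply: eq_integral => z _. Qed.

Let gsum2 a b s f w : gsum (a :: b :: s) f w =
  \int[gamma]_x \int[gamma]_y
    gsum s f (w.1 + (a * x + b * y), w.2 + (x ^+ 2 + y ^+ 2))%R.
Proof.
by apply: eq_integral => x _; apply: eq_integral => y _ /=; rewrite !addrA.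
Qed.

Let measurable_gsum_shift s f w : measurable_fun setT f -> (forall u, 0 <= f u) ->
  measurable_fun setT (fun u : R * R => gsum s f (w.1 + u.1, w.2 + u.2)%R).
Proof.
move=> mf f0; apply: (measurableT_comp (measurable_gsum s mf f0)).
by apply: measurable_fun_pair; apply: measurable_funD.
Qed.

Let gsum_swap a b s f w : measurable_fun setT f -> (forall u, 0 <= f u) ->
  gsum (a :: b :: s) f w = gsum (b :: a :: s) f w.
Proof.
move=> mf f0; rewrite !gsum2.
pose k (u : R * R) := gsum s f (w.1 + (a * u.1 + b * u.2), w.2 + (u.1 ^+ 2 + u.2 ^+ 2))%R.
have mk : measurable_fun setT k.
  apply: (measurableT_comp (measurable_gsum s mf f0)).
  apply: measurable_fun_pair; apply: measurable_funD => //; apply: measurable_funD.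
  - exact: measurable_funM.
  - exact: measurable_funM.
  - exact: measurable_funX.
  - exact: measurable_funX.
have k0 u : 0 <= k u by exact: gsum_ge0.
apply: (etrans (fubini_tonelli (m1 := gamma) (m2 := gamma) k mk k0)).
apply: eq_integral => y _; apply: eq_integral => x _; rewrite /k /=.
by rewrite [(a * x + _)%R]addrC [(x ^+ 2 + _)%R]addrC.
Qed.

Let gsum_rotate a b s f w : measurable_fun setT f -> (forall u, 0 <= f u) ->
  gsum (a :: b :: s) f w = gsum (Num.sqrt (a ^+ 2 + b ^+ 2) :: 0%R :: s) f w.
Proof.
move=> mf f0; rewrite !gsum2.
apply: (etrans (gauss_rotation a b (measurable_gsum_shift s w mf f0)
  (fun u => gsum_ge0 s _ f0))).
by apply: eq_integral => x _; apply: eq_integral => y _; rewrite mul0r addr0.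
Qed.

(** Rotations bring the coefficients one after the other onto the first one. *)
Lemma gsum_canonical a s f w : measurable_fun setT f -> (forall u, 0 <= f u) ->
  gsum (a :: s) f w =
  gsum (Num.sqrt (a ^+ 2 + \sum_(b <- s) b ^+ 2) :: nseq (size s) 0%R) f w.
Proof.
move=> mf f0; elim: s a w => [|b s IH] a w.
  rewrite big_nil addr0 sqrtr_sqr /=.
  have [a0|a0] := leP 0%R a; first by rewrite ger0_norm.
  rewrite ltr0_norm//.
  pose k z := f (w.1 + a * z, w.2 + z ^+ 2)%R.
  have mk : measurable_fun [set: R] k.
    apply: (measurableT_comp mf); apply: measurable_fun_pair.
      by apply: measurable_funD => //; exact: measurable_funM.
    by apply: measurable_funD => //; exact: measurable_funX.
  apply: (etrans (esym (normal_sym mk (fun z => f0 _)))).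
  by apply: eq_integral => z _; rewrite /k mulrN mulNr sqrrN.
pose r := Num.sqrt (a ^+ 2 + b ^+ 2).
have -> : (a ^+ 2 + \sum_(c <- b :: s) c ^+ 2 = r ^+ 2 + \sum_(c <- s) c ^+ 2)%R.
  by rewrite big_cons addrA sqr_sqrtr// addr_ge0// sqr_ge0.
apply: (etrans (gsum_rotate a b s w mf f0)).
apply: (etrans (gsum_swap r 0%R s w mf f0)).
apply: (etrans _ (gsum_swap 0%R _ (nseq (size s) 0%R) w mf f0)).
by apply: eq_integral => z _; exact: IH.
Qed.

Let gsum_pos s f w : (forall u, 0 < u.2 -> f u = 0)%R -> (0 < w.2)%R -> gsum s f w = 0.
Proof.
move=> fpos; elim: s w => [|a s IH] w w0 /=; first exact: fpos.
by apply: integral0_eq => z _; apply: IH => /=; rewrite ltr_wpDr// sqr_ge0.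
Qed.

(** The first summand [z ^ 2] is positive for almost every [z]. *)
Lemma gsum_norm_gt0 a s f : measurable_fun setT f -> (forall u, 0 <= f u) ->
  (forall u, 0 < u.2 -> f u = 0)%R -> gsum (a :: s) f (0, 0)%R = 0.
Proof.
move=> mf f0 fpos /=.
have mk : measurable_fun [set: R] (fun z => gsum s f (0 + a * z, 0 + z ^+ 2)%R).
  apply: (measurableT_comp (measurable_gsum s mf f0)); apply: measurable_fun_pair.
    by apply: measurable_funD => //; exact: measurable_funM.
  by apply: measurable_funD => //; exact: measurable_funX.
apply: (etrans (integral_normal 1 mk (fun z => gsum_ge0 s _ f0))).
apply: (etrans (@ge0_negligible_integral _ _ _ lebesgue_measure setT [set 0%R] _ _ _ _ _ _)).
- exact: measurable_set1.
- exact: measurableT.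
- by apply: emeasurable_funM => //; apply/measurable_EFinP; exact: measurable_normal_pdf.
- by move=> z _; rewrite mule_ge0 ?gsum_ge0// lee_fin normal_pdf_ge0.
- exact: lebesgue_measure_set1.
apply: integral0_eq => z [_ /= /eqP z0].
by rewrite gsum_pos ?mul0e//= add0r exprn_even_gt0.
Qed.

(** Under [m] the pair [L] has the joint law of [\sum_i a_i z_i] and
    [\sum_i z_i ^ 2].  The offset [w] is what makes such laws compose along
    product measures. *)
Definition has_gsum_law d (T : measurableType d) (m : set T -> \bar R)
    (L : T -> R * R) s :=
  forall f w, measurable_fun setT f -> (forall u, 0 <= f u) ->
  \int[m]_x f (w.1 + (L x).1, w.2 + (L x).2)%R = gsum s f w.

Lemma normal_gsum_law (sigma l q : R) : sigma != 0%R -> (q * sigma ^+ 2 = 1)%R ->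
  has_gsum_law (normal_prob 0%R sigma : set (measurableTypeR R) -> \bar R)
    (fun x => (l * x, q * x ^+ 2)%R) [:: (l * sigma)%R].
Proof.
move=> s0 qs f w mf f0 /=.
pose k x := f (w.1 + l * x, w.2 + q * x ^+ 2)%R.
have mk : measurable_fun [set: R] k.
  apply: (measurableT_comp mf); apply: measurable_fun_pair.
    by apply: measurable_funD => //; exact: measurable_funM.
  apply: measurable_funD => //; apply: measurable_funM => //; exact: measurable_funX.
apply: (etrans (normal_scale s0 mk (fun x => f0 _))).
apply: eq_integral => z _; rewrite /k; congr (f (_ + _, _ + _))%R; first by rewrite mulrA.
by rewrite exprMn mulrA qs mul1r.
Qed.

Lemma null_gsum_law d (T : measurableType d) (m : {measure set T -> \bar R}) :
  m setT = 1 -> has_gsum_law m (fun=> (0, 0)%R) [::].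
Proof.
move=> m1 f w mf f0 /=; rewrite !addr0.
by rewrite integral_cst// m1 mule1; case: w.
Qed.

Lemma tuple_gsum_law d (T : measurableType d)
    (m : nat -> {sigma_finite_measure set T -> \bar R}) (L : nat -> T -> R * R)
    (s : nat -> seq R) n : (forall i, measurable_fun setT (L i)) ->
  (forall i, has_gsum_law (m i) (L i) (s i)) ->
  has_gsum_law (tuple_measure m n)
    (fun t => (\sum_(i < n) (L i (tnth t i)).1, \sum_(i < n) (L i (tnth t i)).2)%R)
    (flatten (mkseq s n)).
Proof.
elim: n m L s => [|n IH] m L s mL mLs f w mf f0.
  by rewrite integral_tuple0 !big_ord0 !addr0 /=; case: w.
have mL1 i : measurable_fun setT (fun x => (L i x).1).
  exact: (measurableT_comp measurable_fst (mL i)).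
have mL2 i : measurable_fun setT (fun x => (L i x).2).
  exact: (measurableT_comp measurable_snd (mL i)).
rewrite integral_tupleS//; last first.
  apply: (measurableT_comp mf); apply: measurable_fun_pair; apply: measurable_funD => //;
    apply: measurable_sum => i.
    exact: (measurableT_comp (mL1 i) (measurable_tnth i)).
  exact: (measurableT_comp (mL2 i) (measurable_tnth i)).
have -> : flatten (mkseq s n.+1) = s 0%N ++ flatten (mkseq (fun i => s i.+1) n).
  by rewrite /mkseq /= -[1%N]addn0 iotaDl -map_comp.
rewrite gsum_cat -mLs; last 2 first.
- exact: measurable_gsum.
- by move=> u; exact: gsum_ge0.
apply: eq_integral => x _.
rewrite -(IH (fun i => m i.+1) (fun i => L i.+1))//.
apply: eq_integral => t _; rewrite !big_ord_recl; congr f.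
rewrite (_ : tnth [tuple of x :: t] ord0 = x)// -!addrA.
by congr (_ + (_ + _), _ + (_ + _))%R; apply: eq_bigr => i _; rewrite tnthS.
Qed.

End gauss_sums.

(** * The Gaussian orthogonal ensemble *)

Section goe.
Context (R : realType).
Local Open Scope ereal_scope.
Notation gamma := (normal_prob (0 : R) 1).

Lemma tuple_measure_setT d (T : measurableType d)
    (m : nat -> {sigma_finite_measure set T -> \bar R}) n :
  (forall i, m i setT = 1) -> tuple_measure m n setT = 1.
Proof.
move=> m1.
transitivity (\int[tuple_measure m n]_t (\prod_(i < n) (1 : R))%R%:E).
  by under eq_integral do rewrite big1//; rewrite integral_cst// mul1e.
rewrite (@integral_tuple_prod _ _ _ m (fun _ _ => 1%R) (fun=> 1%R)) ?big1// => i.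
by rewrite integral_cst// mul1e; exact: m1.
Qed.

Context (p : nat).
Implicit Types (x M : 'M[R]_p) (t : p.-tuple (p.-tuple R)).

Definition goe_entry (i j : nat) : {sigma_finite_measure set (measurableTypeR R) -> \bar R} :=
  normal_prob 0%R (if i == j then Num.sqrt 2 else 1%R).

Definition goe_row (i : nat) : {sigma_finite_measure set (p.-tuple (measurableTypeR R)) -> \bar R} :=
  tuple_measure (goe_entry i) p.

Definition goe_tuple := tuple_measure goe_row p.

Definition goe_of t : 'M[R]_p := \matrix_(i, j)
  (if (i <= j)%N then tnth (tnth t i) j else tnth (tnth t j) i).

Lemma measurable_goe_of : measurable_fun setT goe_of.
Proof.
apply: measurable_mx => i j; under eq_fun do rewrite mxE.
by case: (i <= j)%N;
  exact: (measurableT_comp (measurable_tnth _) (measurable_tnth _)).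
Qed.

Definition goe_measure : {measure set 'M[R]_p -> \bar R} :=
  measure_function_pushforward__canonical__measure_function_Measure goe_tuple
    measurable_goe_of.

Lemma goe_measureE : goe_law p = goe_measure :> (set 'M[R]_p -> \bar R).
Proof.
have rowE : (fun i : nat => tuple_prod (fun j =>
    normal_prob (0 : R) (if i == j then Num.sqrt 2 else 1%R)) p) = goe_row.
  by apply/funext => i; exact: (tuple_measureE (goe_entry i)).
by rewrite /goe_law rowE (tuple_measureE goe_row).
Qed.

Lemma integral_goe (f : 'M[R]_p -> \bar R) :
  measurable_fun setT f -> (forall M, 0 <= f M) ->
  \int[goe_measure]_M f M = \int[goe_tuple]_t f (goe_of t).
Proof.
by move=> mf f0; rewrite ge0_integral_pushforward//; exact: measurable_goe_of.
Qed.

Lemma goe_measure_setT : goe_measure setT = 1.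
Proof.
rewrite /= /pushforward preimage_setT; apply: tuple_measure_setT => i.
by apply: tuple_measure_setT => j; exact: probability_setT.
Qed.

Lemma goe_of_sym t : (goe_of t)^T = goe_of t.
Proof.
apply/matrixP => i j; rewrite !mxE; case: ltngtP => // /ord_inj ij.
by rewrite ij.
Qed.

Lemma goe_measure_sym : goe_measure (~` @sym_mx R p) = 0.
Proof.
rewrite /= /pushforward (_ : _ @^-1` _ = set0) ?measure0//.
by rewrite -subset0 => t /=; apply; exact: goe_of_sym.
Qed.

Lemma sum_symmetric (F : 'I_p -> 'I_p -> R) : (forall i j, F i j = F j i) ->
  (\sum_i \sum_j F i j =
   \sum_(i < p) \sum_(j < p) (if i == j :> nat then F i j else if (i < j)%N then 2 * F i j else 0))%R.
Proof.
move=> Fs.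
have lowE : (\sum_(i < p) \sum_(j < p) (if (j < i)%N then F i j else 0) =
    \sum_(i < p) \sum_(j < p) (if (i < j)%N then F i j else 0))%R.
  rewrite exchange_big /=; apply: eq_bigr => i _; apply: eq_bigr => j _.
  by case: ifP => // _.
transitivity (\sum_(i < p) \sum_(j < p) (if i == j :> nat then F i j else 0) +
   (\sum_(i < p) \sum_(j < p) (if (i < j)%N then F i j else 0) +
    \sum_(i < p) \sum_(j < p) (if (j < i)%N then F i j else 0)))%R; last rewrite lowE.
  rewrite -!big_split; apply: eq_bigr => i _; rewrite -!big_split.
  by apply: eq_bigr => j _ /=; case: ltngtP => _; rewrite ?addr0 ?add0r.
rewrite -!big_split; apply: eq_bigr => i _; rewrite -!big_split.
by apply: eq_bigr => j _ /=; case: ltngtP => _; rewrite ?addr0 ?add0r//; ring.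
Qed.

(** The factors of the product measures are indexed by naturals, not ordinals. *)
Definition entry_nat x (i j : nat) : R :=
  if (insub i, insub j) is (Some i', Some j') then x i' j' else 0%R.

Lemma entry_natE x (i j : 'I_p) : entry_nat x i j = x i j.
Proof. by rewrite /entry_nat !valK. Qed.

(** The part of [<x, H>] and of [|H| ^ 2 / 2] due to the entries [(i, j)] and
    [(j, i)] of [H].  Off the diagonal the entry occurs twice, and on the diagonal
    its variance is 2, so that the second components are squares of independent
    standard normal variables. *)
Definition goe_form x (i j : nat) (y : R) : R * R :=
  if i == j then (entry_nat x i j * y, 2^-1 * y ^+ 2)%R
  else if (i < j)%N then (2 * entry_nat x i j * y, 1 * y ^+ 2)%R
  else (0, 0)%R.

Definition goe_coef x (i j : nat) : seq R :=
  if i == j then [:: entry_nat x i j * Num.sqrt 2]%R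
  else if (i < j)%N then [:: 2 * entry_nat x i j * 1]%R else [::].

Definition goe_coefs x : seq R :=
  flatten (mkseq (fun i => flatten (mkseq (goe_coef x i) p)) p).

Lemma measurable_goe_form x i j : measurable_fun [set: R] (goe_form x i j).
Proof.
rewrite /goe_form; case: (i == j); last case: (i < j)%N; last exact: measurable_cst.
- by apply: measurable_fun_pair; apply: measurable_funM => //; exact: measurable_funX.
- by apply: measurable_fun_pair; apply: measurable_funM => //; exact: measurable_funX.
Qed.

Lemma goe_form_law x i j : has_gsum_law (goe_entry i j) (goe_form x i j) (goe_coef x i j).
Proof.
rewrite /goe_form /goe_coef /goe_entry /=; case: eqVneq => _.
  apply: normal_gsum_law; first by rewrite gt_eqF// sqrtr_gt0.
  by rewrite sqr_sqrtr// mulVf.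
case: ifP => _.
  by apply: normal_gsum_law; rewrite ?oner_eq0// expr1n mulr1.
by apply: null_gsum_law; exact: probability_setT.
Qed.

Let goe_dot x t : x^T = x ->
  (\sum_i \sum_j x i j * goe_of t i j =
   \sum_(i < p) \sum_(j < p) (goe_form x i j (tnth (tnth t i) j)).1)%R.
Proof.
move=> xs; rewrite sum_symmetric; last first.
  by move=> i j; rewrite -{1}xs -{1}(goe_of_sym t) !mxE.
apply: eq_bigr => i _; apply: eq_bigr => j _; rewrite /goe_form mxE entry_natE.
case: eqVneq => ij; first by rewrite ij leqnn.
by case: ltnP => ij' //=; rewrite ?(ltnW ij')// mulrA.
Qed.

Lemma goe_fsq x t :
  (fsq (goe_of t) / 2 =
   \sum_(i < p) \sum_(j < p) (goe_form x i j (tnth (tnth t i) j)).2)%R.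
Proof.
rewrite /fsq sum_symmetric; last first.
  by move=> i j; rewrite -{1}(goe_of_sym t) mxE.
rewrite mulr_suml; apply: eq_bigr => i _; rewrite mulr_suml.
apply: eq_bigr => j _; rewrite /goe_form mxE.
case: eqVneq => ij; first by rewrite ij leqnn mulrC.
by case: ltnP => ij' //=; rewrite ?(ltnW ij') ?mul0r//; field.
Qed.

Lemma goe_gsum x (f : R * R -> \bar R) : x^T = x ->
  measurable_fun setT f -> (forall u, 0 <= f u) ->
  \int[goe_measure]_M f (\sum_i \sum_j x i j * M i j, fsq M / 2)%R =
  gsum (goe_coefs x) f (0, 0)%R.
Proof.
move=> xs mf f0; rewrite integral_goe//; last first.
  apply: (measurableT_comp mf); apply: measurable_fun_pair.
    apply: measurable_sum => i; apply: measurable_sum => j.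
    by apply: measurable_funM => //; exact: measurable_entry.
  by apply: measurable_funM => //; exact: measurable_fsq.
have mform i j : measurable_fun [set: R] (goe_form x i j) by exact: measurable_goe_form.
have rowlaw i : has_gsum_law (goe_row i)
    (fun u => (\sum_(j < p) (goe_form x i j (tnth u j)).1,
               \sum_(j < p) (goe_form x i j (tnth u j)).2)%R)
    (flatten (mkseq (goe_coef x i) p)).
  exact: (@tuple_gsum_law R _ (measurableTypeR R) (goe_entry i) (goe_form x i)
    (goe_coef x i) p (mform i) (goe_form_law x i)).
have mrow i : measurable_fun setT (fun u : p.-tuple R =>
    (\sum_(j < p) (goe_form x i j (tnth u j)).1,
     \sum_(j < p) (goe_form x i j (tnth u j)).2)%R).
  apply: measurable_fun_pair; apply: measurable_sum => j.
    exact: (measurableT_comp (measurableT_comp measurable_fst (mform i j)) (measurable_tnth j)).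
  exact: (measurableT_comp (measurableT_comp measurable_snd (mform i j)) (measurable_tnth j)).
rewrite -(@tuple_gsum_law R _ (p.-tuple (measurableTypeR R)) goe_row _ _ p
  mrow rowlaw)//.
by apply: eq_integral => t _; rewrite goe_dot// (goe_fsq x)/= !add0r.
Qed.

Let size_goe_coefs x y : size (goe_coefs x) = size (goe_coefs y).
Proof.
rewrite !size_flatten; congr sumn; rewrite /shape -!map_comp.
apply: eq_map => i /=; rewrite !size_flatten; congr sumn; rewrite /shape -!map_comp.
by apply: eq_map => j /=; rewrite /goe_coef; do 2 case: ifP => _ //.
Qed.

Let sum_goe_coefs x : x^T = x ->
  (\sum_(b <- goe_coefs x) b ^+ 2 = 2 * fsq x)%R.
Proof.
have iotaE q (F : nat -> R) : (\sum_(i <- iota 0 q) F i = \sum_(i < q) F i)%R.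
  by rewrite -(big_mkord xpredT) /index_iota subn0.
move=> xs; rewrite /fsq sum_symmetric; last by move=> i j; rewrite -{1}xs mxE.
rewrite big_flatten big_map iotaE mulr_sumr.
apply: eq_bigr => i _.
rewrite big_flatten big_map iotaE mulr_sumr.
apply: eq_bigr => j _; rewrite /goe_coef entry_natE.
case: eqVneq => _; first by rewrite big_seq1 exprMn sqr_sqrtr// mulrC.
by case: ifP => _; rewrite ?big_seq1 ?big_nil ?mulr0//; ring.
Qed.

Let goe_coefs_cons x : (0 < p)%N -> exists a s, goe_coefs x = a :: s.
Proof.
have flattenE q (F : nat -> seq R) : (0 < q)%N ->
    exists s, flatten (mkseq F q) = F 0%N ++ s.
  by case: q => // q _; exists (flatten (map F (iota 1 q))).
move=> p0; rewrite /goe_coefs; have [s ->] := flattenE p (fun i => flatten (mkseq (goe_coef x i) p)) p0.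
have [s' ->] := flattenE p (goe_coef x 0) p0.
by rewrite /goe_coef eqxx /=; eexists; eexists.
Qed.

(** In terms of standard normal variables, the linear form [<x, H>] has a
    coefficient vector of squared norm [2 * |x| ^ 2], and [gsum_canonical] rotates
    it onto the first axis. *)
Lemma goe_isotropic x y (f : R * R -> \bar R) : (0 < p)%N ->
  x^T = x -> y^T = y -> fsq x = fsq y ->
  measurable_fun setT f -> (forall u, 0 <= f u) ->
  \int[goe_measure]_M f (\sum_i \sum_j x i j * M i j, fsq M / 2)%R =
  \int[goe_measure]_M f (\sum_i \sum_j y i j * M i j, fsq M / 2)%R.
Proof.
move=> p0 xs ys xy mf f0; rewrite !goe_gsum//.
have [a [s xE]] := goe_coefs_cons x p0; have [b [s' yE]] := goe_coefs_cons y p0.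
have := sum_goe_coefs xs; have := sum_goe_coefs ys; have := size_goe_coefs x y.
rewrite xE yE !big_cons => -[ss'] yss xss.
by rewrite (gsum_canonical a)// (gsum_canonical b)// xss yss xy ss'.
Qed.

Lemma goe_measure_fsq0 : (0 < p)%N -> goe_measure [set M | fsq M = 0%R] = 0.
Proof.
move=> p0.
have mA : measurable [set M : 'M[R]_p | fsq M = 0%R].
  rewrite (_ : mkset _ = (fun M : 'M[R]_p => fsq M) @^-1` [set 0%R])//.
  by rewrite -[X in measurable X]setTI; exact: measurable_fsq.
pose B : set (R * R) := [set u | (u.2 <= 0)%R].
have mB : measurable B.
  rewrite (_ : B = (snd : R * R -> R) @^-1` [set` `]-oo, 0%R]%R]); last first.
    by apply/seteqP; split=> u /=; rewrite in_itv.
  by rewrite -[X in measurable X]setTI; exact: measurable_snd.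
pose f (u : R * R) : \bar R := (\1_B u)%:E.
have mf : measurable_fun setT f by exact/measurable_EFinP/measurable_indic.
have f0 u : 0 <= f u by rewrite lee_fin.
have fpos (u : R * R) : (0 < u.2)%R -> f u = 0.
  by move=> u0; rewrite /f indicE memNset//= /B /=; apply/negP; rewrite -ltNge.
have := @goe_gsum 0%R f (trmx0 _ _ _) mf f0.
have [a [s ->]] := goe_coefs_cons 0%R p0.
rewrite gsum_norm_gt0// => E.
apply/eqP; rewrite eq_le measure_ge0 andbT -E -[X in goe_measure X]setIT -integral_indic//.
apply: ge0_le_integral => //.
- exact/measurable_EFinP/measurable_indic.
- apply: (measurableT_comp mf); apply: measurable_fun_pair.
    apply: measurable_sum => i; apply: measurable_sum => j.
    by apply: measurable_funM => //; exact: measurable_entry.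
  by apply: measurable_funM => //; exact: measurable_fsq.
move=> M _; rewrite lee_fin !indicE ler_nat; case: (boolP (M \in _)) => // /set_mem /= M0.
by rewrite mem_set//= /B /= M0 mul0r.
Qed.

End goe.

(** * Concentration of the norm of the Gaussian orthogonal ensemble *)

Section goe_radius.
Context (R : realType).
Local Open Scope ereal_scope.
Notation mu := (@lebesgue_measure R).
Notation gamma := (normal_prob (0 : R) 1).

Let inv_1B_le (v : R) : (v <= 1 / 2 -> (1 - v)^-1 <= expR (v + 2 * v ^+ 2))%R.
Proof.
move=> v2; have v1 : (0 < 1 - v)%R by lra.
rewrite -[leLHS]mul1r ler_pdivrMr//.
have := expR_ge1Dx (v + 2 * v ^+ 2)%R; set e := expR _ => eE.
apply: le_trans (_ : (1 + (v + 2 * v ^+ 2)) * (1 - v) <= _)%R; last by rewrite ler_pM2r.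
have : (0 <= v ^+ 2 * (1 - 2 * v))%R by rewrite mulr_ge0 ?sqr_ge0//; lra.
rewrite !expr2; nra.
Qed.

(** The left-hand side is [exp (- u) / sqrt (1 - 2 u)], whose logarithm vanishes to
    second order at 0. *)
Lemma gauss_laplace (u : R) : (u <= 1 / 4)%R ->
  \int[gamma]_z (expR (u * (z ^+ 2 - 1)))%:E <= (expR (4 * u ^+ 2))%:E.
Proof.
move=> u4; have a0 : (0 < 1 - 2 * u)%R by lra.
have mk : measurable_fun [set: R] (fun z : R => (expR (u * (z ^+ 2 - 1)))%:E).
  apply/measurable_EFinP; apply: measurableT_comp => //; apply: measurable_funM => //.
  by apply: measurable_funB => //; exact: measurable_funX.
have k0 (z : R) : 0 <= (expR (u * (z ^+ 2 - 1)))%:E by rewrite lee_fin expR_ge0.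
rewrite (integral_normal 1 mk k0).
pose c := (expR (- u) * normal_peak 1)%R.
have c0 : (0 <= c)%R by rewrite mulr_ge0 ?expR_ge0// normal_peak_ge0.
have -> : \int[mu]_z ((expR (u * (z ^+ 2 - 1)))%:E * (normal_pdf 0%R 1 z)%:E) =
    \int[mu]_z (c%:E * (expR (- ((1 - 2 * u) * (z + 0) ^+ 2) / 2))%:E).
  apply: eq_integral => z _; rewrite -!EFinM; congr EFin.
  rewrite normal_pdfE ?oner_eq0// /normal_fun /c.
  rewrite mulrCA [(expR (- u) * _)%R]mulrC -[RHS]mulrA -!expRD; congr (_ * expR _)%R.
  by rewrite subr0 addr0 expr1n; field.
rewrite ge0_integralZl//; last first.
  apply/measurable_EFinP; apply: measurableT_comp => //; apply: measurable_funM => //.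
  apply: measurableT_comp => //; apply: measurable_funM => //.
  by apply: measurable_funX; exact: measurable_funD.
rewrite integral_gauss1// -EFinM lee_fin.
have pi2 : (0 < pi *+ 2 :> R)%R by rewrite mulrn_wgt0// pi_gt0.
have peakE : (normal_peak 1 = (Num.sqrt (pi *+ 2))^-1 :> R)%R.
  by rewrite /normal_peak expr1n mul1r.
rewrite /c peakE (sqrtrM _ (ltW pi2)) mulrA -[(_ * _ * Num.sqrt (pi *+ 2))%R]mulrA.
rewrite mulVf ?mulr1; last by rewrite gt_eqF// sqrtr_gt0.
have v2 : (2 * u <= 1 / 2)%R by lra.
have := inv_1B_le v2 => /ler_wsqrtr h.
apply: le_trans (ler_wpM2l (expR_ge0 _) h) _.
have -> : (Num.sqrt (expR (2 * u + 2 * (2 * u) ^+ 2)) = expR (u + 4 * u ^+ 2))%R.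
  have -> : (2 * u + 2 * (2 * u) ^+ 2 = 2%:R * (u + 4 * u ^+ 2))%R by ring.
  by rewrite expRM_natl sqrtr_sqr ger0_norm// expR_ge0.
by rewrite -expRD ler_expR; lra.
Qed.

Let entry_fluct (i j : nat) (y : R) : R :=
  ((if i == j then 2^-1 * y ^+ 2 else if (i < j)%N then 1 * y ^+ 2 else 0) - (i <= j)%N%:R)%R.

Let entry_laplace i j (u : R) : (u <= 1 / 4)%R ->
  \int[@goe_entry R i j]_y (expR (u * entry_fluct i j y))%:E <= (expR (4 * u ^+ 2))%:E.
Proof.
move=> u4; rewrite /goe_entry /entry_fluct.
have mk (q : R) : measurable_fun [set: R] (fun y : R => (expR (u * (q * y ^+ 2 - 1)))%:E).
  apply/measurable_EFinP; apply: measurableT_comp => //; apply: measurable_funM => //.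
  by apply: measurable_funB => //; apply: measurable_funM => //; exact: measurable_funX.
have k0 (q y : R) : 0 <= (expR (u * (q * y ^+ 2 - 1)))%:E by rewrite lee_fin expR_ge0.
case: ltngtP => _.
- under eq_integral do rewrite mul1r; exact: gauss_laplace.
- under eq_integral do rewrite subr0 mulr0 expR0.
  rewrite integral_cst// [X in _ * X](probability_setT gamma) mule1 lee_fin.
  by rewrite -[leLHS]expR0 ler_expR mulr_ge0// sqr_ge0.
- have s0 : (Num.sqrt 2 != 0 :> R)%R by rewrite gt_eqF// sqrtr_gt0.
  apply: le_trans _ (gauss_laplace u4).
  rewrite (normal_scale s0 (mk _) (k0 _)).
  under eq_integral do rewrite exprMn sqr_sqrtr// mulrA mulVf// mul1r.
  exact: lexx.
Qed.

Context (p : nat).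

(** The mean of [fsq] is [p ^ 2 + p]. *)
Let fluctE (t : p.-tuple (p.-tuple R)) :
  (fsq (goe_of t) - p%:R ^+ 2 - p%:R =
   2 * \sum_(i < p) \sum_(j < p) entry_fluct i j (tnth (tnth t i) j))%R.
Proof.
have cnt : ((\sum_(i < p) \sum_(j < p) ((i <= j)%N%:R : R)) *+ 2 = p%:R ^+ 2 + p%:R)%R.
  have lowE : (\sum_(i < p) \sum_(j < p) ((i <= j)%N%:R : R) =
      \sum_(i < p) \sum_(j < p) ((j <= i)%N%:R : R))%R by rewrite exchange_big.
  transitivity (\sum_(i < p) \sum_(j < p) (1 + (i == j)%:R : R))%R.
    rewrite mulr2n {2}lowE -big_split; apply: eq_bigr => i _.
    rewrite -big_split; apply: eq_bigr => j _ /=.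
    by rewrite -val_eqE /=; case: ltngtP => _; rewrite ?addr0 ?add0r.
  under eq_bigr => i _.
    rewrite big_split /= sumr_const card_ord (bigD1 i)//= eqxx big1 ?addr0; last first.
      by move=> j; rewrite eq_sym => /negbTE ->.
    over.
  rewrite big_split /= !sumr_const card_ord; rewrite -mulr_natr expr2; ring.
have -> : (\sum_(i < p) \sum_(j < p) entry_fluct i j (tnth (tnth t i) j) =
    fsq (goe_of t) / 2 - \sum_(i < p) \sum_(j < p) ((i <= j)%N%:R : R))%R.
  rewrite (goe_fsq 0 t) -sumrB; apply: eq_bigr => i _; rewrite -sumrB.
  apply: eq_bigr => j _; rewrite /entry_fluct /goe_form.
  by case: ltngtP => _.
move: cnt; set S := (\sum_i _)%R; rewrite mulr2n; lra.
Qed.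

Let measurable_entry_fluct i j : measurable_fun [set: R] (entry_fluct i j).
Proof.
rewrite /entry_fluct; apply: measurable_funB => //.
case: (i == j); last case: (i < j)%N; last exact: measurable_cst.
- by apply: measurable_funM => //; exact: measurable_funX.
- by apply: measurable_funM => //; exact: measurable_funX.
Qed.

Let goe_laplace (s : R) : (s <= 1 / 8)%R ->
  \int[@goe_measure R p]_M (expR (s * (fsq M - p%:R ^+ 2 - p%:R)))%:E <=
  (expR (16 * s ^+ 2) ^+ p ^+ p)%:E.
Proof.
move=> s8; rewrite integral_goe//; last first.
  apply/measurable_EFinP; apply: measurableT_comp => //; apply: measurable_funM => //.
  by do 2 apply: measurable_funB => //; exact: measurable_fsq.
pose f i j (y : R) : R := expR (2 * s * entry_fluct i j y).
have mf i j : measurable_fun [set: R] (f i j).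
  apply: measurableT_comp => //; apply: measurable_funM => //.
have f0 i j y : (0 <= f i j y)%R by exact: expR_ge0.
have u4 : (2 * s <= 1 / 4)%R by lra.
have s2 : (4 * (2 * s) ^+ 2 = 16 * s ^+ 2)%R by ring.
have fle i j : \int[goe_entry R i j]_y (f i j y)%:E <= (expR (16 * s ^+ 2))%:E.
  by rewrite -s2; exact: entry_laplace.
have mrow i : measurable_fun setT (fun u : p.-tuple R => \prod_(j < p) f i j (tnth u j))%R.
  exact: (measurable_tuple_prod (mf i)).
have row0 i (u : p.-tuple R) : (0 <= \prod_(j < p) f i j (tnth u j))%R.
  by apply: prodr_ge0 => j _.
have rowle i : \int[goe_row R p i]_u (\prod_(j < p) f i j (tnth u j))%:E <=
    (expR (16 * s ^+ 2) ^+ p)%:E.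
  apply: le_trans (@integral_tuple_prod_le _ _ _ (goe_entry R i) (f i)
    (fun=> expR (16 * s ^+ 2)) p (mf i) (f0 i) (fle i)) _.
  by rewrite prodr_const card_ord.
have := @integral_tuple_prod_le _ _ _ (goe_row R p) (fun i u => \prod_(j < p) f i j (tnth u j))%R
  (fun=> expR (16 * s ^+ 2) ^+ p)%R p mrow row0 rowle.
rewrite prodr_const card_ord; apply: le_trans.
rewrite le_eqVlt; apply/orP; left; apply/eqP.
apply: eq_integral => t _; congr EFin.
rewrite fluctE mulrA [(s * 2)%R]mulrC mulr_sumr expR_sum; apply: eq_bigr => i _.
by rewrite mulr_sumr expR_sum.
Qed.

(** Up to the mean, [fsq] is twice a sum of [p (p + 1) / 2] independent centred
    terms, hence of order [p].  Its Laplace transform at [s = 1 / (8 p)] is bounded,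
    and [|x| <= exp x + exp (- x)] turns this into a bound on the first moment. *)
Lemma goe_radius : (0 < p)%N ->
  \int[@goe_measure R p]_M `|fsq M - p%:R ^+ 2|%:E <= (17 * expR 1 * p%:R)%:E.
Proof.
move=> p0; have pR : (0 < p%:R :> R)%R by rewrite ltr0n.
have p1 : (1 <= p%:R :> R)%R by rewrite ler1n.
pose X (M : 'M[R]_p) : R := (fsq M - p%:R ^+ 2 - p%:R)%R.
have mX : measurable_fun setT X.
  by do 2 apply: measurable_funB => //; exact: measurable_fsq.
pose s : R := (8 * p%:R)^-1%R.
have s0 : (0 < s)%R by rewrite invr_gt0 mulr_gt0.
have s8 : (s <= 1 / 8)%R.
  by rewrite /s invfM mul1r ler_piMr// invf_le1.
have lap (t : R) : (t ^+ 2 = s ^+ 2)%R -> (t <= 1 / 8)%R ->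
    \int[@goe_measure R p]_M (expR (t * X M))%:E <= (expR 1)%:E.
  move=> ts t8; apply: le_trans (goe_laplace t8) _.
  rewrite lee_fin -exprM -expRM_natl ler_expR ts.
  have -> : ((p * p)%:R * (16 * s ^+ 2) = 1 / 4)%R.
    by rewrite natrM /s; field; rewrite gt_eqF.
  lra.
have mexp t : measurable_fun setT (fun M => (expR (t * X M))%:E).
  by apply/measurable_EFinP; apply: measurableT_comp => //; exact: measurable_funM.
have ptw M : `|fsq M - p%:R ^+ 2|%:E <=
    (8 * p%:R)%:E * ((expR (s * X M))%:E + (expR (- s * X M))%:E) + p%:R%:E.
  rewrite -[(expR (s * X M))%:E + _]EFinD -EFinM -EFinD lee_fin.
  have -> : (fsq M - p%:R ^+ 2 = X M + p%:R)%R by rewrite /X subrK.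
  apply: le_trans (ler_normD _ _) _; rewrite [`|p%:R|%R]ger0_norm//.
  rewrite lerD2r; have h1 := expR_ge1Dx (s * X M); have h2 := expR_ge1Dx (- s * X M).
  have e1 := expR_ge0 (s * X M); have e2 := expR_ge0 (- s * X M).
  have -> : (`|X M| = 8 * p%:R * `|s * X M|)%R.
    by rewrite normrM gtr0_norm// mulrA /s mulfV ?mul1r// gt_eqF// mulr_gt0.
  rewrite ler_pM2l ?mulr_gt0// ler_norml.
  by apply/andP; split; lra.
apply: le_trans (_ : \int[@goe_measure R p]_M
    ((8 * p%:R)%:E * ((expR (s * X M))%:E + (expR (- s * X M))%:E) + p%:R%:E) <= _).
  apply: le_integral_nonmeasurable => M; last exact: ptw.
  by rewrite lee_fin.
have sum0 M : 0 <= (expR (s * X M))%:E + (expR (- s * X M))%:E.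
  by rewrite adde_ge0// lee_fin expR_ge0.
have msum : measurable_fun setT (fun M => (expR (s * X M))%:E + (expR (- s * X M))%:E).
  exact: emeasurable_funD.
have p8 : 0 <= (8 * p%:R)%:E :> \bar R by rewrite lee_fin mulr_ge0// ltW.
rewrite ge0_integralD//; last 2 first.
- by move=> M _; exact: mule_ge0.
- exact: emeasurable_funM.
rewrite ge0_integralZl// ge0_integralD//.
rewrite integral_cst// [X in _ + _ * X]goe_measure_setT mule1.
have l1 := lap s erefl s8.
have l2 : \int[@goe_measure R p]_M (expR (- s * X M))%:E <= (expR 1)%:E.
  by apply: lap; rewrite ?sqrrN//; lra.
apply: le_trans (_ : (8 * p%:R)%:E * ((expR 1)%:E + (expR 1)%:E) + p%:R%:E <= _).
  by rewrite leeD2r// lee_wpmul2l// leeD.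
rewrite -[(expR 1)%:E + _]EFinD -EFinM -EFinD lee_fin.
have := expR_ge1Dx (1 : R); nra.
Qed.

End goe_radius.

(** * Uniqueness of the uniform law on the sphere *)

Section sphere.
Context (R : realType) (p : nat).
Local Open Scope ereal_scope.
Implicit Types (x y z : 'M[R]_p).
Notation S := (@sym_sphere R p).

Definition mxdot x y : R := \sum_i \sum_j x i j * y i j.

Lemma frob_dotE x y : frob_dot x y = mxdot x y.
Proof.
rewrite /frob_dot /mxdot /mxtrace exchange_big; apply: eq_bigr => j _.
by rewrite mxE; apply: eq_bigr => i _; rewrite mxE.
Qed.

Lemma mxdotxx x : mxdot x x = fsq x.
Proof. by apply: eq_bigr => i _; apply: eq_bigr => j _; rewrite expr2. Qed.

Lemma mxdotC x y : mxdot x y = mxdot y x.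
Proof. by apply: eq_bigr => i _; apply: eq_bigr => j _; rewrite mulrC. Qed.

Lemma mxdotDl x y z : mxdot (x + y) z = (mxdot x z + mxdot y z)%R.
Proof.
rewrite -big_split; apply: eq_bigr => i _; rewrite -big_split.
by apply: eq_bigr => j _; rewrite mxE mulrDl.
Qed.

Lemma mxdotZl a x y : mxdot (a *: x) y = (a * mxdot x y)%R.
Proof.
rewrite /mxdot mulr_sumr; apply: eq_bigr => i _; rewrite mulr_sumr.
by apply: eq_bigr => j _; rewrite mxE mulrA.
Qed.

Lemma fsqB x y : fsq (x - y) = (fsq x + fsq y - 2 * mxdot x y)%R.
Proof.
rewrite -!mxdotxx mxdotDl [mxdot x (x - y)]mxdotC [mxdot (- y) _]mxdotC.
rewrite !mxdotDl -scaleN1r !mxdotZl [mxdot y (-1 *: y)]mxdotC [mxdot x (-1 *: y)]mxdotC.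
by rewrite !mxdotZl [mxdot y x]mxdotC; ring.
Qed.

Lemma sphereE x : S x <-> x^T = x /\ fsq x = (p%:R ^+ 2)%R.
Proof.
by split=> -[xs xp]; split=> //; move: xp; rewrite fsq_trace xs.
Qed.

Lemma measurable_sphere : measurable S.
Proof.
rewrite (_ : S = @sym_mx R p `&` (fun M : 'M[R]_p => fsq M) @^-1` [set (p%:R ^+ 2)%R]).
  apply: measurableI; first exact: measurable_sym.
  by rewrite -[X in measurable X]setTI; exact: measurable_fsq.
by apply/seteqP; split=> x /=; [move/sphereE|move=> h; exact/sphereE].
Qed.

Definition mxball x (e : R) : set 'M[R]_p := [set y | (fsq (x - y) < e ^+ 2)%R].

Lemma measurable_mxball x e : measurable (mxball x e).
Proof.
rewrite (_ : mxball x e = (fun y => fsq (x - y)) @^-1` [set` `]-oo, (e ^+ 2)%R[%R]); last first.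
  by apply/seteqP; split=> y /=; rewrite in_itv.
rewrite -[X in measurable X]setTI.
have mf : measurable_fun setT (fun y : 'M[R]_p => fsq (x - y)).
  by apply: measurable_fsq; apply: measurable_submx => //; exact: measurable_cst.
exact: mf.
Qed.

Lemma mxballP x y e : (0 <= e)%R -> mxball x e y <-> (fnorm (x - y) < e)%R.
Proof.
move=> e0; by rewrite /mxball /= -fnorm_sqr (@ltr_pXn2r _ 2)// ?nnegrE ?fnorm_ge0.
Qed.

Definition reflection (w : 'M[R]_p) z : 'M[R]_p :=
  z - (2 * mxdot w z / fsq w) *: w.

Let reflection_linear w : linear (reflection w).
Proof.
move=> a u v; rewrite /reflection mxdotC mxdotDl mxdotZl ![mxdot _ w]mxdotC.
rewrite scalerBr scalerA addrACA -opprD -scalerDl; congr (_ - _ *: _)%R.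
ring.
Qed.

Lemma mxdot_reflection w u v : fsq w != 0%R ->
  mxdot (reflection w u) (reflection w v) = mxdot u v.
Proof.
move=> w0; rewrite /reflection; set a := (2 * mxdot w u / _)%R; set b := (2 * mxdot w v / _)%R.
rewrite -[(- (a *: w))%R]scaleNr -[(- (b *: w))%R]scaleNr mxdotDl mxdotZl.
rewrite ![mxdot _ (v + _)]mxdotC !mxdotDl !mxdotZl mxdotxx.
rewrite [mxdot w u]mxdotC [mxdot v w]mxdotC [mxdot v u]mxdotC.
rewrite /a /b [mxdot w u]mxdotC.
by field.
Qed.

Lemma fsq_eq0E (x : 'M[R]_p) : (fsq x == 0%R) = (x == 0%R).
Proof.
apply/eqP/eqP => [/fsq_eq0//|->].
by rewrite /fsq big1// => i _; rewrite big1// => j _; rewrite mxE expr0n.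
Qed.

Context (Q : probability 'M[R]_p R) (hQ : uniform_sym_sphere Q).

(** The reflection along [x - y] exchanges [x] and [y]. *)
Let Q_ball_le x y e : S x -> S y -> Q (S `&` mxball x e) <= Q (S `&` mxball y e).
Proof.
move=> Sx Sy; have [<-//|xy] := eqVneq x y.
have [xs xp] := (sphereE x).1 Sx; have [ys yp] := (sphereE y).1 Sy.
pose w := (x - y)%R.
have w0 : fsq w != 0%R by rewrite fsq_eq0E subr_eq0.
pose f : {linear 'M[R]_p -> 'M[R]_p} :=
  HB.pack (reflection w) (GRing.isLinear.Build _ _ _ _ (reflection w) (reflection_linear w)).
have ws : w^T = w by rewrite /w linearB /= xs ys.
have fsym z : z^T = z -> (f z)^T = f z.
  by move=> zs; rewrite /= /reflection linearB /= linearZ /= zs ws.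
have fiso : sym_isometry f.
  by split=> [z|u v _ _]; [exact: fsym|rewrite !frob_dotE mxdot_reflection].
have fx : f x = y.
  rewrite /= /reflection (_ : 2 * mxdot w x / fsq w = 1)%R ?scale1r ?subKr//.
  have wE : fsq w = (2 * mxdot w x)%R.
    rewrite /w fsqB xp yp -[(- y)%R]scaleN1r mxdotDl mxdotZl mxdotxx xp [mxdot y x]mxdotC; ring.
  by rewrite -wE mulfV.
have ffsq z : fsq (f z) = fsq z by rewrite -!mxdotxx mxdot_reflection.
have mB : measurable (S `&` mxball y e).
  by apply: measurableI; [exact: measurable_sphere|exact: measurable_mxball].
rewrite -[leRHS](hQ.2 f fiso _ mB); apply: le_measure; rewrite ?inE//.
- by apply: measurableI; [exact: measurable_sphere|exact: measurable_mxball].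
- rewrite -[X in measurable X]setTI.
  have mf : measurable_fun setT (fun z : 'M[R]_p => reflection w z).
    apply: measurable_submx => //; apply: measurable_scalemx; last exact: measurable_cst.
    apply: measurable_funM => //; apply: measurable_funM => //.
    apply: measurable_sum => i; apply: measurable_sum => j.
    by apply: measurable_funM => //; exact: measurable_entry.
  exact: mf.
- move=> z [/sphereE [zs zp] zx]; split.
    by apply/sphereE; split; [exact: fsym|rewrite ffsq].
  by rewrite /mxball /= -[in X in (X < _)%R]fx -[X in fsq X]linearB ffsq.
Qed.

Lemma sphere_ball_const x y e : S x -> S y -> Q (S `&` mxball x e) = Q (S `&` mxball y e).
Proof. by move=> Sx Sy; apply/eqP; rewrite eq_le !Q_ball_le. Qed.

Let rational_approx x e : (0 < e)%R ->
  exists q : 'M[rat]_p, (fnorm (map_mx ratr q - x) < e)%R.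
Proof.
move=> e0; pose h := (e / p.+1%:R)%R.
have h0 : (0 < h)%R by rewrite divr_gt0.
have ex i j : exists q : rat, (`|ratr q - x i j| < h)%R.
  have : (x i j - h < x i j + h)%R by lra.
  move=> /rat_in_itvoo [q]; rewrite in_itv /= => /andP[q1 q2].
  by exists q; rewrite ltr_norml; apply/andP; split; lra.
have [q hq] := choice (fun ij : 'I_p * 'I_p => ex ij.1 ij.2).
exists (\matrix_(i, j) q (i, j)).
rewrite -(@ltr_pXn2r _ 2)// ?nnegrE ?fnorm_ge0 ?ltW// fnorm_sqr.
apply: le_lt_trans (_ : \sum_(i < p) \sum_(j < p) h ^+ 2 < _)%R.
  apply: ler_sum => i _; apply: ler_sum => j _; rewrite !mxE.
  rewrite -real_normK ?num_real// lerXn2r ?nnegrE// ?ltW//; exact: (hq (i, j)).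
rewrite !sumr_const !card_ord -mulrnA -mulr_natr /h expr_div_n -mulrA.
rewrite gtr_pMr ?exprn_gt0// mulrC ltr_pdivrMr ?exprn_gt0// mul1r.
by rewrite -natrX ltr_nat expnS expn1 ltn_mul.
Qed.

(** Otherwise the sphere would be covered by countably many null sets, namely its
    intersections with balls of rational centres. *)
Lemma sphere_ball_gt0 x e : S x -> (0 < e)%R -> 0 < Q (S `&` mxball x e).
Proof.
move=> Sx e0; rewrite lt0e measure_ge0 andbT; apply/eqP => Q0.
have e20 : (0 < e / 2)%R by rewrite divr_gt0.
pose F (n : nat) : set 'M[R]_p :=
  if unpickle n is Some q then S `&` mxball (map_mx ratr (q : 'M[rat]_p)) (e / 2)
  else set0.
have mF n : measurable (F n).
  rewrite /F; case: unpickle => // q.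
  by apply: measurableI; [exact: measurable_sphere|exact: measurable_mxball].
have F0 n : Q (F n) = 0.
  rewrite /F; case: unpickle => [q|]; last exact: measure0.
  have [[z [Sz qz]]|none] := pselect (exists z, S z /\ mxball (map_mx ratr q) (e / 2) z).
    apply/eqP; rewrite eq_le measure_ge0 andbT -Q0 (sphere_ball_const e Sx Sz).
    apply: le_measure; rewrite ?inE//.
    - by apply: measurableI; [exact: measurable_sphere|exact: measurable_mxball].
    - by apply: measurableI; [exact: measurable_sphere|exact: measurable_mxball].
    move=> y [Sy qy]; split => //.
    move: qz qy; rewrite !mxballP ?ltW// => qz qy.
    rewrite (_ : z - y = - (map_mx ratr q - z) + (map_mx ratr q - y))%R; last first.
      by rewrite opprB addrA subrK.
    by apply: le_lt_trans (fnormD _ _) _; rewrite fnormN; lra.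
  rewrite (_ : _ `&` _ = set0) ?measure0// -subset0 => z [Sz qz].
  by apply: none; exists z.
have SF : S `<=` \bigcup_n F n.
  move=> z Sz; have [q hq] := rational_approx z e20.
  exists (pickle q) => //; rewrite /F pickleK; split => //.
  by apply/mxballP => //; exact: ltW.
have : Q S <= 0.
  apply: le_trans (measure_sigma_subadditive Q mF measurable_sphere SF) _.
  by rewrite eseries0 // => n _ _; exact: F0.
by rewrite hQ.1 lee_fin ler10.
Qed.

End sphere.

(** Both marginals of the restriction of a product measure to [K] have constant
    densities when all sections of [K] have the same mass. *)
Section coupling.
Context d1 d2 (T1 : measurableType d1) (T2 : measurableType d2) (R : realType).
Context (mu : {sigma_finite_measure set T1 -> \bar R}).
Context (nu : {sigma_finite_measure set T2 -> \bar R}).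
Context (K : set (T1 * T2)) (mK : measurable K).
Local Open Scope ereal_scope.

Lemma integral_coupling_fst (D : set T1) f c : measurable D -> mu (~` D) = 0 ->
  measurable_fun setT f -> (forall x, 0 <= f x) -> 0 <= c ->
  (forall x, D x -> nu (xsection K x) = c) ->
  \int[mu]_x \int[nu]_y (f x * (\1_K (x, y))%:E) = c * \int[mu]_x f x.
Proof.
move=> mD D0 mf f0 c0 Kc; rewrite -ge0_integralZl//.
apply: (@integral_eq_on _ _ _ mu _ _ D) => //.
- by move=> x; exact: mule_ge0.
- exact: measurable_funeM.
move=> x Dx.
have mKx : measurable (xsection K x) by exact: measurable_xsection.
transitivity (\int[nu]_y (f x * (\1_(xsection K x) y)%:E)).
  by apply: eq_integral => y _; rewrite !indicE mem_xsection.
rewrite ge0_integralZl//; last by apply/measurable_EFinP; exact: measurable_indic.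
by rewrite integral_indic// setIT muleC; congr (_ * _); exact: Kc.
Qed.

Lemma integral_coupling_snd (E : set T2) g c : measurable E -> nu (~` E) = 0 ->
  measurable_fun setT g -> (forall y, 0 <= g y) -> 0 <= c ->
  (forall y, E y -> mu (ysection K y) = c) ->
  \int[mu]_x \int[nu]_y (g y * (\1_K (x, y))%:E) = c * \int[nu]_y g y.
Proof.
move=> mE E0 mg g0 c0 Kc; rewrite -ge0_integralZl//.
rewrite (@fubini_tonelli _ _ _ _ _ mu nu (fun z => g z.2 * (\1_K z)%:E)); first last.
- by move=> z; rewrite mule_ge0// lee_fin.
- apply: emeasurable_funM; first exact: measurableT_comp.
  by apply/measurable_EFinP; exact: measurable_indic.
apply: (@integral_eq_on _ _ _ nu _ _ E) => //.
- by move=> y; exact: mule_ge0.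
- exact: measurable_funeM.
move=> y Ey.
have mKy : measurable (ysection K y) by exact: measurable_ysection.
transitivity (\int[mu]_x (g y * (\1_(ysection K y) x)%:E)).
  by apply: eq_integral => x _; rewrite !indicE mem_ysection.
rewrite ge0_integralZl//; last by apply/measurable_EFinP; exact: measurable_indic.
by rewrite integral_indic// setIT muleC; congr (_ * _); exact: Kc.
Qed.

End coupling.

Section sphere_projection.
Context (R : realType) (p : nat) (p0 : (0 < p)%N).
Context (Q : probability 'M[R]_p R) (hQ : uniform_sym_sphere Q).
Local Open Scope ereal_scope.
Implicit Types (x y H : 'M[R]_p).
Notation S := (@sym_sphere R p).

Definition sphere_proj H : 'M[R]_p := (p%:R / fnorm H) *: H.

Definition sym_nonzero : set 'M[R]_p := [set H | H^T = H /\ (0 < fsq H)%R].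

Lemma sphere_projP H : sym_nonzero H -> S (sphere_proj H).
Proof.
move=> [Hs H0]; apply/sphereE; split; first by rewrite /sphere_proj linearZ /= Hs.
by rewrite fsqZ expr_div_n fnorm_sqr mulfVK ?gt_eqF.
Qed.

Lemma measurable_sphere_proj : measurable_fun setT sphere_proj.
Proof.
apply: measurable_scalemx => //; apply: measurable_funM => //.
apply: (measurableT_comp (@measurable_inv R)).
by apply: (measurableT_comp (@measurable_sqrt R)); exact: measurable_fsq.
Qed.

Lemma measurable_sym_nonzero : measurable sym_nonzero.
Proof.
rewrite (_ : sym_nonzero = @sym_mx R p `&` (fun M : 'M[R]_p => fsq M) @^-1` [set` `]0%R, +oo[%R]).
  apply: measurableI; first exact: measurable_sym.
  by rewrite -[X in measurable X]setTI; exact: measurable_fsq.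
by apply/seteqP; split=> x /=; rewrite in_itv /= andbT.
Qed.

Lemma goe_measure_sym_nonzero : @goe_measure R p (~` sym_nonzero) = 0.
Proof.
have mZ : measurable [set M : 'M[R]_p | fsq M = 0%R].
  rewrite (_ : mkset _ = (fun M : 'M[R]_p => fsq M) @^-1` [set 0%R])//.
  by rewrite -[X in measurable X]setTI; exact: measurable_fsq.
have mN : measurable (~` @sym_mx R p) by apply: measurableC; exact: measurable_sym.
have sub : ~` sym_nonzero `<=` ~` @sym_mx R p `|` [set M : 'M[R]_p | fsq M = 0%R].
  move=> M /= /not_andP[|/negP]; first by left.
  by rewrite lt0r fsq_ge0 andbT negbK => /eqP; right.
apply: (subset_measure0 (measurableC measurable_sym_nonzero) (measurableU _ _ mN mZ) sub).
by apply: null_set_setU => //; [exact: goe_measure_sym|exact: goe_measure_fsq0].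
Qed.

Lemma uniform_measureC : Q (~` S) = 0.
Proof. by rewrite probability_setC ?hQ.1 ?subee//; exact: measurable_sphere. Qed.

Section near_projection.
Context (e : R) (e0 : (0 < e)%R).

Definition near_proj : set ('M[R]_p * 'M[R]_p) :=
  (sym_nonzero `*` S) `&` [set Hy | (fsq (sphere_proj Hy.1 - Hy.2) < e ^+ 2)%R].

Lemma measurable_near_proj : measurable near_proj.
Proof.
apply: measurableI.
  by apply: measurableX; [exact: measurable_sym_nonzero|exact: measurable_sphere].
rewrite (_ : mkset _ = (fun Hy => fsq (sphere_proj Hy.1 - Hy.2)) @^-1`
  [set` `]-oo, (e ^+ 2)%R[%R]); last by apply/seteqP; split=> Hy /=; rewrite in_itv.
rewrite -[X in measurable X]setTI.
have mf : measurable_fun setT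
    (fun Hy : 'M[R]_p * 'M[R]_p => fsq (sphere_proj Hy.1 - Hy.2)).
  apply: measurable_fsq; apply: measurable_submx; last exact: measurable_snd.
  exact: (measurableT_comp measurable_sphere_proj measurable_fst).
exact: mf.
Qed.

Lemma near_proj_xsection H x : sym_nonzero H -> S x ->
  Q (xsection near_proj H) = Q (S `&` mxball x e).
Proof.
move=> Hg Sx; rewrite -(sphere_ball_const hQ e (sphere_projP Hg) Sx); congr (Q _).
apply/seteqP; split=> y; rewrite /xsection /= inE.
  by move=> [[_ Sy] h].
by move=> [Sy h]; split.
Qed.

(** The squared distance from [y] to the projection of [H] is
    [2 p ^ 2 - 2 p <y, H> / |H|], whose law is independent of [y] by
    [goe_isotropic]. *)
Lemma near_proj_ysection x y : S x -> S y ->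
  @goe_measure R p (ysection near_proj x) = @goe_measure R p (ysection near_proj y).
Proof.
pose A : set (R * R) :=
  [set uq | (2 * p%:R ^+ 2 - 2 * (p%:R / Num.sqrt (2 * uq.2) * uq.1) < e ^+ 2)%R].
have mA : measurable A.
  rewrite (_ : A = (fun uq => 2 * p%:R ^+ 2 - 2 * (p%:R / Num.sqrt (2 * uq.2) * uq.1))%R @^-1`
    [set` `]-oo, (e ^+ 2)%R[%R]); last by apply/seteqP; split=> uq /=; rewrite in_itv.
  rewrite -[X in measurable X]setTI.
  have mf : measurable_fun setT (fun uq : R * R =>
      (2 * p%:R ^+ 2 - 2 * (p%:R / Num.sqrt (2 * uq.2) * uq.1))%R).
    apply: measurable_funB => //; apply: measurable_funM => //.
    apply: measurable_funM => //.
    apply: measurable_funM => //; apply: (measurableT_comp (@measurable_inv R)).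
    apply: (measurableT_comp (@measurable_sqrt R)).
    by apply: measurable_funM => //; exact: measurable_snd.
  exact: mf.
have mphi : measurable_fun setT (fun uq => (\1_A uq)%:E : \bar R).
  by apply/measurable_EFinP; exact: measurable_indic.
have mdot z : measurable_fun setT (fun H => mxdot z H).
  apply: measurable_sum => i; apply: measurable_sum => j.
  by apply: measurable_funM => //; exact: measurable_entry.
have key z : S z -> @goe_measure R p (ysection near_proj z) =
    \int[@goe_measure R p]_H (\1_A (mxdot z H, fsq H / 2)%R)%:E.
  move=> Sz; have [zs zp] := (sphereE z).1 Sz.
  have mK : measurable (ysection near_proj z).
    exact: measurable_ysection measurable_near_proj.
  rewrite -[in LHS](setIT (ysection near_proj z)) -integral_indic//.
  apply: (integral_eq_on measurable_sym_nonzero goe_measure_sym_nonzero).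
  - by move=> H; rewrite lee_fin.
  - apply: (measurableT_comp mphi); apply: measurable_fun_pair; first exact: mdot.
    by apply: measurable_funM => //; exact: measurable_fsq.
  move=> H Hg; congr (_ %:E); rewrite !indicE; congr (nat_of_bool _)%:R.
  have [_ fp] := (sphereE _).1 (sphere_projP Hg).
  have dE : fsq (sphere_proj H - z) =
      (2 * p%:R ^+ 2 - 2 * (p%:R / fnorm H * mxdot z H))%R.
    by rewrite fsqB fp zp mxdotZl [mxdot H z]mxdotC; ring.
  have qE : (2 * (fsq H / 2) = fsq H)%R by field.
  rewrite mem_ysection; apply/idP/idP; rewrite !inE /A /= qE -/(fnorm H).
    by move=> [_ /=]; rewrite dE.
  by move=> h; split; [|rewrite /= dE].
move=> Sx Sy; rewrite (key x Sx) (key y Sy).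
have [xs xp] := (sphereE x).1 Sx; have [ys yp] := (sphereE y).1 Sy.
apply: (@goe_isotropic R p x y (fun uq => (\1_A uq)%:E)) => //.
by rewrite xp yp.
Qed.

End near_projection.

(** The pairs [(H, y)] of [near_proj] form a set whose [H]-sections all have one
    mass and whose [y]-sections all have one mass.  Integrating [g] at either of
    the two nearby points over this set gives, up to the common mass, the two sides
    of the equation, and their difference is at most [L] times the radius. *)
Lemma uniform_is_projection (g : 'M[R]_p -> \bar R) (L : R) :
  measurable_fun setT g -> (forall x, 0 <= g x) -> (0 <= L)%R ->
  (forall x y, S x -> S y -> g x <= g y + (L * fnorm (x - y))%:E) ->
  \int[Q]_x g x = \int[@goe_measure R p]_H g (sphere_proj H).
Proof.
move=> mg g0 L0 gL.
have [x0 Sx0] : exists x, S x.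
  apply: contrapT => nS; have := hQ.1; rewrite (_ : S = set0) ?measure0.
    by move=> /eqP; rewrite eq_sym onee_eq0.
  by rewrite -subset0 => x Sx; apply: nS; exists x.
have [nu nuE] : exists nu : {sigma_finite_measure set 'M[R]_p -> \bar R},
    @goe_measure R p = nu :> (set 'M[R]_p -> \bar R).
  apply: sigma_finite_pack; exists (fun=> setT); first by rewrite bigcup_const.
  by move=> _; split => //; rewrite goe_measure_setT ltry.
have nu1 : nu setT = 1 by rewrite -nuE goe_measure_setT.
have mgp : measurable_fun setT (fun H => g (sphere_proj H)).
  exact: (measurableT_comp mg measurable_sphere_proj).
rewrite nuE.
have close (e : R) : (0 < e)%R ->
    \int[Q]_x g x <= \int[nu]_H g (sphere_proj H) + (L * e)%:E /\
    \int[nu]_H g (sphere_proj H) <= \int[Q]_x g x + (L * e)%:E.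
  move=> e0; have mK := measurable_near_proj e.
  pose c := Q (S `&` mxball x0 e); pose c' := nu (ysection (near_proj e) x0).
  have c0 : 0 < c by exact: sphere_ball_gt0.
  have fst_ f : measurable_fun setT f -> (forall x, 0 <= f x) ->
      \int[nu]_H \int[Q]_y (f H * (\1_(near_proj e) (H, y))%:E) = c * \int[nu]_H f H.
    move=> mf f0; apply: (integral_coupling_fst mK measurable_sym_nonzero) => //.
    - by rewrite -nuE goe_measure_sym_nonzero.
    - exact: ltW.
    - by move=> H Hg; exact: near_proj_xsection.
  have snd_ f : measurable_fun setT f -> (forall x, 0 <= f x) ->
      \int[nu]_H \int[Q]_y (f y * (\1_(near_proj e) (H, y))%:E) = c' * \int[Q]_y f y.
    move=> mf f0; apply: (integral_coupling_snd (mu := nu) (nu := Q) mK (@measurable_sphere R p) _ mf f0) => //.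
    - exact: uniform_measureC.
    - exact: measure_ge0.
    - by move=> y Sy; rewrite /c' -nuE; exact: near_proj_ysection.
  have cE : c' = c.
    have := fst_ (cst 1) (measurable_cst _) (fun=> lee01).
    rewrite (snd_ (cst 1) (measurable_cst _) (fun=> lee01)).
    have one (m : {measure set 'M[R]_p -> \bar R}) : m setT = 1 ->
        \int[m]_x cst 1 x = 1.
      by move=> m1; rewrite integral_cst// mul1e; exact: m1.
    by rewrite (one nu nu1) (one Q (probability_setT Q)) !mule1.
  have cfin : c \is a fin_num.
    apply: (fin_num_measure Q); apply: measurableI; first exact: measurable_sphere.
    exact: measurable_mxball.
  have Le0 : (0 <= L * e)%R by rewrite mulr_ge0// ltW.
  have nearby H y : near_proj e (H, y) ->
      g y <= g (sphere_proj H) + (L * e)%:E /\ g (sphere_proj H) <= g y + (L * e)%:E.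
    move=> [[/= Hg Sy] /= d]; have Sp := sphere_projP Hg.
    have dn : (fnorm (sphere_proj H - y) < e)%R by apply/mxballP => //; exact: ltW.
    have dL : (L * fnorm (sphere_proj H - y) <= L * e)%R by rewrite ler_wpM2l// ltW.
    split.
      apply: le_trans (gL y (sphere_proj H) Sy Sp) _; apply: leeD2l.
      by rewrite lee_fin -[(y - _)%R]opprB fnormN.
    by apply: le_trans (gL (sphere_proj H) y Sp Sy) _; apply: leeD2l; rewrite lee_fin.
  have dbl (f h : 'M[R]_p -> 'M[R]_p -> \bar R) : (forall H y, 0 <= f H y) ->
      (forall H y, near_proj e (H, y) -> f H y <= h H y) ->
      \int[nu]_H \int[Q]_y (f H y * (\1_(near_proj e) (H, y))%:E) <=
      \int[nu]_H \int[Q]_y (h H y * (\1_(near_proj e) (H, y))%:E).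
    move=> f0 fh; have f10 H y : 0 <= f H y * (\1_(near_proj e) (H, y))%:E.
      by rewrite mule_ge0// lee_fin.
    apply: le_integral_nonmeasurable => H; first exact: integral_ge0.
    apply: le_integral_nonmeasurable => y //; rewrite indicE.
    have [/set_mem yK|_] := boolP (_ \in _); rewrite ?mule1 ?mule0//.
    exact: fh.
  have shift f : measurable_fun setT f -> (forall x, 0 <= f x) ->
      forall m : {measure set 'M[R]_p -> \bar R}, m setT = 1 ->
      \int[m]_x (f x + (L * e)%:E) = \int[m]_x f x + (L * e)%:E.
    move=> mf f0 m m1; rewrite ge0_integralD//.
    by rewrite integral_cst// m1 mule1.
  have shift_ge0 f x : (forall x, 0 <= f x) -> 0 <= f x + (L * e)%:E :> \bar R.
    by move=> f0; rewrite adde_ge0// lee_fin.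
  have mshift f : measurable_fun setT f ->
      measurable_fun setT (fun x : 'M[R]_p => f x + (L * e)%:E).
    by move=> mf; apply: emeasurable_funD => //; exact: measurable_cst.
  pose gp H := g (sphere_proj H).
  have gp0 H : 0 <= gp H by exact: g0.
  rewrite -/(gp); split; rewrite -(@lee_pmul2l _ c)//.
    rewrite -(shift gp mgp gp0 nu nu1).
    rewrite -(fst_ _ (mshift gp mgp) (fun x => shift_ge0 gp x gp0)).
    rewrite -[X in X * _ <= _]cE -(snd_ g mg g0).
    by apply: dbl => // H y /nearby[].
  rewrite -(shift g mg g0 Q (probability_setT Q)) -(fst_ gp mgp gp0).
  rewrite -[X in _ <= X * _]cE -(snd_ _ (mshift g mg) (fun x => shift_ge0 g x g0)).
  by apply: dbl => // H y /nearby[].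
apply/eqP; rewrite eq_le.
have L1 : (0 < L + 1)%R by lra.
have Le (e : R) : (0 < e)%R -> (L * (e / (L + 1)) <= e)%R.
  move=> e0; rewrite mulrCA ler_piMr ?ltW// ltr_pdivrMr//; lra.
by apply/andP; split; apply/lee_addgt0Pr => e e0;
  have [h1 h2] := close (e / (L + 1))%R (divr_gt0 e0 L1);
  (apply: le_trans (_ : _ <= _ + (L * (e / (L + 1)))%:E) _;
    [eassumption|rewrite leeD2l// lee_fin; exact: Le]).
Qed.

End sphere_projection.

(** * The comparison of the two mixtures *)

Section mixtures.
Context (R : realType) (n p : nat) (n0 : (0 < n)%N) (p0 : (0 < p)%N).
Context (Q : probability 'M[R]_p R) (hQ : uniform_sym_sphere Q).
Context (omega : R) (w0 : 0 <= omega).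
Local Open Scope ereal_scope.
Implicit Types (x y H : 'M[R]_p).

Let le_goe_integral (f g : 'M[R]_p -> \bar R) :
  measurable_fun setT f -> measurable_fun setT g -> (forall H, 0 <= f H) ->
  (forall H, 0 <= g H) -> (forall H, sym_nonzero H -> f H <= g H) ->
  \int[@goe_measure R p]_H f H <= \int[@goe_measure R p]_H g H.
Proof.
move=> mf mg f0 g0 fg; apply: ae_ge0_le_integral => //.
exists (~` @sym_nonzero R p); split.
- by apply: measurableC; exact: measurable_sym_nonzero.
- exact: goe_measure_sym_nonzero.
- by move=> H /= nfg Hg; apply: nfg => _; exact: fg.
Qed.

Lemma fnorm_sphere_proj H : (0 < fsq H)%R -> fnorm (sphere_proj H) = p%:R.
Proof.
move=> H0; rewrite fnormZ ger0_norm ?divr_ge0 ?fnorm_ge0//.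
by rewrite divfK// gt_eqF// sqrtr_gt0.
Qed.

Lemma fnorm_sub_sphere_proj H : (0 < fsq H)%R ->
  fnorm (H - sphere_proj H) = `|fnorm H - p%:R|%R.
Proof.
move=> H0; have h0 : (0 < fnorm H)%R by rewrite sqrtr_gt0.
rewrite -[in X in fnorm (X - _)](scale1r H) /sphere_proj -scalerBl fnormZ.
rewrite -[X in (_ * X)%R]ger0_norm ?ltW// -normrM mulrBl mul1r divfK//.
by rewrite gt_eqF.
Qed.

(** [| |H| - p | * (|H| + p) = | |H| ^ 2 - p ^ 2 |], and [|H| + p >= p]. *)
Lemma dist_sphere_le H : (0 < fsq H)%R ->
  (fnorm (H - sphere_proj H) *
     (1 + omega / n%:R * (fnorm H + fnorm (sphere_proj H))) <=
   (p%:R^-1 + omega / n%:R) * `|fsq H - p%:R ^+ 2|)%R.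
Proof.
move=> H0; have h0 : (0 < fnorm H)%R by rewrite sqrtr_gt0.
have pR : (0 < p%:R :> R)%R by rewrite ltr0n.
rewrite fnorm_sub_sphere_proj// fnorm_sphere_proj// -fnorm_sqr subr_sqr normrM.
rewrite [X in (_ <= _ * (_ * X))%R]ger0_norm ?addr_ge0 ?fnorm_ge0//.
rewrite mulrDr mulr1 mulrDl; apply: lerD.
  rewrite mulrCA ler_peMr ?normr_ge0// mulrC ler_pdivlMr// mul1r.
  by rewrite lerDr fnorm_ge0.
by rewrite mulrCA.
Qed.

Lemma abse_sub_le (u v : \bar R) (c : R) : u \is a fin_num -> v \is a fin_num ->
  u <= v + c%:E -> v <= u + c%:E -> `|u - v| <= c%:E.
Proof.
case: u v => [u||] [v||]// _ _; rewrite -!EFinD !lee_fin => uv vu.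
by rewrite ler_norml; apply/andP; split; lra.
Qed.

(** The projection to the sphere couples the two mixing laws, and the distance
    moved is integrated by [goe_radius]; [34 = 2 * 17]. *)
Lemma tv_mixtures_le :
  tv_dist (mixture_law n Q omega) (mixture_law n (goe_law p) omega) <=
  (34 * expR 1 * (omega * (Num.sqrt n%:R)^-1 * (1 + omega * (p%:R / n%:R))))%:E.
Proof.
apply: ge_ereal_sup => _ [B mB <-].
have QC : Q (~` @sym_mx R p) = 0.
  have mS := @measurable_sphere R p; have ms := @measurable_sym R p.
  apply: (subset_measure0 (measurableC ms) (measurableC mS) _ (uniform_measureC hQ)).
  by apply: subsetC => x [].
have GC : @goe_measure R p (~` @sym_mx R p) = 0 by exact: goe_measure_sym.
rewrite goe_measureE !mixture_law_fun//.
pose a := sample_law_fun (n := n) omega B.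
have a0 H : 0 <= a H by exact: sample_law_fun_ge0.
have ma : measurable_fun setT a by exact: measurable_sample_law_fun.
have wn : (0 <= omega / n%:R)%R by rewrite divr_ge0.
pose k : R := (2 * Num.sqrt n%:R * (omega / n%:R))%R.
have k0 : (0 <= k)%R by rewrite mulr_ge0// mulr_ge0// sqrtr_ge0.
have alip x y : x^T = x -> y^T = y -> a x <= a y +
    (k * (fnorm (x - y) * (1 + omega / n%:R * (fnorm x + fnorm y))))%:E.
  move=> xs ys; rewrite /a -!sample_law_funE// mulrA.
  exact: sample_law_of_lip.
rewrite -/a (@uniform_is_projection R p p0 Q hQ a (k * (1 + omega / n%:R * (p%:R + p%:R)))%R)//; first last.
- move=> x y /sphereE [xs xp] /sphereE [ys yp]; apply: le_trans (alip x y xs ys) _.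
  by rewrite leeD2l// lee_fin /fnorm xp yp sqrtr_sqr ger0_norm// mulrA mulrAC.
- by rewrite mulr_ge0// addr_ge0// mulr_ge0// addr_ge0.
pose ap H := a (sphere_proj H).
have ap0 H : 0 <= ap H by exact: a0.
have map_ : measurable_fun setT ap.
  by apply: (measurableT_comp ma); exact: measurable_sphere_proj.
have le1 H : H^T = H -> a H <= 1.
  move=> Hs; rewrite /a -sample_law_funE//.
  by have /andP[] := sample_law_le1 (law_precision_posdef n omega Hs) mB.
have int1 f : measurable_fun setT f -> (forall H, 0 <= f H) ->
    (forall H, sym_nonzero H -> f H <= 1) ->
    \int[@goe_measure R p]_H f H \is a fin_num.
  move=> mf f0 f1; rewrite ge0_fin_numE ?integral_ge0//.
  apply: (@le_lt_trans _ _ (\int[@goe_measure R p]_H cst 1 H)).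
    by apply: le_goe_integral.
  rewrite integral_cst// mul1e.
  by apply: (@le_lt_trans _ _ 1); [rewrite -(goe_measure_setT R p)|rewrite ltry].
pose K : R := (k * (p%:R^-1 + omega / n%:R))%R.
have K0 : (0 <= K)%R by rewrite mulr_ge0// addr_ge0// invr_ge0.
pose r H : \bar R := (`|fsq H - p%:R ^+ 2|%R)%:E.
have r0 H : 0 <= r H by rewrite lee_fin.
have mr : measurable_fun setT r.
  apply/measurable_EFinP; apply: measurableT_comp => //.
  by apply: measurable_funB => //; exact: measurable_fsq.
pose d H := K%:E * r H.
have d0 H : 0 <= d H by rewrite mule_ge0// lee_fin.
have md : measurable_fun setT d by exact: measurable_funeM.
have near H : sym_nonzero H -> a H <= ap H + d H /\ ap H <= a H + d H.
  move=> Hg; have [Hs H0] := Hg.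
  have [ps _] := (sphereE _).1 (sphere_projP Hg).
  have kd : (k * (fnorm (H - sphere_proj H) *
      (1 + omega / n%:R * (fnorm H + fnorm (sphere_proj H)))))%:E <= d H.
    by rewrite /d /r -EFinM lee_fin /K -[leRHS]mulrA ler_wpM2l// dist_sphere_le.
  split; first by apply: le_trans (alip _ _ Hs ps) _; exact: leeD2l.
  apply: le_trans (alip _ _ ps Hs) _; apply: leeD2l; apply: le_trans kd.
  by rewrite -opprB fnormN [(fnorm (sphere_proj H) + _)%R]addrC.
have intd : \int[@goe_measure R p]_H d H <= (K * (17 * expR 1 * p%:R))%:E.
  rewrite (ge0_integralZl _ measurableT mr (fun H _ => r0 H))// (EFinM K).
  by apply: lee_wpmul2l; [rewrite lee_fin|exact: goe_radius].
have le_shift f g : measurable_fun setT f -> measurable_fun setT g ->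
    (forall H, 0 <= f H) -> (forall H, 0 <= g H) ->
    (forall H, sym_nonzero H -> f H <= g H + d H) ->
    \int[@goe_measure R p]_H f H <=
    \int[@goe_measure R p]_H g H + (K * (17 * expR 1 * p%:R))%:E.
  move=> mf mg f0 g0 fg.
  apply: (@le_trans _ _ (\int[@goe_measure R p]_H (g H + d H))).
    apply: le_goe_integral => //; first exact: emeasurable_funD.
    by move=> H; rewrite adde_ge0.
  rewrite (ge0_integralD _ measurableT (fun H _ => g0 H) mg (fun H _ => d0 H) md).
  exact: leeD2l.
have le_ap := le_shift _ _ ma map_ a0 ap0 (fun H Hg => (near H Hg).1).
have ap_le := le_shift _ _ map_ ma ap0 a0 (fun H Hg => (near H Hg).2).
have fa := int1 a ma a0 (fun H Hg => le1 H Hg.1).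
have fap : \int[@goe_measure R p]_H ap H \is a fin_num.
  by apply: int1 => // H /sphere_projP/sphereE[ps _]; exact: le1.
apply: le_trans (abse_sub_le fap fa ap_le le_ap) _.
rewrite lee_fin le_eqVlt; apply/orP; left; apply/eqP.
have pR : (p%:R != 0 :> R)%R by rewrite pnatr_eq0 -lt0n.
have s0 : (Num.sqrt n%:R != 0 :> R)%R by rewrite gt_eqF// sqrtr_gt0 ltr0n.
rewrite /K /k; move: (Num.sqrt n%:R) s0 (sqr_sqrtr (ler0n R n)) => s s0 <-.
by field; rewrite s0.
Qed.

End mixtures.

Theorem proposition1 (R : realType) (p : nat -> nat) (gamma : R)
    (Qsph : forall n : nat, probability 'M[R]_(p n) R)
    (hQsph : forall n : nat, uniform_sym_sphere (Qsph n))
    (hp : p n @[n --> \oo] --> \oo)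
    (hgamma : 0 < gamma)
    (hpn : (p n)%:R / n%:R @[n --> \oo] --> gamma)
    (Omega : R) (hOmega : 0 <= Omega) :
  exists C : R, \forall n \near \oo,
    (ereal_sup [set tv_dist (mixture_law n (Qsph n) omega)
                            (mixture_law n (goe_law (p n)) omega)
               | omega in `[0%R, Omega]%classic]
     <= (C * (Num.sqrt (p n)%:R)^-1)%:E)%E.
Proof.
exists (34 * expR 1 * (Omega * Num.sqrt (gamma + 1) * (1 + Omega * (gamma + 1)))).
have g1 : gamma < gamma + 1 by lra.
near=> n.
have n0 : (0 < n)%N by near: n; exact: nbhs_infty_gt.
have p0 : (0 < p n)%N by near: n; exact: (hp _ (nbhs_infty_gt 0)).
have pn : (p n)%:R / n%:R <= gamma + 1 by near: n; exact: (cvgr_le gamma hpn).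
apply: ge_ereal_sup => _ [omega + <-]; rewrite /= in_itv /= => /andP[w0 wO].
apply: le_trans (tv_mixtures_le n0 p0 (hQsph n) w0) _; rewrite lee_fin -!mulrA.
do 2! rewrite ler_wpM2l ?expR_ge0//.
have sn : 0 < Num.sqrt n%:R :> R by rewrite sqrtr_gt0 ltr0n.
have sp : 0 < Num.sqrt (p n)%:R :> R by rewrite sqrtr_gt0 ltr0n.
have root : (Num.sqrt n%:R)^-1 <= Num.sqrt (gamma + 1) * (Num.sqrt (p n)%:R)^-1.
  rewrite ler_pdivlMr// mulrC -sqrtrV// -sqrtrM//.
  exact: ler_wsqrtr.
rewrite !mulrA [(Omega * _ * _ / _)%R]mulrAC -[(Omega * _ / _)%R]mulrA.
have q0 : 0 <= (p n)%:R / n%:R :> R by rewrite divr_ge0.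
apply: ler_pM.
- by rewrite mulr_ge0// invr_ge0 sqrtr_ge0.
- by rewrite -mulrA addr_ge0// mulr_ge0.
- by apply: ler_pM; rewrite // invr_ge0 sqrtr_ge0.
- by rewrite lerD2l -mulrA; apply: ler_pM.
Unshelve. all: by end_near.
Qed.
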